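(* Let $G\in\mathbb{R}[z]$ be a polynomial such that $\operatorname{Re}G(it)\to-\infty$ as $t\to\pm\infty$ ($t$ real) and $G'\in\mathbb{R}[z]\cap\mathscr{L}\text{-}\mathscr{P}$. Let $F(z)$ be the entire function possessing the representation $$F(z)=\int_{-\infty}^\infty e^{G(it)}e^{itz}\,dt.$$ Then $F\in\mathscr{L}\text{-}\mathscr{P}$.
   Context: The Laguerre–Pólya class $\mathscr{L}\text{-}\mathscr{P}$ is the set of real entire functions of the form $\varphi(x)=cx^me^{-ax^2+bx}\prod_{k=1}^\omega\left(1+\frac{x}{x_k}\right)e^{-x/x_k}$ ($0\le\omega\le\infty$), where $b,c,x_k\in\mathbb{R}$, $m$ is a non-negative integer, $a\ge0$, $x_k\ne0$, and $\sum_{k=1}^\omega1/x_k^2<\infty$. *)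

(* Defs.v *)
From HB Require Import structures.
From mathcomp Require Import all_boot all_order all_algebra.
From mathcomp Require Import all_classical all_reals all_analysis.
From mathcomp Require Import complex.

Set Implicit Arguments.
Unset Strict Implicit.
Unset Printing Implicit Defensive.

Import Order.TTheory GRing.Theory Num.Theory.
Import numFieldNormedType.Exports.

Local Open Scope classical_set_scope.
Local Open Scope ring_scope.
Local Open Scope complex_scope.

Definition cexp (R : realType) (z : R[i]) : R[i] :=
  (expR (complex.Re z))%:C * (cos (complex.Im z) +i* sin (complex.Im z)).

(* [R[i]^o] is [R[i]] as a normed module over itself, so the increments in the
   difference quotient range over all small complex numbers. *)
Definition entire (R : realType) (f : R[i] -> R[i]) : Prop :=
  forall z : R[i]^o, derivable (f : R[i]^o -> R[i]^o) z (1 : R[i]^o).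

Definition real_on_reals (R : realType) (f : R[i] -> R[i]) : Prop :=
  forall x : R, complex.Im (f x%:C) = 0.

(* [None] stands for infinity. *)
Definition below (omega : option nat) (k : nat) : bool :=
  if omega is Some n then (k < n)%N else true.

Definition lp_factor (R : realType) (x : R) (z : R[i]) : R[i] :=
  (1 + z / x%:C) * cexp (- (z / x%:C)).

(* For [omega = Some N] the sequence of partial products is stationary from
   rank [N] on, so its limit is the finite product. The terms [x k] with
   [k >= omega] are irrelevant. Since the sum of the [1 / x_k ^ 2] is finite,
   the partial products converge locally uniformly, so pointwise convergence
   determines the same function. *)
Definition laguerre_polya (R : realType) (phi : R[i] -> R[i]) : Prop :=
  [/\ entire phi, real_on_reals phi &
    exists (omega : option nat) (a b c : R) (m : nat) (x : nat -> R),
      [/\ 0 <= a,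
          forall k, below omega k -> x k != 0,
          (\sum_(0 <= k <oo | below omega k) ((x k ^+ 2)^-1)%:E < +oo)%E &
          forall z : R[i],
            (fun n : nat => (c%:C * z ^+ m
               * cexp (- (a%:C * z ^+ 2) + b%:C * z)
               * \prod_(0 <= k < n | below omega k) lp_factor (x k) z : R[i]^o))
              @ \oo --> (phi z : R[i]^o)]].

Definition ceval (R : realType) (p : {poly R}) (z : R[i]) : R[i] :=
  (map_poly (real_complex R) p).[z].

(* Meaningful only when both parts are Lebesgue integrable: [Rintegral] returns a
   default value otherwise. *)
Definition cintegral (R : realType) (f : R -> R[i]) : R[i] :=
  (\int[lebesgue_measure]_t complex.Re (f t))
    +i* (\int[lebesgue_measure]_t complex.Im (f t)).

(* Main.v *)
(* Integrating the derivative of [e^(G(it) + itz)] in [t] gives [z F + G'(d/dz) F = 0].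
   This equation is discretized as [(2/eps) tan(eps z/2) f + Q(d/dz) f = 0] for
   [f = sum_(|k| <= N) c_k e^(i eps k z)], where [Q] is a real-rooted perturbation of
   [G'] with [Q (i eps N) = 2 i / eps], so that the recurrence for the [c_k] stops at
   [k = N]. Regard [f] as a polynomial in [e^(i eps z)]. If it had zeros inside the
   unit circle, then at one of least modulus each factor [d/dz - a], [a] real, of
   [Q(d/dz)] would lower the multiplicity, whereas the equation preserves it; hence
   all the zeros are on the unit circle. Replacing [e^(i eps z)] by the Cayley
   transform [(1 + i eps z/2) / (1 - i eps z/2)] and clearing denominators yields
   polynomials with real zeros. As [eps N] tends to infinity and [eps] to 0 they are
   Riemann sums for a multiple of [F], dominated by a Gaussian, and an entire pointwise
   limit of real polynomials with real zeros is in the Laguerre-Polya class. *)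
Require Import Defs.
From mathcomp Require Import all_boot all_order all_algebra.
From mathcomp Require Import all_classical all_reals all_analysis.
From mathcomp Require Import complex measurable_realfun polyorder polyrcf.
From mathcomp Require Import ring lra.

Set Implicit Arguments.
Unset Strict Implicit.

Import Order.TTheory GRing.Theory Num.Theory.
Import numFieldNormedType.Exports.

Local Open Scope classical_set_scope.
Local Open Scope ring_scope.
Local Open Scope complex_scope.

(** * The complex modulus *)

(** [F] itself offers no zero to start from: comparing multiplicities needs an extremal zero, and an
    entire function may have none. The discrete solution has finitely many zeros modulo its period,
    hence one of least modulus; the strict inequality needed there holds because the symmetry
    [c_(-k) = conj c_k] makes the moduli of the zeros have product 1.

    With [T = eps N] the perturbation is [Q = kap (1 - beta X)^2 (1 - X^2 / T) G']. The square turns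
    [G'(iT)] onto the positive imaginary axis, and [kap] absorbs the rounding of [N] to an integer.
    The last factor equals [1 + T] at [iT], which makes [eps T] of order [1 / T] even if [G'] is
    linear. The Cayley transform relies on this: it replaces [e^(i eps k z)] with an error governed
    by [N (eps |z|)^2 = eps T |z|^2].

    The limit theorem has only pointwise convergence at its disposal. Limits are taken along an
    ultrafilter, and factors of genus two make tails uniformly small under a mere bound on the
    inverse squares of the zeros; square mass lost in the limit becomes the Gaussian factor. *)

Notation normc := Normc.normc.

Section ComplexModulus.
Context {R : realType}.
Implicit Types (z w : R[i]) (x y : R).

Lemma ReCD z w : complex.Re (z + w) = complex.Re z + complex.Re w.
Proof. by case: z w => [a b] [c d]. Qed.

Lemma ImCD z w : complex.Im (z + w) = complex.Im z + complex.Im w.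
Proof. by case: z w => [a b] [c d]. Qed.

Lemma ReCN z : complex.Re (- z) = - complex.Re z.
Proof. by case: z. Qed.

Lemma ImCN z : complex.Im (- z) = - complex.Im z.
Proof. by case: z. Qed.

Lemma ReCM z w : complex.Re (z * w) =
  complex.Re z * complex.Re w - complex.Im z * complex.Im w.
Proof. by case: z w => [a b] [c d]. Qed.

Lemma ImCM z w : complex.Im (z * w) =
  complex.Re z * complex.Im w + complex.Im z * complex.Re w.
Proof. by case: z w => [a b] [c d]. Qed.

Lemma ReCJ z : complex.Re z^* = complex.Re z.
Proof. by case: z. Qed.

Lemma ImCJ z : complex.Im z^* = - complex.Im z.
Proof. by case: z. Qed.

Lemma complex_eqP z w : complex.Re z = complex.Re w ->
  complex.Im z = complex.Im w -> z = w.
Proof. by case: z w => [a b] [c d] /= -> ->. Qed.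

Lemma conjcM z w : conjc (z * w) = conjc z * conjc w.
Proof. exact: (rmorphM (@conjc R)). Qed.

Lemma conjcD z w : conjc (z + w) = conjc z + conjc w.
Proof. exact: (rmorphD (@conjc R)). Qed.

Lemma conjcB z w : conjc (z - w) = conjc z - conjc w.
Proof. exact: (rmorphB (@conjc R)). Qed.

Lemma normc_ge0 z : 0 <= normc z.
Proof. by case: z => a b; apply: sqrtr_ge0. Qed.

Lemma sqr_normcE z : normc z ^+ 2 = complex.Re z ^+ 2 + complex.Im z ^+ 2.
Proof. by case: z => a b /=; rewrite sqr_sqrtr // addr_ge0 // sqr_ge0. Qed.

Lemma normcX z n : normc (z ^+ n) = normc z ^+ n.
Proof.
by elim: n => [|n IH]; rewrite ?expr0 ?Normc.normc1 // !exprS Normc.normcM IH.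
Qed.

Lemma normc_eq0 z : (normc z == 0) = (z == 0).
Proof.
by apply/eqP/eqP => [/Normc.eq0_normc //|->]; rewrite Normc.normc0.
Qed.

Lemma normc_gt0 z : (0 < normc z) = (z != 0).
Proof. by rewrite lt_neqAle normc_ge0 andbT eq_sym normc_eq0. Qed.

Lemma normc_real x : normc x%:C = `|x|.
Proof. by rewrite /= expr0n addr0 sqrtr_sqr. Qed.

Lemma normc_i : normc ('i : R[i]) = 1.
Proof. by rewrite /= expr0n add0r sqrtr_sqr normr1. Qed.

Lemma normc_N z : normc (- z) = normc z.
Proof. exact: normcN. Qed.

Lemma normcD z w : normc (z + w) <= normc z + normc w.
Proof. exact: le_normcD. Qed.

Lemma normcB z w : normc (z - w) <= normc z + normc w.
Proof. by rewrite -(normc_N w); exact: normcD. Qed.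

Lemma normc_distC z w : normc (z - w) = normc (w - z).
Proof. by rewrite -normc_N opprB. Qed.

Lemma ler_normcB z w : normc z - normc w <= normc (z - w).
Proof. by rewrite lerBlDr -{1}(subrK w z); exact: normcD. Qed.

Lemma normc_conj z : normc z^* = normc z.
Proof. by case: z => a b /=; rewrite sqrrN. Qed.

Lemma normr_Re_le z : `|complex.Re z| <= normc z.
Proof.
rewrite -(ler_pXn2r (n := 2)) ?nnegrE ?normc_ge0 // sqr_normcE.
by rewrite real_normK ?num_real // lerDl sqr_ge0.
Qed.

Lemma normr_Im_le z : `|complex.Im z| <= normc z.
Proof.
rewrite -(ler_pXn2r (n := 2)) ?nnegrE ?normc_ge0 // sqr_normcE.
by rewrite real_normK ?num_real // lerDr sqr_ge0.
Qed.

Lemma normc_le_ReIm z : normc z <= `|complex.Re z| + `|complex.Im z|.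
Proof.
rewrite -(ler_pXn2r (n := 2)) ?nnegrE ?normc_ge0 ?addr_ge0 // sqr_normcE.
rewrite sqrrD !real_normK ?num_real //.
have : 0 <= `|complex.Re z| * `|complex.Im z| by rewrite mulr_ge0.
lra.
Qed.

Lemma normc_prod (I : Type) (s : seq I) (P : pred I) (F : I -> R[i]) :
  normc (\prod_(i <- s | P i) F i) = \prod_(i <- s | P i) normc (F i).
Proof.
by apply: (big_morph _ (@Normc.normcM R)); exact: Normc.normc1.
Qed.

Lemma normcE_complex z : `|z| = (normc z)%:C :> R[i].
Proof. by rewrite normc_def; case: z. Qed.

(** Telescoping: the factors are exchanged one at a time, each at the cost of [d] times the moduli
    of the others. As [1 <= M], the power [size s] may stand for [(size s).-1]. *)
Lemma normc_prodB (I : eqType) (s : seq I) (a b : I -> R[i]) (M d : R) :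
  1 <= M -> 0 <= d -> (forall i, i \in s -> normc (a i) <= M) ->
  (forall i, i \in s -> normc (b i) <= M) ->
  (forall i, i \in s -> normc (a i - b i) <= d) ->
  normc (\prod_(i <- s) a i - \prod_(i <- s) b i)
    <= (size s)%:R * M ^+ size s * d.
Proof.
move=> M1 d0.
have M0 : 0 <= M by exact: le_trans M1.
elim: s => [|i s IH] aM bM abd.
  by rewrite !big_nil subrr Normc.normc0 !mul0r.
have tl j : j \in s -> j \in i :: s by move=> js; rewrite inE js orbT.
have hd : i \in i :: s by exact: mem_head.
have {}IH := IH (fun j js => aM j (tl j js)) (fun j js => bM j (tl j js))
  (fun j js => abd j (tl j js)).
rewrite !big_cons /=.
set A := \prod_(j <- s) a j in IH *.
have BM : normc (\prod_(j <- s) b j) <= M ^+ size s.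
  have : {in s, forall j, normc (b j) <= M} by move=> j js; exact: bM (tl j js).
  elim: (s) => [|j u IHu] uM; first by rewrite big_nil Normc.normc1.
  rewrite big_cons Normc.normcM /= exprS ler_pM ?normc_ge0 //.
    by apply: uM; exact: mem_head.
  by apply: IHu => l lu; apply: uM; rewrite inE lu orbT.
set B := \prod_(j <- s) b j in IH BM *.
have -> : a i * A - b i * B = a i * (A - B) + (a i - b i) * B by ring.
apply: (le_trans (normcD _ _)); rewrite !Normc.normcM.
apply: (@le_trans _ _ (M * ((size s)%:R * M ^+ size s * d) + d * M ^+ size s)).
  by apply: lerD; apply: ler_pM; rewrite ?normc_ge0 ?aM ?abd.
rewrite -natr1 exprS.
have h : d * M ^+ size s <= d * (M * M ^+ size s).
  apply: ler_wpM2l => //; rewrite ler_peMl //; exact: exprn_ge0.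
apply: (le_trans (lerD (lexx _) h)).
by rewrite le_eqVlt; apply/orP; left; apply/eqP; ring.
Qed.

End ComplexModulus.

Section ComplexLimits.
Context {R : realType} {T : Type} {F : set_system T} {FF : Filter F}.
Implicit Types (f : T -> R[i]) (l : R[i]).

(** The norm of [R[i]^o] takes values in [R[i]], where a positive element is real; this trades it
    for the real modulus in which all the estimates are made. *)
Lemma cvgC_normcP f l :
  (f @ F --> (l : R[i]^o)) <->
  (forall e : R, 0 < e -> \forall x \near F, normc (f x - l) < e).
Proof.
split.
  move=> /(@cvgrPdist_lt R[i] R[i]^o) h e e0.
  have := h e%:C; rewrite ltcR => /(_ e0); apply: filterS => x.
  by rewrite normcE_complex ltcR normc_distC.
move=> h; apply/(@cvgrPdist_lt R[i] R[i]^o) => e e0.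
have eE : e = (complex.Re e)%:C.
  by move: e0; rewrite ltcE => /andP[/eqP /= ie _]; apply: complex_eqP.
have {}e0 : 0 < complex.Re e by move: e0; rewrite {1}eE ltcR.
apply: filterS (h _ e0) => x.
by rewrite normcE_complex eE ltcR normc_distC.
Qed.

Lemma cvgC_ReImP f l :
  (f @ F --> (l : R[i]^o)) <->
  ((fun x => complex.Re (f x)) @ F --> complex.Re l /\
   (fun x => complex.Im (f x)) @ F --> complex.Im l).
Proof.
split.
  move=> /cvgC_normcP h; split; apply/cvgrPdist_lt => e e0;
    apply: filterS (h e e0) => x hx; rewrite distrC; apply: le_lt_trans hx.
    by rewrite -ReCN -ReCD normr_Re_le.
  by rewrite -ImCN -ImCD normr_Im_le.
move=> [/cvgrPdist_lt hr /cvgrPdist_lt hi]; apply/cvgC_normcP => e e0.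
have e2 : 0 < e / 2 by rewrite divr_gt0.
apply: filterS2 (hr _ e2) (hi _ e2) => x.
rewrite distrC -ReCN -ReCD => h1; rewrite distrC -ImCN -ImCD => h2.
apply: (le_lt_trans (normc_le_ReIm _)).
by rewrite (splitr e) ltrD.
Qed.

Lemma cvgC_normc f l : f @ F --> (l : R[i]^o) ->
  (fun x => normc (f x)) @ F --> normc l.
Proof.
move=> /cvgC_normcP h; apply/cvgrPdist_lt => e e0.
apply: filterS (h e e0) => x; apply: le_lt_trans.
by rewrite ler_norml lerNl opprB ler_normcB normc_distC ler_normcB.
Qed.

End ComplexLimits.

(** * The complex exponential *)

Section RealTaylor.
Context {R : realType}.
Implicit Types (x y : R).

(** Mean value theorem. The constant [C] is kept rather than divided by [n.+1], so that the bounds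
    below follow one from another by integrating once more. *)
Lemma normr_le_of_deriv (f df : R -> R) (C : R) (n : nat) :
  f 0 = 0 -> (forall x, is_derive x 1 f (df x)) ->
  (forall x, `|x| <= 1 -> `|df x| <= C * `|x| ^+ n) ->
  forall x, `|x| <= 1 -> `|f x| <= C * `|x| ^+ n.+1.
Proof.
move=> f0 fd fb.
have cf a b : {within `[a, b], continuous f}.
  apply: derivable_within_continuous => z _.
  by have [] := fd z.
have C0 x : `|x| <= 1 -> 0 <= C * `|x| ^+ n by move=> /fb; apply: le_trans.
have main c x : `|c| <= `|x| -> `|x| <= 1 ->
    `|df c * x| <= C * `|x| ^+ n.+1.
  move=> cx x1; rewrite normrM exprS mulrCA mulrC.
  apply: ler_wpM2l => //; apply: (le_trans (fb _ (le_trans cx x1))).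
  have : 0 <= C * `|1 : R| ^+ n by apply: C0; rewrite normr1.
  rewrite normr1 expr1n mulr1 => C1.
  by apply: ler_wpM2l => //; apply: lerXn2r; rewrite ?nnegrE.
move=> x x1; have [x0|x0] := leP 0 x.
  have [c] := @MVT_segment R f df 0 x x0 (fun z _ => fd z) (cf _ _).
  rewrite in_itv /= f0 !subr0 => /andP[c0 cx] ->.
  by apply: main => //; rewrite !ger0_norm.
have [c] := @MVT_segment R f df x 0 (ltW x0) (fun z _ => fd z) (cf _ _).
rewrite in_itv /= f0 !sub0r => /andP[xc c0] fE.
rewrite -normrN fE mulrN normrN.
by apply: main => //; rewrite !ler0_norm ?(ltW x0) // lerN2.
Qed.

Lemma normr_sin_le x : `|x| <= 1 -> `|sin x| <= `|x|.
Proof.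
move=> x1; rewrite -[leRHS]mul1r -[in leRHS](expr1 `|x|).
apply: (@normr_le_of_deriv sin cos) => //; first exact: sin0.
by move=> y _; rewrite expr0 mulr1 ler_norml cos_geN1 cos_le1.
Qed.

Lemma normr_cosB1_le x : `|x| <= 1 -> `|cos x - 1| <= `|x| ^+ 2.
Proof.
move=> x1; rewrite -[leRHS]mul1r.
apply: (@normr_le_of_deriv (fun x => cos x - 1) (fun x => - sin x)) => //.
  by rewrite cos0 subrr.
- by move=> y; apply: is_derive_eq; rewrite subr0.
by move=> y y1; rewrite normrN mul1r expr1 normr_sin_le.
Qed.

Lemma normr_sinB_le x : `|x| <= 1 -> `|sin x - x| <= `|x| ^+ 3.
Proof.
move=> x1; rewrite -[leRHS]mul1r.
apply: (@normr_le_of_deriv (fun x => sin x - x) (fun x => cos x - 1)) => //.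
  by rewrite sin0 subrr.
by move=> y y1; rewrite mul1r normr_cosB1_le.
Qed.

Lemma normr_cosB2_le x : `|x| <= 1 -> `|cos x - 1 + x ^+ 2 / 2| <= `|x| ^+ 3.
Proof.
move=> x1.
have : `|cos x - 1 + x ^+ 2 / 2| <= 1 * `|x| ^+ 4.
  apply: (@normr_le_of_deriv (fun x => cos x - 1 + x ^+ 2 / 2)
    (fun x => - (sin x - x))) => //.
  - by rewrite cos0 subrr add0r expr0n mul0r.
  - move=> y; apply: is_derive_eq; rewrite /GRing.scale /=; lra.
  by move=> y y1; rewrite normrN mul1r normr_sinB_le.
move=> /le_trans; apply; rewrite mul1r exprS ler_piMl ?exprn_ge0 //.
Qed.

Lemma normr_expRB1_le x : `|x| <= 1 -> `|expR x - 1| <= 3 * `|x|.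
Proof.
move=> x1; rewrite -[`|x|]expr1.
apply: (@normr_le_of_deriv (fun x => expR x - 1) expR) => //.
  by rewrite expR0 subrr.
- by move=> y; apply: is_derive_eq; rewrite subr0.
move=> y y1; rewrite mulr1 ger0_norm ?expR_ge0 //.
apply: (@le_trans _ _ (expR 1)).
  by rewrite ler_expR; apply: le_trans y1; exact: ler_norm.
have : 1 + (- 2^-1 : R) <= expR (- 2^-1) by exact: expR_ge1Dx.
have h : expR 1 * (expR (- 2^-1) * expR (- 2^-1)) = 1 :> R.
  by rewrite -!expRD -[RHS]expR0; congr expR; lra.
have : 1 + (- 3^-1 : R) <= expR (- 3^-1) by exact: expR_ge1Dx.
have h' : expR 1 * (expR (- 3^-1) * expR (- 3^-1) * expR (- 3^-1)) = 1 :> R.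
  by rewrite -!expRD -[RHS]expR0; congr expR; lra.
have : 1 + (- 6^-1 : R) <= expR (- 6^-1) by exact: expR_ge1Dx.
(* [expR 1 <= 3] because [expR (- 6^-1) >= 5/6] and [(5/6)^6 > 1/3]. *)
set u := expR (- 6^-1) => u6.
have h6 : expR 1 * u ^+ 6 = 1.
  by rewrite /u -expRM_natl -expRD -[RHS]expR0; congr expR; lra.
move=> _ _; have {}u6 : 5 / 6 <= u by lra.
have : (5 / 6) ^+ 6 <= u ^+ 6 by apply: lerXn2r; rewrite ?nnegrE ?expR_ge0 //; lra.
have : 0 < expR (1 : R) by exact: expR_gt0.
nra.
Qed.

Lemma normr_expRB2_le x : `|x| <= 1 -> `|expR x - 1 - x| <= 3 * `|x| ^+ 2.
Proof.
move=> x1.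
apply: (@normr_le_of_deriv (fun x => expR x - 1 - x) (fun x => expR x - 1)) => //.
  by rewrite expR0 !subrr.
- by move=> y; apply: is_derive_eq; rewrite subr0.
by move=> y y1; rewrite expr1 normr_expRB1_le.
Qed.

Lemma normr_expRB3_le x : `|x| <= 1 ->
  `|expR x - 1 - x - x ^+ 2 / 2| <= 3 * `|x| ^+ 3.
Proof.
move=> x1.
apply: (@normr_le_of_deriv (fun x => expR x - 1 - x - x ^+ 2 / 2)
  (fun x => expR x - 1 - x)) => //.
- by rewrite expR0 !subrr expr0n mul0r subrr.
- by move=> y; apply: is_derive_eq; rewrite /GRing.scale /=; lra.
by move=> y y1; rewrite normr_expRB2_le.
Qed.

End RealTaylor.

Section ComplexExponentialParts.
Context {R : realType}.
Implicit Types (z w : R[i]) (x y : R).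

Lemma Re_cexp z : complex.Re (cexp z) = expR (complex.Re z) * cos (complex.Im z).
Proof. by rewrite /cexp ReCM /= mul0r subr0. Qed.

Lemma Im_cexp z : complex.Im (cexp z) = expR (complex.Re z) * sin (complex.Im z).
Proof. by rewrite /cexp ImCM /= mul0r addr0. Qed.

End ComplexExponentialParts.

Opaque cexp.

Section ComplexExponential.
Context {R : realType}.
Implicit Types (z w : R[i]) (x y : R).

Lemma cexpD z w : cexp (z + w) = cexp z * cexp w.
Proof.
apply: complex_eqP.
  by rewrite [RHS]ReCM !(Re_cexp, Im_cexp) ReCD ImCD expRD cosD; ring.
by rewrite [RHS]ImCM !(Re_cexp, Im_cexp) ReCD ImCD expRD sinD; ring.
Qed.

Lemma cexp_real x : cexp x%:C = (expR x)%:C.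
Proof. by apply: complex_eqP; rewrite ?Re_cexp ?Im_cexp /= ?cos0 ?sin0; ring. Qed.

Lemma cexp0 : cexp (0 : R[i]) = 1.
Proof. by rewrite -[0]/(0%:C) cexp_real expR0. Qed.

Lemma normc_cexp z : normc (cexp z) = expR (complex.Re z).
Proof.
apply/eqP; rewrite -(eqrXn2 (n := 2)) ?normc_ge0 ?expR_ge0 // sqr_normcE.
rewrite Re_cexp Im_cexp !exprMn -mulrDr cos2Dsin2; apply/eqP; ring.
Qed.

Lemma cexp_neq0 z : cexp z != 0.
Proof. by rewrite -normc_gt0 normc_cexp expR_gt0. Qed.

Lemma cexp_sum (I : Type) (s : seq I) (P : pred I) (F : I -> R[i]) :
  cexp (\sum_(i <- s | P i) F i) = \prod_(i <- s | P i) cexp (F i).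
Proof. by apply: big_morph; [exact: cexpD|exact: cexp0]. Qed.

Lemma cexp_conj z : cexp z^* = (cexp z)^*.
Proof.
apply: complex_eqP.
  by rewrite ReCJ !Re_cexp ReCJ ImCJ cosN.
by rewrite ImCJ !Im_cexp ReCJ ImCJ sinN mulrN.
Qed.

(** Split into real and imaginary parts, the remainder has five terms made of real Taylor
    remainders. They contribute 4, 3, 3, 4 and 3 times [r ^+ 3], within the round constant 20. *)
Lemma cexp_taylor3 z : normc z <= 1 ->
  normc (cexp z - 1 - z - z ^+ 2 / 2) <= 20 * normc z ^+ 3.
Proof.
case: z => a b; set z := a +i* b => z1; set r := normc z in z1 *.
have r0 : 0 <= r by exact: normc_ge0.
have ar : `|a| <= r by exact: (normr_Re_le z).
have br : `|b| <= r by exact: (normr_Im_le z).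
have a1 := le_trans ar z1; have b1 := le_trans br z1.
have r3 (c : R) : `|c| <= r -> `|c| ^+ 3 <= r ^+ 3.
  by move=> h; apply: lerXn2r; rewrite ?nnegrE.
have r2 (c : R) : `|c| <= r -> `|c| ^+ 2 <= r ^+ 2.
  by move=> h; apply: lerXn2r; rewrite ?nnegrE.
have e4 : `|expR a| <= 4.
  have := normr_expRB1_le a1.
  rewrite -[X in _ -> `|X| <= _](subrK 1) => h.
  by apply: (le_trans (ler_normD _ _)); rewrite normr1; lra.
have zE : z ^+ 2 / 2 = ((a ^+ 2 - b ^+ 2) / 2) +i* (a * b).
  have -> : (2 : R[i])^-1 = (2^-1)%:C by rewrite rmorphV ?unitfE ?pnatr_eq0 // rmorph_nat.
  by rewrite expr2; apply: complex_eqP; rewrite ?ReCM ?ImCM /= ?ReCM ?ImCM /=; lra.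
have RE : complex.Re (cexp z - 1 - z - z ^+ 2 / 2) =
   expR a * (cos b - 1 + b ^+ 2 / 2) - (expR a - 1) * (b ^+ 2 / 2)
   + (expR a - 1 - a - a ^+ 2 / 2).
  by rewrite zE !(ReCD, ReCN) Re_cexp /=; ring.
have IE : complex.Im (cexp z - 1 - z - z ^+ 2 / 2) =
   expR a * (sin b - b) + (expR a - 1 - a) * b.
  by rewrite zE !(ImCD, ImCN) Im_cexp /=; ring.
apply: (le_trans (normc_le_ReIm _)); rewrite RE IE.
have h1 : `|expR a * (cos b - 1 + b ^+ 2 / 2)| <= 4 * r ^+ 3.
  by rewrite normrM ler_pM // (le_trans (normr_cosB2_le b1)) // r3.
have h2 : `|(expR a - 1) * (b ^+ 2 / 2)| <= 3 * r ^+ 3.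
  have -> : 3 * r ^+ 3 = (3 * r) * r ^+ 2 by ring.
  rewrite normrM; apply: ler_pM => //.
    by apply: (le_trans (normr_expRB1_le a1)); rewrite ler_pM2l.
  rewrite normrM normrX (ger0_norm (x := 2^-1)) ?invr_ge0 //.
  apply: (le_trans _ (r2 b br)); rewrite ler_piMr ?exprn_ge0 //; lra.
have h3 : `|expR a - 1 - a - a ^+ 2 / 2| <= 3 * r ^+ 3.
  by apply: (le_trans (normr_expRB3_le a1)); rewrite ler_pM2l ?r3.
have h4 : `|expR a * (sin b - b)| <= 4 * r ^+ 3.
  by rewrite normrM ler_pM // (le_trans (normr_sinB_le b1)) // r3.
have h5 : `|(expR a - 1 - a) * b| <= 3 * r ^+ 3.
  have -> : 3 * r ^+ 3 = (3 * r ^+ 2) * r by ring.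
  rewrite normrM; apply: ler_pM => //.
  by apply: (le_trans (normr_expRB2_le a1)); rewrite ler_pM2l ?r2.
have := ler_normD (expR a * (cos b - 1 + b ^+ 2 / 2) - (expR a - 1) * (b ^+ 2 / 2))
  (expR a - 1 - a - a ^+ 2 / 2).
have := ler_normB (expR a * (cos b - 1 + b ^+ 2 / 2)) ((expR a - 1) * (b ^+ 2 / 2)).
have := ler_normD (expR a * (sin b - b)) ((expR a - 1 - a) * b).
have : 0 <= r ^+ 3 by exact: exprn_ge0.
lra.
Qed.

Lemma cexp_taylor2_small z : normc z <= 1 ->
  normc (cexp z - 1 - z) <= 21 * normc z ^+ 2.
Proof.
move=> z1.
have -> : cexp z - 1 - z = (cexp z - 1 - z - z ^+ 2 / 2) + z ^+ 2 / 2 by ring.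
apply: (le_trans (normcD _ _)).
have h := cexp_taylor3 z1.
have h2 : normc (z ^+ 2 / 2) <= normc z ^+ 2.
  rewrite Normc.normcM normcX Normc.normcV ler_piMr ?exprn_ge0 ?normc_ge0 //.
  rewrite -[2%R in leLHS]/(2%:R) -(rmorph_nat (real_complex R)) normc_real normr_nat.
  by rewrite invf_le1 // ler1n.
have h3 : normc z ^+ 3 <= normc z ^+ 2.
  by rewrite exprS ler_piMl ?exprn_ge0 ?normc_ge0.
lra.
Qed.

(** For [normc z > 1] the trivial bound [expR r + 1 + r <= 2 * expR r] suffices. The exponential on
    the right frees the estimate from any restriction on [z], as is needed under an integral over an
    unbounded variable. *)
Lemma cexp_taylor2 z :
  normc (cexp z - 1 - z) <= 21 * normc z ^+ 2 * expR (normc z).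
Proof.
set r := normc z; have r0 : 0 <= r by exact: normc_ge0.
have e1 : 1 + r <= expR r by exact: expR_ge1Dx.
have [z1|z1] := leP r 1.
  apply: (le_trans (cexp_taylor2_small z1)).
  by rewrite ler_peMr ?mulr_ge0 ?exprn_ge0 //; lra.
apply: (@le_trans _ _ (2 * expR r)).
  apply: (le_trans (normcB _ _)); rewrite -/r.
  have : normc (cexp z - 1) <= expR r + 1.
    apply: (le_trans (normcB _ _)); rewrite Normc.normc1 lerD2r normc_cexp ler_expR.
    by apply: le_trans (normr_Re_le z); exact: ler_norm.
  lra.
apply: ler_wpM2r; first exact: expR_ge0.
have : 1 <= r ^+ 2 by rewrite expr_ge1 // ltW.
lra.
Qed.

(* The factor [exp (w^2/2)] removes the quadratic term of the elementary factor. *)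
Lemma elementary_factor_cubic w : normc w <= 4^-1 ->
  normc ((1 - w) * cexp w * cexp (w ^+ 2 / 2) - 1) <= 100 * normc w ^+ 3.
Proof.
move=> w1; set r := normc w in w1 *; have r0 : 0 <= r by exact: normc_ge0.
have n2 : normc (2 : R[i])^-1 = 2^-1.
  by rewrite Normc.normcV -(rmorph_nat (real_complex R)) normc_real normr_nat.
(* Both exponentials merge into [cexp z], and in [(1 - w) * (1 + z + z ^+ 2 / 2)] the terms of
   degree 1 and 2 in [w] cancel. *)
pose z := w + w ^+ 2 / 2.
have zr : normc z <= 9 / 8 * r.
  apply: (le_trans (normcD _ _)); rewrite Normc.normcM normcX n2 -/r.
  have : r ^+ 2 <= r * 4^-1 by rewrite expr2; apply: ler_wpM2l.
  lra.
have z1 : normc z <= 1 by lra.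
have h := cexp_taylor3 z1.
have -> : (1 - w) * cexp w * cexp (w ^+ 2 / 2) - 1 =
  (1 - w) * (cexp z - 1 - z - z ^+ 2 / 2)
   + - (w ^+ 3) * (2^-1 + 3 * 2^-1 * 2^-1 * 2^-1 * w + 2^-1 * 2^-1 * 2^-1 * w ^+ 2).
  rewrite -mulrA -cexpD -/z; move: (cexp z) => u; rewrite /z.
  by field.
apply: (le_trans (normcD _ _)).
have hw : normc (1 - w) <= 5 / 4.
  by apply: (le_trans (normcB _ _)); rewrite Normc.normc1 -/r; lra.
have z3 : normc z ^+ 3 <= (9 / 8 * r) ^+ 3 by apply: lerXn2r; rewrite ?nnegrE ?normc_ge0 //; lra.
have r3 : 0 <= r ^+ 3 by exact: exprn_ge0.
have -> : 100 * r ^+ 3 = 5 / 4 * (76 * r ^+ 3) + 5 * r ^+ 3 by field.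
apply: lerD.
  rewrite Normc.normcM; apply: ler_pM; rewrite ?normc_ge0 //.
  by apply: (le_trans h); move: z3; rewrite exprMn; lra.
rewrite Normc.normcM normc_N normcX -/r mulrC; apply: ler_wpM2r => //.
apply: (le_trans (normcD _ _)); rewrite !Normc.normcM !n2 -/r.
apply: (@le_trans _ _ (2^-1 + 3 * 2^-1 * 2^-1 * 2^-1 * 4^-1 + 2^-1 * 2^-1 * 2^-1 * 1)); last lra.
apply: lerD.
  apply: (le_trans (normcD _ _)); rewrite n2 lerD2l !Normc.normcM !n2 -/r.
  rewrite -(rmorph_nat (real_complex R)) normc_real normr_nat.
  by apply: ler_wpM2l => //; lra.
apply: ler_wpM2l; first lra.
by apply: mulr_ile1 => //; lra.
Qed.

Lemma cvg_cexp {T : Type} {F : set_system T} {FF : Filter F} (f : T -> R[i]) z :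
  f @ F --> (z : R[i]^o) -> (fun t => cexp (f t)) @ F --> (cexp z : R[i]^o).
Proof.
move=> /cvgC_ReImP[hr hi]; apply/cvgC_ReImP.
have he := @continuous_cvg _ _ _ _ _ _ expR _ (@continuous_expR R _) hr.
have hc := @continuous_cvg _ _ _ _ _ _ cos _ (@continuous_cos R _) hi.
have hs := @continuous_cvg _ _ _ _ _ _ sin _ (@continuous_sin R _) hi.
split.
  under eq_fun => t do rewrite Re_cexp.
  by rewrite Re_cexp; apply: cvgM; [exact: he|exact: hc].
under eq_fun => t do rewrite Im_cexp.
by rewrite Im_cexp; apply: cvgM; [exact: he|exact: hs].
Qed.

End ComplexExponential.

(** * Zeros on the unit circle *)

Section RealRooted.
Context {R : realType}.

Definition real_rooted (Q : {poly R}) :=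
  forall z : R[i], ceval Q z = 0 -> complex.Im z = 0.

Lemma cevalM (p q : {poly R}) z : ceval (p * q) z = ceval p z * ceval q z.
Proof. by rewrite /ceval rmorphM hornerM. Qed.

Lemma cevalC (c : R) z : ceval c%:P z = c%:C.
Proof. by rewrite /ceval map_polyC hornerC. Qed.

Lemma ceval_conj (p : {poly R}) z : ceval p z^* = (ceval p z)^*.
Proof.
rewrite /ceval !horner_coef !size_map_poly rmorph_sum /=.
apply: eq_bigr => i _; rewrite !coef_map rmorphM rmorphXn; congr (_ * _).
by apply: complex_eqP; rewrite /= ?oppr0.
Qed.

Lemma real_rooted_ceval (Q : {poly R}) : real_rooted Q ->
  exists2 s : seq R, size s = (size Q).-1 &
    forall z, ceval Q z = (lead_coef Q)%:C * \prod_(a <- s) (z - a%:C).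
Proof.
move=> QR; set q := map_poly (real_complex R) Q.
have lq : lead_coef q = (lead_coef Q)%:C by exact: lead_coef_map.
have [Q0|Q0] := eqVneq Q 0.
  exists [::]; first by rewrite Q0 size_poly0.
  by move=> z; rewrite Q0 lead_coef0 mul0r /ceval rmorph0 horner0.
have [r rE] := closed_field_poly_normal q.
have q0 : lead_coef q != 0 by rewrite lead_coef_eq0 map_poly_eq0.
have rR z : z \in r -> z = (complex.Re z)%:C.
  move=> zr; apply: complex_eqP => //=; apply: QR.
  by apply/rootP; rewrite -/q rE rootZ // root_prod_XsubC.
exists (map (@complex.Re R) r).
  have : size q = (size r).+1 by rewrite rE size_scale // size_prod_XsubC.
  by rewrite size_map_poly size_map => ->.
move=> z; rewrite /ceval -/q rE hornerZ lq horner_prod big_map; congr (_ * _).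
rewrite big_seq [RHS]big_seq; apply: eq_bigr => a /rR aE.
by rewrite hornerXsubC {1}aE.
Qed.

Lemma real_rooted_mul (p q : {poly R}) :
  real_rooted p -> real_rooted q -> real_rooted (p * q).
Proof.
by move=> hp hq z; rewrite cevalM => /eqP; rewrite mulf_eq0 => /orP[]/eqP; auto.
Qed.

End RealRooted.

Section CircleRoots.
Context {R : realType}.
Implicit Types (x z : R[i]) (p q : {poly R[i]}).

(** [x / (x - z)] is the contribution of a zero [z] to [x p'(x) / p(x)]. Whether its real part
    exceeds 1/2 depends only on which of [x] and [z] is nearer to 0. *)
Lemma Re_div_subE x z : x != z ->
  1 - 2 * complex.Re (x / (x - z)) =
    (normc z ^+ 2 - normc x ^+ 2) / normc (x - z) ^+ 2.
Proof.
move=> xz; have : normc (x - z) ^+ 2 != 0.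
  by rewrite expf_eq0 /= normc_eq0 subr_eq0.
rewrite !sqr_normcE; case: x z {xz} => [a b] [c d] /= h.
by field.
Qed.

Lemma Re_div_sub_le x z : x != z -> normc x <= normc z ->
  2 * complex.Re (x / (x - z)) <= 1.
Proof.
move=> xz h; rewrite -subr_ge0 Re_div_subE // divr_ge0 ?exprn_ge0 ?normc_ge0 //.
by rewrite subr_ge0 lerXn2r // nnegrE normc_ge0.
Qed.

Lemma Re_div_sub_lt x z : x != z -> normc x < normc z ->
  2 * complex.Re (x / (x - z)) < 1.
Proof.
move=> xz h; rewrite -subr_gt0 Re_div_subE // divr_gt0 ?exprn_gt0 //.
  by rewrite subr_gt0 ltrXn2r // ?nnegrE ?normc_ge0.
by rewrite normc_gt0 subr_eq0.
Qed.

Lemma logderiv_prod_XsubC (s : seq R[i]) x : x \notin s ->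
  (\prod_(z <- s) ('X - z%:P))^`().[x]
    = (\prod_(z <- s) ('X - z%:P)).[x] * \sum_(z <- s) (x - z)^-1.
Proof.
elim: s => [|a s IH]; first by rewrite !big_nil derivC horner0 mulr0.
rewrite inE negb_or => /andP[xa xs].
rewrite !big_cons derivM derivXsubC mul1r hornerD !hornerM hornerXsubC IH //.
have : x - a != 0 by rewrite subr_eq0.
by move=> h; field.
Qed.

(* Coefficientwise multiplication; with [g j = i eps (j - N)] it represents
   differentiation of the trigonometric polynomial [sum_j p_j e^(i eps (j - N) z)]. *)
Definition coef_mul (g : nat -> R[i]) p := \poly_(j < size p) (g j * p`_j).

Lemma coef_coef_mul g p j : (coef_mul g p)`_j = g j * p`_j.
Proof.
by rewrite coef_poly; case: ltnP => // h; rewrite nth_default // mulr0.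
Qed.

Definition freq (eps : R) (N j : nat) : R[i] := 'i * (eps * (j%:R - N%:R))%:C.

(* The trigonometric polynomial attached to [p] has degree [N], its extreme
   coefficients have equal modulus, and its zeros are in a half-plane. *)
Definition roots_outside (r : R) (N : nat) p :=
  [/\ size p = N.*2.+1, normc p`_0 = normc p`_(N.*2) &
      forall z, root p z -> r <= normc z].

(** By Vieta, extreme coefficients of equal modulus force the moduli of the zeros to have product
    1. *)
Lemma roots_outside_split r N p : roots_outside r N p ->
  exists s : seq R[i], [/\ p = lead_coef p *: \prod_(z <- s) ('X - z%:P),
    size s = N.*2, \prod_(z <- s) normc z = 1 &
    forall z, (z \in s) = root p z].
Proof.
move=> [sp p0 pr]; have [s sE] := closed_field_poly_normal p.
have p_neq0 : p != 0 by rewrite -size_poly_eq0 sp.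
have lp : lead_coef p != 0 by rewrite lead_coef_eq0.
have ss : size s = N.*2.
  by move: sp; rewrite {1}sE size_scale // size_prod_XsubC => -[].
exists s; split=> //; last first.
  by move=> z; rewrite sE rootZ // root_prod_XsubC.
have : normc p`_0 = normc (lead_coef p) * \prod_(z <- s) normc z.
  rewrite -horner_coef0 {1}sE hornerZ Normc.normcM horner_prod normc_prod.
  congr (_ * _); apply: eq_bigr => z _.
  by rewrite hornerXsubC sub0r normc_N.
have lE : p`_(N.*2) = lead_coef p by rewrite /lead_coef sp.
rewrite p0 lE => h; apply: (@mulfI _ (normc (lead_coef p))).
  by rewrite normc_eq0.
by rewrite -h mulr1.
Qed.

(** Each of the [2N] zeros contributes at most 1/2 to the logarithmic derivative. One contributes
    strictly less: the moduli have product 1 and [r < 1], so some zero has modulus above [r]. *)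
Lemma roots_outside_Re_logderiv r N p x : (0 < N)%N -> 0 < r -> r < 1 ->
  roots_outside r N p -> normc x <= r -> ~~ root p x ->
  complex.Re (x * p^`().[x] / p.[x]) < N%:R.
Proof.
move=> N0 r0 r1 hp xr px; have [_ _ pr] := hp.
have [s [sE ss s1 sr]] := roots_outside_split hp.
have xs : x \notin s by rewrite sr.
have zx z : z \in s -> x != z by move=> zs; apply: contraNneq xs => ->.
have -> : x * p^`().[x] / p.[x] = \sum_(z <- s) x / (x - z).
  have px0 : p.[x] != 0 by move: px; rewrite rootE.
  rewrite -mulr_sumr -mulrA; congr (_ * _); apply: (mulIf px0).
  rewrite divfK // {1}sE derivZ hornerZ logderiv_prod_XsubC //.
  by rewrite mulrA -hornerZ -sE mulrC.
have [y ys yr] : exists2 y, y \in s & r < normc y.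
  apply: contrapT => h.
  have hle z : z \in s -> normc z <= r.
    by move=> zs; rewrite leNgt; apply/negP => rz; apply: h; exists z.
  have : \prod_(z <- s) normc z <= \prod_(z <- s) r.
    rewrite big_seq [leRHS]big_seq; apply: ler_prod => z zs.
    by rewrite normc_ge0 hle.
  rewrite s1 big_const_seq count_predT ss iter_mulr_1 leNgt => /negP; apply.
  by rewrite exprn_ilt1 ?ltW //; case: (N) N0.
have ssum : \sum_(z <- s) (1 : R) = N%:R + N%:R.
  by rewrite big_const_seq count_predT ss iter_addr_0 -addnn natrD.
have : 2 * complex.Re (\sum_(z <- s) x / (x - z)) < \sum_(z <- s) 1.
  rewrite (big_morph _ (@ReCD R) (erefl _ : complex.Re 0 = 0)) mulr_sumr.
  rewrite (big_rem y ys) /= [ltRHS](big_rem y ys) /=.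
  apply: ltr_leD; first by apply: Re_div_sub_lt; [exact: zx|exact: le_lt_trans yr].
  rewrite big_seq [leRHS]big_seq; apply: ler_sum => z /mem_rem zs.
  apply: Re_div_sub_le; first exact: zx.
  by apply: (le_trans xr); apply: pr; rewrite -sr.
rewrite ssum; lra.
Qed.

(** In the variable [X = e^(i eps z)], [d/dz] is [i eps X d/dX]; the term in [eps * N] accounts for
    the shift of the exponents by [N]. *)
Lemma coef_mul_freqE eps N (a : R) p :
  coef_mul (fun j => freq eps N j - a%:C) p =
    ('i * eps%:C) *: ('X * p^`()) - ('i * (eps * N%:R)%:C + a%:C) *: p.
Proof.
apply/polyP => j; rewrite coef_coef_mul coefB !coefZ coefXM coef_deriv.
have -> : (if j == 0%N then 0 else p`_j.-1.+1 *+ j.-1.+1) = j%:R * p`_j.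
  by case: j => [|j] /=; rewrite ?mul0r // mulr_natl.
rewrite /freq !(rmorphM, rmorphB, rmorph_nat) /=; ring.
Qed.

(** At such a point [x p'/p = N - i a / eps], and [a] is real. In the disc [normc x <= r] this
    contradicts the strict bound of [roots_outside_Re_logderiv]. *)
Lemma freq_horner_eq0 eps N (a : R) p x : 0 < eps -> ~~ root p x ->
  root (coef_mul (fun j => freq eps N j - a%:C) p) x ->
  complex.Re (x * p^`().[x] / p.[x]) = N%:R.
Proof.
move=> e0 px /rootP; rewrite coef_mul_freqE !hornerE /= => /eqP; rewrite subr_eq0 => /eqP h.
have px0 : p.[x] != 0 by move: px; rewrite rootE.
have -> : x * p^`().[x] / p.[x] = N%:R - 'i * (a / eps)%:C.
  apply: (mulIf px0); rewrite divfK //.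
  have ie0 : ('i * eps%:C) != 0 :> R[i].
    by rewrite -normc_gt0 Normc.normcM normc_i normc_real mul1r normr_gt0 gt_eqF.
  apply: (mulfI ie0); rewrite [LHS]mulrA h mulrA; congr (_ * _).
  rewrite -(rmorph_nat (real_complex R) N).
  by apply: complex_eqP; rewrite /=; field; rewrite gt_eqF.
rewrite ReCD ReCN ReCM /= -(rmorph_nat (real_complex R) N) /=; ring.
Qed.

Lemma roots_outside_coef_mul eps r N (a : R) p :
  0 < eps -> (0 < N)%N -> 0 < r -> r < 1 -> roots_outside r N p ->
  roots_outside r N (coef_mul (fun j => freq eps N j - a%:C) p).
Proof.
move=> e0 N0 r0 r1 hp; have [sp p0 pr] := hp.
(* The extreme frequencies are [-i eps N] and [i eps N]; after subtraction of a real [a] they are,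
   up to sign of the imaginary part, the same number, so the extreme coefficients keep equal
   moduli. *)
have n0 : normc (freq eps N 0 - a%:C) = normc (freq eps N N.*2 - a%:C).
  rewrite -(normc_conj (freq _ _ N.*2 - _)); congr normc.
  rewrite /freq -addnn natrD; apply: complex_eqP;
    rewrite ?(ReCJ, ImCJ) !(ReCM, ImCM, ReCD, ImCD, ReCN, ImCN) /=; ring.
have nN : freq eps N N.*2 - a%:C != 0.
  apply/eqP => /(congr1 (@complex.Im R)).
  rewrite /freq -addnn natrD !(ImCM, ImCD, ImCN) /= => /eqP; apply/negP.
  rewrite gt_eqF // mul0r add0r subr0 mul1r addrK mulr_gt0 // ltr0n //.
split.
- rewrite size_poly_eq ?sp //= mulf_neq0 //.
  have -> : p`_(N.*2) = lead_coef p by rewrite /lead_coef sp.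
  by rewrite lead_coef_eq0 -size_poly_eq0 sp.
- by rewrite !coef_coef_mul !Normc.normcM p0 n0.
move=> z Sz; rewrite leNgt; apply/negP => zr.
have pz : ~~ root p z by apply/negP => /pr; rewrite leNgt zr.
have := roots_outside_Re_logderiv N0 r0 r1 hp (ltW zr) pz.
by rewrite (freq_horner_eq0 e0 pz Sz) ltxx.
Qed.

(** At a zero of order [m.+1] the derivative term leaves [m.+1] times a nonzero factor, so exactly
    one order is lost. At any other point the bound on the logarithmic derivative prevents a new
    zero, which the truncated predecessor of 0 records. *)
Lemma mup_coef_mul eps r N (a : R) p x :
  0 < eps -> (0 < N)%N -> 0 < r -> r < 1 -> roots_outside r N p ->
  normc x = r ->
  mup x (coef_mul (fun j => freq eps N j - a%:C) p) = (mup x p).-1.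
Proof.
move=> e0 N0 r0 r1 hp xr; have [sp _ _] := hp.
have p0 : p != 0 by rewrite -size_poly_eq0 sp.
have x0 : x != 0 by rewrite -normc_gt0 xr.
have [px|px] := boolP (root p x); last first.
  rewrite (mupNroot px) mupNroot //; apply/negP => Sx.
  have := roots_outside_Re_logderiv N0 r0 r1 hp _ px.
  by rewrite xr => /(_ (lexx _)); rewrite (freq_horner_eq0 e0 px Sx) ltxx.
have [m [q /implyP/(_ p0) qx pE]] := multiplicity_XsubC p x.
have m0 : (0 < m)%N.
  by case: m pE => // pE; move: px; rewrite pE expr0 mulr1 (negPf qx).
case: m pE m0 => // m pE _.
have mX k : mup x (('X - x%:P) ^+ k) = k by rewrite mup_XsubCX eqxx.
rewrite {2}pE mupMr // mX /= coef_mul_freqE.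
pose w := ('i * eps%:C) *: ('X * (q *+ m.+1 + q^`() * ('X - x%:P)))
  - ('i * (eps * N%:R)%:C + a%:C) *: (q * ('X - x%:P)).
have -> : ('i * eps%:C) *: ('X * p^`()) - ('i * (eps * N%:R)%:C + a%:C) *: p =
    w * ('X - x%:P) ^+ m.
  rewrite /w pE derivM deriv_exp derivXsubC mul1r /= exprS -!mul_polyC.
  by rewrite -[q *+ m.+1]mulr_natl -[_ ^+ m *+ m.+1]mulr_natl; ring.
rewrite mupMr ?mX //.
rewrite rootE /w !hornerE /= hornerMn subrr !(mulr0, addr0, subr0).
rewrite -mulr_natl !mulf_neq0 //.
- by rewrite -normc_gt0 normc_i ltr01.
- by rewrite -normc_gt0 normc_real normr_gt0 gt_eqF.
Qed.

Lemma iter_coef_mul eps r N (s : seq R) p x :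
  0 < eps -> (0 < N)%N -> 0 < r -> r < 1 -> roots_outside r N p ->
  normc x = r ->
  let Sp := foldr (fun a q => coef_mul (fun j => freq eps N j - a%:C) q) p s in
  [/\ roots_outside r N Sp, mup x Sp = (mup x p - size s)%N &
      forall j, Sp`_j = \prod_(a <- s) (freq eps N j - a%:C) * p`_j].
Proof.
move=> e0 N0 r0 r1 hp xr; elim: s => [|a s [h1 h2 h3]] /=.
  by split=> // [|j]; rewrite ?subn0 // big_nil mul1r.
split.
- exact: roots_outside_coef_mul.
- by rewrite (mup_coef_mul _ e0 N0 r0 r1 h1 xr) h2 subnS.
- by move=> j; rewrite coef_coef_mul h3 big_cons mulrA.
Qed.

Lemma seq_argmin (T : eqType) (f : T -> R) (s : seq T) : s != [::] ->
  exists2 x : T, x \in s & forall y : T, y \in s -> f x <= f y.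
Proof.
elim: s => // a s IH _; have [->|/IH[x xs xmin]] := eqVneq s [::].
  by exists a; rewrite ?inE // => z; rewrite inE => /eqP ->.
have [ax|xa] := leP (f a) (f x).
  exists a; rewrite ?inE ?eqxx // => z; rewrite inE => /orP[/eqP -> //|/xmin].
  exact: le_trans.
exists x; rewrite ?inE ?xs ?orbT // => z; rewrite inE => /orP[/eqP ->|/xmin //].
exact: ltW.
Qed.

(* At a zero [x] of least modulus [r < 1] the operator [Q] with real zeros lowers
   the multiplicity, whereas the functional equation preserves it. *)
Lemma circle_roots (Q : {poly R}) eps N p : 0 < eps -> (0 < N)%N ->
  real_rooted Q -> (1 < size Q)%N ->
  size p = N.*2.+1 -> normc p`_0 = normc p`_(N.*2) -> p`_0 != 0 ->
  ('X - 1%:P) * p = - ('i * (eps / 2)%:C) *: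
    (('X + 1%:P) * coef_mul (fun j => ceval Q (freq eps N j)) p) ->
  forall z, root p z -> normc z = 1.
Proof.
move=> e0 N0 QR sQ sp p0 p00 eqp.
have pn0 : p != 0 by rewrite -size_poly_eq0 sp.
have h0 : roots_outside 0 N p by split=> // z _; exact: normc_ge0.
have [s [sE ss s1 sr]] := roots_outside_split h0.
have s_neq0 : s != [::] by rewrite -size_eq0 ss double_eq0 -lt0n.
have [x xs xmin] := seq_argmin (fun z => normc z) s_neq0.
have rx : root p x by rewrite -sr.
have x0 : 0 < normc x.
  rewrite normc_gt0; apply: contraNneq p00 => xE.
  by move: rx; rewrite xE /root horner_coef0.
(* If the least modulus is at least 1, a product of moduli equal to 1 leaves no zero off the
   circle. *)
have [x1|x1] := ltP (normc x) 1; last first.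
  move=> z rz; have zs : z \in s by rewrite sr.
  apply/eqP; rewrite eq_le (le_trans x1 (xmin _ zs)) andbT.
  rewrite -s1 (big_rem z zs) /= ler_peMr ?normc_ge0 //.
  rewrite big_seq; elim/big_rec: _ => // i y /mem_rem/xmin xi y1.
  by rewrite -[1]mul1r ler_pM // (le_trans x1 xi).
have hp : roots_outside (normc x) N p.
  by split=> // z; rewrite -sr; exact: xmin.
have [[|a t] st QE] := real_rooted_ceval QR.
  by move: st sQ => /=; case: (size Q) => [|[|k]].
have [_ mSp cSp] := iter_coef_mul (a :: t) e0 N0 x0 x1 hp (erefl _).
move: mSp cSp; set Sp := foldr _ _ _ => mSp cSp.
have lQ : lead_coef Q != 0.
  by rewrite lead_coef_eq0 -size_poly_gt0; exact: ltn_trans sQ.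
have cE : coef_mul (fun j => ceval Q (freq eps N j)) p = (lead_coef Q)%:C *: Sp.
  by apply/polyP => j; rewrite coef_coef_mul QE coefZ cSp mulrA.
have Sp0 : Sp != 0.
  apply: contra_eq_neq eqp => Sp0; rewrite cE Sp0 scaler0 mulr0 scaler0.
  by rewrite mulf_neq0 // polyXsubC_eq0.
have mupZ c q : c != 0 -> mup x (c *: q) = mup x q.
  by move=> c0; rewrite -mul_polyC mupMr // rootC.
(* The multipliers [X - 1] and [X + 1] vanish only on the unit circle, so the equation makes
   [mup x p] equal to itself minus the positive degree of [Q], truncated at 0, although [x] is a
   zero. *)
have nx1 : ~~ root ('X - 1%:P) x.
  by rewrite root_XsubC; apply: contraTneq x1 => ->; rewrite Normc.normc1 ltxx.
have nxN1 : ~~ root ('X + 1%:P) x.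
  rewrite -[1%:P]opprK -polyCN root_XsubC; apply: contraTneq x1 => ->.
  by rewrite normc_N Normc.normc1 ltxx.
have := congr1 (mup x) eqp; rewrite mupMr // cE mupZ; last first.
  rewrite oppr_eq0 -normc_gt0 Normc.normcM normc_i normc_real mul1r normr_gt0.
  by rewrite gt_eqF // divr_gt0.
rewrite mupMr // mupZ; last by rewrite -normc_gt0 normc_real normr_gt0.
rewrite mSp /=; have : (0 < mup x p)%N by rewrite -XsubC_dvd // dvdp_XsubCl.
by case: (mup x p) => // k _ /eqP; rewrite subSS eqn_leq ltnNge leq_subr.
Qed.

End CircleRoots.

(** * Polynomials in the Laguerre-Polya class *)

Section LaguerrePolyaRealRooted.
Context {R : realType}.

Lemma sqrt_mono (z w : R[i]) : complex.Re z = complex.Re w ->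
  `|complex.Im z| <= `|complex.Im w| -> normc z <= normc w.
Proof.
move=> re im; rewrite -(ler_pXn2r (n := 2)) ?nnegrE ?normc_ge0 // !sqr_normcE.
rewrite re lerD2l -[leLHS]real_normK ?num_real // -[leRHS]real_normK ?num_real //.
by rewrite lerXn2r // nnegrE.
Qed.

(* Each factor of the product has this monotonicity when its zero is real. *)
Lemma laguerre_polya_normc_le (phi : R[i] -> R[i]) (x y y' : R) :
  laguerre_polya phi -> `|y| <= `|y'| ->
  normc (phi (x +i* y)) <= normc (phi (x +i* y')).
Proof.
move=> [_ _ [om [a [b [c [m [xs [a0 xs0 _ cv]]]]]]]] yy.
apply: (ler_cvg_to (cvgC_normc (cv (x +i* y))) (cvgC_normc (cv (x +i* y')))).
apply: nearW => n.
have nE (A B C D : R[i]) : normc (A * B * C * D) =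
    normc A * normc B * normc C * normc D by rewrite !Normc.normcM.
rewrite !nE !normcX !normc_prod !normc_cexp.
have zz : normc (x +i* y) <= normc (x +i* y') by apply: sqrt_mono.
apply: ler_pM; rewrite ?mulr_ge0 ?prodr_ge0 ?exprn_ge0 ?normc_ge0 ?expR_ge0 //.
- by move=> i _; exact: normc_ge0.
- apply: ler_pM; rewrite ?mulr_ge0 ?prodr_ge0 ?exprn_ge0 ?normc_ge0 ?expR_ge0 //.
    by apply: ler_wpM2l; [exact: normc_ge0|apply: lerXn2r; rewrite ?nnegrE ?normc_ge0].
  rewrite ler_expR !expr2 /=.
  have : a * y ^+ 2 <= a * y' ^+ 2.
    apply: ler_wpM2l => //.
    by rewrite -[leLHS]real_normK ?num_real // -[leRHS]real_normK ?num_real // lerXn2r // nnegrE.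
  lra.
apply: ler_prod => i ib; rewrite normc_ge0 /=.
rewrite /lp_factor 2!(Normc.normcM (1 + _)) !normc_cexp.
have ReE (t : R) : complex.Re ((x +i* t) / (xs i)%:C) = x / xs i.
  by rewrite -fmorphV ReCM /=; ring.
have ImE (t : R) : complex.Im ((x +i* t) / (xs i)%:C) = t / xs i.
  by rewrite -fmorphV ImCM /=; ring.
apply: ler_pM; rewrite ?normc_ge0 ?expR_ge0 //; last by rewrite !ReCN !ReE.
apply: sqrt_mono; first by rewrite !ReCD !ReE.
by rewrite !ImCD !ImE /= !add0r !normrM ler_wpM2r.
Qed.

(** By monotonicity of the modulus on vertical lines, a nonreal zero makes [p] vanish on the whole
    segment down to the real axis, hence at more points than its degree allows. *)
Lemma laguerre_polya_real_rooted (p : {poly R}) :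
  p != 0 -> laguerre_polya (ceval p) -> real_rooted p.
Proof.
move=> p0 hp [x y] /= h; apply/eqP/negPn/negP => y0.
set q := map_poly (real_complex R) p.
have q0 : q != 0 by rewrite map_poly_eq0.
pose f (k : nat) : R[i] := x +i* (y / k.+1%:R).
have fr k : root q (f k).
  apply/rootP/eqP; rewrite -normc_eq0 eq_le normc_ge0 andbT.
  have -> : 0 = normc (ceval p (x +i* y)) by rewrite h Normc.normc0.
  apply: laguerre_polya_normc_le => //.
  by rewrite normrM normfV normr_nat ler_piMr // invf_le1 // ler1n.
have : (size (map f (iota 0 (size q))) < size q)%N.
  apply: max_poly_roots => //; first by apply/allP => z /mapP[k _ ->].
  rewrite map_inj_uniq ?iota_uniq // => k l [] /(mulfI y0)/invr_inj/eqP.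
  by rewrite eqr_nat eqSS => /eqP.
by rewrite size_map size_iota ltnn.
Qed.

End LaguerrePolyaRealRooted.

(** * Limits of real-rooted polynomials *)

Section ComplexLimitAlgebra.
Context {R : realType} {T : Type} {F : set_system T} {FF : ProperFilter F}.
Implicit Types (f g : T -> R[i]) (a b : R[i]).

Lemma cvgC_mul f g a b : f @ F --> (a : R[i]^o) -> g @ F --> (b : R[i]^o) ->
  (fun t => f t * g t) @ F --> (a * b : R[i]^o).
Proof. by move=> h1 h2; exact: (@cvgM R[i]^o _ _ _ f g a b h1 h2). Qed.

Lemma cvgC_inv f a : a != 0 -> f @ F --> (a : R[i]^o) ->
  (fun t => (f t)^-1) @ F --> (a^-1 : R[i]^o).
Proof. by move=> h1 h2; exact: (@cvgV R[i]^o _ _ _ f a h1 h2). Qed.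

Lemma cvgC_cst a : (fun _ : T => a) @ F --> (a : R[i]^o).
Proof. by apply: (@cvg_cst R[i]^o). Qed.

Lemma cvgC_unique f a b :
  f @ F --> (a : R[i]^o) -> f @ F --> (b : R[i]^o) -> a = b.
Proof.
move=> h1 h2; have H := @norm_hausdorff R[i] R[i]^o.
exact: (@cvg_unique R[i]^o H (f @ F) _ a b h1 h2).
Qed.

Lemma cvgC_real (f : T -> R) (x : R) : f @ F --> x ->
  (fun t => (f t)%:C) @ F --> (x%:C : R[i]^o).
Proof. by move=> h; apply/cvgC_ReImP; split; [exact: h|apply: cvg_cst]. Qed.

Lemma near_eq_cvgC f g a : (\forall t \near F, f t = g t) ->
  f @ F --> (a : R[i]^o) -> g @ F --> (a : R[i]^o).
Proof.
move=> fg /cvgC_normcP h; apply/cvgC_normcP => e e0.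
by apply: filterS2 fg (h e e0) => t ->.
Qed.

Lemma cvgC_prod (I : Type) (s : seq I) (P : pred I) (f : I -> T -> R[i]) (a : I -> R[i]) :
  (forall i, P i -> f i @ F --> (a i : R[i]^o)) ->
  (fun t => \prod_(i <- s | P i) f i t) @ F --> (\prod_(i <- s | P i) a i : R[i]^o).
Proof.
move=> h; elim: s => [|i s IH].
  rewrite big_nil; under eq_fun do rewrite big_nil; exact: cvgC_cst.
rewrite big_cons; under eq_fun do rewrite big_cons.
case: ifP => Pi; last exact: IH.
by apply: cvgC_mul; [exact: (h i Pi)|exact: IH].
Qed.

Lemma cvgC_of_normc_le f a (g : T -> R) :
  (\forall t \near F, normc (f t - a) <= g t) -> g @ F --> (0 : R) ->
  f @ F --> (a : R[i]^o).
Proof.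
move=> fg /cvgrPdist_lt g0; apply/cvgC_normcP => e e0.
apply: filterS2 fg (g0 e e0) => t h; rewrite sub0r normrN => h2.
by apply: le_lt_trans h (le_lt_trans (ler_norm _) h2).
Qed.

End ComplexLimitAlgebra.

(** Compactness in the form used here: an ultrafilter replaces the successive extraction of
    subsequences, since all bounded quantities converge along it at once. *)
Lemma ultra_bounded_cvg {R : realType} {T : Type} {U : set_system T}
    {UU : UltraFilter U} (f : T -> R) (M : R) :
  (\forall t \near U, `|f t| <= M) -> exists l : R, f @ U --> l.
Proof.
move=> fM; have fU : (f @ U) `[- M, M]%classic.
  by apply: filterS fM => t; rewrite /= in_itv /= ler_norml.
have [l [_ cl]] := @segment_compact R (- M) M (f @ U) _ fU.
exists l => A lA; have [//|UA] := in_ultra_setVsetC (f @^-1` A) UU.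
have [x [nAx Ax]] := cl (~` A) A UA lA.
by case: nAx.
Qed.

Section Products.
Context {R : realType}.

Lemma prod1D_ge (I : Type) (s : seq I) (t : I -> R) : (forall i, 0 <= t i) ->
  1 + \sum_(i <- s) t i <= \prod_(i <- s) (1 + t i).
Proof.
move=> t0; elim: s => [|i s IH]; first by rewrite !big_nil addr0.
rewrite !big_cons; have := t0 i.
have : 0 <= \sum_(j <- s) t j by exact: sumr_ge0.
nra.
Qed.

Lemma normc_prodB1 (I : eqType) (s : seq I) (f : I -> R[i]) (d : I -> R) :
  (forall i, i \in s -> normc (f i - 1) <= d i) ->
  normc (\prod_(i <- s) f i - 1) <= expR (\sum_(i <- s) d i) - 1.
Proof.
elim: s => [|i s IH] h; first by rewrite !big_nil subrr Normc.normc0 expR0 subrr.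
rewrite !big_cons expRD.
have {}IH := IH (fun j js => h j (mem_behead (s := i :: s) js)).
have hi := h i (mem_head _ _).
set P := \prod_(j <- s) f j in IH *; set S := \sum_(j <- s) d j in IH *.
have -> : f i * P - 1 = (f i - 1) * P + (P - 1) by ring.
apply: (le_trans (normcD _ _)); rewrite Normc.normcM.
have hP : normc P <= expR S.
  rewrite -[P](subrK 1); apply: (le_trans (normcD _ _)).
  by rewrite Normc.normc1; lra.
have di : 1 + d i <= expR (d i) by exact: expR_ge1Dx.
have di0 : 0 <= d i by exact: le_trans (normc_ge0 _) hi.
have e0 : 0 < expR S by exact: expR_gt0.
have : normc (f i - 1) * normc P <= d i * expR S.
  by apply: ler_pM; rewrite ?normc_ge0.
nra.
Qed.

(** The first [k.+1] terms all dominate the one of index [k]. Under a bound on the sum this gives a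
    decay in [1 / k.+1] that is uniform over all such sequences. *)
Lemma sorted_sum_ge (T : Type) (le : rel T) (g : T -> R) (x0 : T) (s : seq T) k :
  transitive le -> reflexive le -> (forall a b, le a b -> g b <= g a) ->
  (forall a, 0 <= g a) -> sorted le s -> (k < size s)%N ->
  k.+1%:R * g (nth x0 s k) <= \sum_(a <- s) g a.
Proof.
move=> ltr lrefl gle g0 ss ks.
rewrite (big_nth x0) (big_cat_nat _ (n := k.+1)) //=.
rewrite -[leLHS]addr0; apply: lerD; last exact: sumr_ge0.
rewrite [X in X * _](_ : _ = \sum_(0 <= i < k.+1) 1); last first.
  by rewrite big_const_nat subn0 iter_addr_0.
rewrite mulr_suml; apply: ler_sum_nat => i /andP[_ ik]; rewrite mul1r.
by apply: gle; apply: sorted_leq_nth => //; rewrite !inE; apply: leq_ltn_trans ks.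
Qed.

End Products.

(** * Canonical products with bounded square sums along an ultrafilter *)

Section ProductLimit.
Context {R : realType}.
Implicit Types (z w : R[i]).

(** Past the end of [s] the default value 0 contributes the neutral element, so [K] need not be
    compared with the size of [s]. *)
Lemma big_nth_drop (V : Type) (idx : V) (op : Monoid.law idx) (f : R -> V)
    (s : seq R) (K : nat) : f 0 = idx ->
  \big[op/idx]_(x <- s) f x =
    op (\big[op/idx]_(0 <= k < K) f s`_k) (\big[op/idx]_(x <- drop K s) f x).
Proof.
move=> f0; elim: s K => [|x s IH] [|K].
- by rewrite big_geq // Monoid.mul1m.
- rewrite !big_nil Monoid.mulm1 big1 // => k _; by rewrite nth_nil.
- by rewrite big_geq // Monoid.mul1m.
by rewrite big_cons (IH K) big_nat_recl //= Monoid.mulmA.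
Qed.

Definition efac w : R[i] := (1 - w) * cexp w.

Definition ge_abs : rel R := fun x y => `|y| <= `|x|.

Lemma efac_neq0 z (x : R) : complex.Im z != 0 -> efac (z * x%:C) != 0.
Proof.
move=> z0; rewrite mulf_neq0 ?cexp_neq0 //.
apply/eqP => /[dup] /(congr1 (@complex.Re R)) h1 /(congr1 (@complex.Im R)).
move: h1; rewrite !(ReCD, ReCN, ReCM, ImCD, ImCN, ImCM) /= !(mulr0, subr0, add0r).
move=> h1 /eqP; rewrite oppr_eq0 mulf_eq0 (negPf z0) /= => /eqP x0.
by move: h1 => /eqP; rewrite x0 mulr0 subr0 oner_eq0.
Qed.

(** Elementary factor of genus two. It differs from 1 by a cube, so that a bound on the sum of
    squares of sorted entries makes tails uniformly small; with [efac] a tail of many tiny entries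
    need not be close to 1. *)
Definition dfac w : R[i] := efac w * cexp (w ^+ 2 / 2).

Lemma dfac0 : dfac 0 = 1.
Proof. by rewrite /dfac /efac subr0 cexp0 expr0n mul0r cexp0 !mul1r. Qed.

Lemma prod_dfac (I : Type) (s : seq I) (P : pred I) (x : I -> R) z :
  \prod_(i <- s | P i) dfac (z * (x i)%:C) =
    (\prod_(i <- s | P i) efac (z * (x i)%:C))
      * cexp (z ^+ 2 / 2 * (\sum_(i <- s | P i) x i ^+ 2)%:C).
Proof.
rewrite big_split /= -cexp_sum; congr (_ * cexp _).
rewrite rmorph_sum mulr_sumr; apply: eq_bigr => i _.
by rewrite exprMn rmorphXn /=; ring.
Qed.

Context {T : Type} {U : set_system T} {UU : UltraFilter U}.
Variables (v : T -> seq R) (B : R).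
Hypothesis vB : \forall n \near U,
  sorted ge_abs (v n) /\ \sum_(x <- v n) x ^+ 2 <= B.

Let UF : ProperFilter U := ultra_proper.

Lemma near_sqr_nth k : \forall n \near U, k.+1%:R * (v n)`_k ^+ 2 <= B.
Proof.
apply: filterS vB => n [vs vb].
have [kn|kn] := ltnP k (size (v n)); last first.
  rewrite nth_default // expr0n mulr0; apply: le_trans vb.
  by apply: sumr_ge0 => x _; exact: sqr_ge0.
apply: le_trans vb.
apply: (@sorted_sum_ge R R ge_abs (fun x : R => x ^+ 2)) => //.
- by move=> x' y z h1' h2'; exact: le_trans h2' h1'.
- by move=> x; exact: lexx.
- move=> x y h; rewrite -[leLHS]real_normK ?num_real //.
  by rewrite -[leRHS]real_normK ?num_real // lerXn2r // nnegrE.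
by move=> x; exact: sqr_ge0.
Qed.

Lemma ultra_coef_cvg : exists w : nat -> R, forall k, (fun n => (v n)`_k) @ U --> w k.
Proof.
suff h : forall k, exists l : R, (fun n => (v n)`_k) @ U --> l by have [w hw] := choice h; exists w.
move=> k; apply: (@ultra_bounded_cvg _ _ _ _ _ (B + 1)).
apply: filterS (near_sqr_nth k) => n h.
have h2 : (v n)`_k ^+ 2 <= B.
  apply: le_trans h; rewrite ler_peMl ?sqr_ge0 // ler1n //.
rewrite -(ler_pXn2r (n := 2)) ?nnegrE //.
  rewrite real_normK ?num_real //; have := sqr_ge0 (v n)`_k; nra.
by have := sqr_ge0 (v n)`_k; lra.
Qed.

Lemma ultra_sum_cvg : exists A : R, (fun n => \sum_(x <- v n) x ^+ 2) @ U --> A.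
Proof.
apply: (@ultra_bounded_cvg _ _ _ _ _ B); apply: filterS vB => n [_].
by rewrite ger0_norm // sumr_ge0 // => x _; exact: sqr_ge0.
Qed.

Variables (w : nat -> R) (A : R).
Hypothesis vw : forall k, (fun n => (v n)`_k) @ U --> w k.
Hypothesis vA : (fun n => \sum_(x <- v n) x ^+ 2) @ U --> A.

Lemma B_ge0 : 0 <= B.
Proof.
by have [n] := filter_ex (near_sqr_nth 0); apply: le_trans; rewrite mul1r sqr_ge0.
Qed.

Lemma cvg_sum_sqr_nth K : (fun n => \sum_(0 <= k < K) (v n)`_k ^+ 2) @ U -->
  \sum_(0 <= k < K) w k ^+ 2.
Proof.
elim: K => [|K IH].
  by rewrite big_geq //; under eq_fun do rewrite big_geq //; exact: cvg_cst.
rewrite big_nat_recr //=; under eq_fun do rewrite big_nat_recr //=.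
apply: cvgD => //; rewrite expr2; under eq_fun do rewrite expr2.
by apply: cvgM.
Qed.

(** A Fatou inequality. It may be strict for every [K]: the deficit is square mass spread over ever
    smaller entries, and it becomes the Gaussian coefficient of the limit. *)
Lemma sum_sqr_limit_le K : \sum_(0 <= k < K) w k ^+ 2 <= A.
Proof.
have h : (fun n => \sum_(x <- v n) x ^+ 2 - \sum_(0 <= k < K) (v n)`_k ^+ 2) @ U
    --> A - \sum_(0 <= k < K) w k ^+ 2.
  by apply: cvgB; [exact: vA|exact: cvg_sum_sqr_nth].
rewrite -subr_ge0; apply: (@cvgr_to_ge _ _ _ _ _ _ _ h); apply: nearW => n.
rewrite subr_ge0 (@big_nth_drop R 0 +%R (fun x => x ^+ 2) (v n) K) ?expr0n //=.
by rewrite lerDl sumr_ge0 // => x _; exact: sqr_ge0.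
Qed.

Lemma limit_abs_decr k : `|w k.+1| <= `|w k|.
Proof.
have h j : (fun n => `|(v n)`_j|) @ U --> `|w j| by apply: cvg_norm.
have h2 : (fun n => `|(v n)`_k| - `|(v n)`_k.+1|) @ U --> `|w k| - `|w k.+1|.
  by apply: cvgB; exact: h.
rewrite -subr_ge0; apply: (@cvgr_to_ge _ _ _ _ _ _ _ h2).
apply: filterS vB => n [vs _]; rewrite subr_ge0.
have [kn|kn] := ltnP k.+1 (size (v n)); last first.
  by rewrite [X in `|X| <= _]nth_default // normr0.
have tr : transitive ge_abs by move=> x' y z h1' h2'; exact: le_trans h2' h1'.
have rf : reflexive ge_abs by move=> x; exact: lexx.
exact: (sorted_leq_nth tr rf 0 vs) (ltnW kn) kn (leqnSn k).
Qed.

Lemma cvg_sqrt_div : (fun K => Num.sqrt (B / K.+1%:R)) @ \oo --> (0 : R).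
Proof.
rewrite -[X in _ --> X](sqrtr0 R).
apply: continuous_cvg; first exact: sqrt_continuous.
rewrite -[X in _ --> X](mulr0 B).
by apply: cvgM; [apply: cvg_cst|exact: cvg_harmonic].
Qed.

(** From index [K] on, entries are at most [sqrt (B / K.+1)], hence their cubes sum to at most
    [B * sqrt (B / K.+1)]; 100 is the constant of [elementary_factor_cubic], and [r] stands for the
    modulus of [z]. *)
Definition tail_bound (r : R) K := expR (100 * r ^+ 3 * B * Num.sqrt (B / K.+1%:R)) - 1.

Lemma tail_bound_cvg0 r : tail_bound r @ \oo --> (0 : R).
Proof.
have h : (fun K => 100 * r ^+ 3 * B * Num.sqrt (B / K.+1%:R)) @ \oo --> (0 : R).
  rewrite -[X in _ --> X](mulr0 (100 * r ^+ 3 * B)).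
  by apply: cvgM; [apply: cvg_cst|exact: cvg_sqrt_div].
rewrite /tail_bound -[X in _ --> X](subrr 1).
apply: cvgB; last by apply: cvg_cst.
rewrite -[X in _ --> X](expR0 R).
by apply: continuous_cvg; [exact: continuous_expR|exact: h].
Qed.

(** The tail product is close to 1, which gives an error relative to the partial product. In this
    form the estimate also shows that the limit does not vanish. *)
Lemma near_tail z K : normc z * Num.sqrt (B / K.+1%:R) <= 4^-1 ->
  \forall n \near U,
    normc (\prod_(x <- v n) dfac (z * x%:C)
            - \prod_(0 <= k < K) dfac (z * ((v n)`_k)%:C))
      <= normc (\prod_(0 <= k < K) dfac (z * ((v n)`_k)%:C)) * tail_bound (normc z) K.
Proof.
move=> zK; apply: filterS2 vB (near_sqr_nth K) => n [vs vb] vK.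
rewrite (@big_nth_drop _ 1 *%R (fun x : R => dfac (z * x%:C)) (v n) K) /=; last first.
  by rewrite mulr0 dfac0.
set P := \prod_(0 <= k < K) _; rewrite -{2}[P]mulr1 -mulrBr Normc.normcM.
apply: ler_wpM2l; first exact: normc_ge0.
set r := normc z in zK *; have r0 : 0 <= r by exact: normc_ge0.
set eta := Num.sqrt _ in zK *; have eta0 : 0 <= eta by exact: sqrtr_ge0.
have xe x : x \in drop K (v n) -> `|x| <= eta.
  move=> /(nthP 0)[j]; rewrite size_drop => jn <-; rewrite nth_drop.
  have tr : transitive ge_abs by move=> x' y z' h1' h2'; exact: le_trans h2' h1'.
  have rf : reflexive ge_abs by move=> x'; exact: lexx.
  have Kj : (K + j < size (v n))%N by rewrite -ltn_subRL.
  have h : `|(v n)`_(K + j)| <= `|(v n)`_K|.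
    apply: (sorted_leq_nth tr rf 0 vs) => //; last exact: leq_addr.
    by rewrite inE (leq_ltn_trans (leq_addr _ _) Kj).
  apply: (le_trans h).
  rewrite -sqrtr_sqr ler_wsqrtr // ler_pdivlMr ?ltr0n //.
  by rewrite mulrC.
have hx x : x \in drop K (v n) -> normc (dfac (z * x%:C) - 1) <= 100 * r ^+ 3 * eta * x ^+ 2.
  move=> /xe xle; have zx : normc (z * x%:C) = r * `|x| by rewrite Normc.normcM normc_real.
  have h4 : normc (z * x%:C) <= 4^-1.
    by rewrite zx; apply: le_trans zK; apply: ler_wpM2l.
  apply: (le_trans (elementary_factor_cubic h4)).
  rewrite zx exprMn [`|x| ^+ 3]exprS real_normK ?num_real //.
  have -> : 100 * (r ^+ 3 * (`|x| * x ^+ 2)) = 100 * r ^+ 3 * x ^+ 2 * `|x| by ring.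
  have -> : 100 * r ^+ 3 * eta * x ^+ 2 = 100 * r ^+ 3 * x ^+ 2 * eta by ring.
  apply: ler_wpM2l => //; apply: mulr_ge0; last exact: sqr_ge0.
  by apply: mulr_ge0 => //; exact: exprn_ge0.
apply: (le_trans (normc_prodB1 hx)).
rewrite lerD2r ler_expR -mulr_sumr.
have -> : 100 * r ^+ 3 * B * eta = 100 * r ^+ 3 * eta * B by ring.
apply: ler_wpM2l; first by rewrite !mulr_ge0 // exprn_ge0.
apply: le_trans vb.
rewrite (@big_nth_drop R 0 +%R (fun x => x ^+ 2) (v n) K) ?expr0n //=.
by rewrite lerDr sumr_ge0 // => x _; exact: sqr_ge0.
Qed.

Lemma cvg_prod_nth z K : (fun n => \prod_(0 <= k < K) dfac (z * ((v n)`_k)%:C)) @ U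
  --> (\prod_(0 <= k < K) dfac (z * (w k)%:C) : R[i]^o).
Proof.
apply: cvgC_prod => k _.
have h : (fun n => z * ((v n)`_k)%:C) @ U --> (z * (w k)%:C : R[i]^o).
  by apply: cvgC_mul; [exact: cvgC_cst|exact: cvgC_real].
rewrite /dfac /efac; apply: cvgC_mul; last first.
  apply: cvg_cexp; apply: cvgC_mul; last exact: cvgC_cst.
  by rewrite expr2; under eq_fun do rewrite expr2; exact: cvgC_mul.
apply: cvgC_mul; last exact: cvg_cexp.
by apply: (@cvgB _ R[i]^o); [exact: cvgC_cst|exact: h].
Qed.

Lemma near_tail_small z : \forall K \near \oo,
  normc z * Num.sqrt (B / K.+1%:R) <= 4^-1 /\ tail_bound (normc z) K <= 2^-1.
Proof.
have h : (fun K => normc z * Num.sqrt (B / K.+1%:R)) @ \oo --> (0 : R).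
  rewrite -[X in _ --> X](mulr0 (normc z)).
  by apply: cvgM; [apply: cvg_cst|exact: cvg_sqrt_div].
have h1 : \forall K \near \oo, normc z * Num.sqrt (B / K.+1%:R) <= 4^-1.
  by apply: (cvgr_le _ h); rewrite invr_gt0.
have h2 : \forall K \near \oo, tail_bound (normc z) K <= 2^-1.
  by apply: (cvgr_le _ (tail_bound_cvg0 (normc z))); rewrite invr_gt0.
by apply: filterS2 h1 h2.
Qed.

(** Interchange of the limits in [n] along [U] and in [K], permitted by tails that are small
    uniformly in [n]. *)
Lemma ultra_dfac_limit z : exists q : R[i],
  [/\ (fun n => \prod_(x <- v n) dfac (z * x%:C)) @ U --> (q : R[i]^o),
      (fun K => \prod_(0 <= k < K) dfac (z * (w k)%:C)) @ \oo --> (q : R[i]^o) &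
      complex.Im z != 0 -> q != 0].
Proof.
pose Q n := \prod_(x <- v n) dfac (z * x%:C).
pose P K n := \prod_(0 <= k < K) dfac (z * ((v n)`_k)%:C).
pose L K := \prod_(0 <= k < K) dfac (z * (w k)%:C).
have tail K : normc z * Num.sqrt (B / K.+1%:R) <= 4^-1 ->
    \forall n \near U, normc (Q n - P K n) <= normc (P K n) * tail_bound (normc z) K.
  by move=> /near_tail.
have [K0 _ small] := near_tail_small z.
have PL K : P K @ U --> (L K : R[i]^o) by exact: cvg_prod_nth.
have tau0 K : 0 <= tail_bound (normc z) K.
  rewrite subr_ge0 -expR0 ler_expR !mulr_ge0 ?sqrtr_ge0 ?exprn_ge0 ?normc_ge0 //.
  exact: B_ge0.
(* The partial product of length [K0] controls the full products, whose real and imaginary parts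
   therefore converge along [U]. *)
have [M QM] : exists M : R, \forall n \near U, normc (Q n) <= M.
  have [s4 s2] := small K0 (leqnn _); exists (2 * (normc (L K0) + 1)).
  have LK : normc (L K0) < normc (L K0) + 1 by rewrite ltrDl.
  have near_lt : \forall n \near U, normc (P K0 n) < normc (L K0) + 1.
    by apply: (cvgr_lt _ (cvgC_normc (PL K0))).
  apply: filterS2 (tail K0 s4) near_lt => n h1 h2.
  rewrite -[Q n](subrK (P K0 n)); apply: (le_trans (normcD _ _)).
  have : normc (P K0 n) * tail_bound (normc z) K0 <= normc (P K0 n) * 2^-1.
    by apply: ler_wpM2l; [exact: normc_ge0|].
  have := normc_ge0 (P K0 n); lra.
have [a Qa] : exists a : R, (fun n => complex.Re (Q n)) @ U --> a.
  apply: (@ultra_bounded_cvg _ _ _ _ _ M); apply: filterS QM => n.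
  exact: le_trans (normr_Re_le _).
have [b Qb] : exists b : R, (fun n => complex.Im (Q n)) @ U --> b.
  apply: (@ultra_bounded_cvg _ _ _ _ _ M); apply: filterS QM => n.
  exact: le_trans (normr_Im_le _).
have [q Qq] : exists q : R[i], Q @ U --> (q : R[i]^o).
  by exists (a +i* b); apply/cvgC_ReImP.
have main K : (K0 <= K)%N ->
    normc (q - L K) <= normc (L K) * tail_bound (normc z) K.
  move=> /small[s4 _].
  have h1 : (fun n => normc (Q n - P K n)) @ U --> normc (q - L K).
    by apply: cvgC_normc; apply: (@cvgB _ R[i]^o); [exact: Qq|exact: PL].
  have h2 : (fun n => normc (P K n) * tail_bound (normc z) K) @ U
      --> normc (L K) * tail_bound (normc z) K.
    by apply: cvgM; [exact: (cvgC_normc (PL K))|apply: cvg_cst].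
  have h3 : (fun n => normc (P K n) * tail_bound (normc z) K - normc (Q n - P K n)) @ U
      --> normc (L K) * tail_bound (normc z) K - normc (q - L K).
    by apply: cvgB; [exact: h2|exact: h1].
  rewrite -subr_ge0; apply: (@cvgr_to_ge _ _ _ _ _ _ _ h3).
  by apply: filterS (tail K s4) => n; rewrite subr_ge0.
exists q; split => //.
  apply: (@cvgC_of_normc_le _ _ _ _ _ _ (fun K => 2 * normc q * tail_bound (normc z) K)).
    exists K0 => // K /= K0K; have h := main K K0K; have [_ s2] := small K K0K.
    rewrite normc_distC; apply: (le_trans h); apply: ler_wpM2r => //.
    have := ler_normcB (L K) q; rewrite normc_distC.
    have : normc (L K) * tail_bound (normc z) K <= normc (L K) * 2^-1.
      by apply: ler_wpM2l; [exact: normc_ge0|].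
    lra.
  rewrite -[X in _ --> X](mulr0 (2 * normc q)).
  by apply: cvgM; [apply: cvg_cst|exact: tail_bound_cvg0].
(* With [q = 0], [main] bounds [normc (L K0)] by half of itself, although no factor of [L K0]
   vanishes at a nonreal point. *)
move=> z0; apply/eqP => q0; have := main K0 (leqnn _).
have L0 : 0 < normc (L K0).
  rewrite normc_gt0 prodf_seq_neq0; apply/allP => k _ /=.
  by rewrite mulf_neq0 ?cexp_neq0 // efac_neq0.
rewrite q0 sub0r normc_N -[leLHS]mulr1 ler_pM2l // => /le_trans.
by move=> /(_ _ (proj2 (small K0 (leqnn _)))); lra.
Qed.

(** Passing from [dfac] back to [efac] divides by the exponential of [z ^+ 2 / 2] times a square
    sum. That sum tends to [A] along [U], but to the possibly smaller sum of the [w k ^+ 2] for the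
    limit product; the difference is the Gaussian factor. *)
Lemma ultra_efac_limit z : exists L : R[i],
  [/\ (fun n => \prod_(x <- v n) efac (z * x%:C)) @ U --> (L : R[i]^o),
      (fun K => cexp (- (((A - lim (series (fun k => w k ^+ 2) @ \oo)) / 2)%:C * z ^+ 2))
        * \prod_(0 <= k < K) efac (z * (w k)%:C)) @ \oo --> (L : R[i]^o) &
      complex.Im z != 0 -> L != 0].
Proof.
set S := lim _.
have cS : series (fun k => w k ^+ 2) @ \oo --> S.
  apply: nondecreasing_is_cvgn.
    by apply: nondecreasing_series => k _ _; exact: sqr_ge0.
  by exists A => _ [K _ <-]; exact: sum_sqr_limit_le.
have [q [Qq Lq q0]] := ultra_dfac_limit z.
exists (q * cexp (- (z ^+ 2 / 2 * A%:C))); split; last first.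
- by move=> /q0 h; rewrite mulf_neq0 ?cexp_neq0.
- have -> : q * cexp (- (z ^+ 2 / 2 * A%:C)) =
      cexp (- (((A - S) / 2)%:C * z ^+ 2)) * (q * cexp (- (z ^+ 2 / 2 * S%:C))).
    rewrite [RHS]mulrCA -cexpD; congr (_ * cexp _).
    by rewrite rmorphM rmorphB fmorphV rmorph_nat; field.
  apply: cvgC_mul; first exact: cvgC_cst.
  apply: (@near_eq_cvgC _ _ _ _ (fun K => (\prod_(0 <= k < K) dfac (z * (w k)%:C))
    * cexp (- (z ^+ 2 / 2 * (series (fun k => w k ^+ 2) K)%:C)))).
    by apply: nearW => K; rewrite prod_dfac -mulrA -cexpD subrr cexp0 mulr1.
  apply: cvgC_mul; first exact: Lq.
  apply: cvg_cexp; apply: (@cvgN _ R[i]^o).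
  by apply: cvgC_mul; [exact: cvgC_cst|exact: cvgC_real].
apply: (@near_eq_cvgC _ _ _ _ (fun n => (\prod_(x <- v n) dfac (z * x%:C))
    * cexp (- (z ^+ 2 / 2 * (\sum_(x <- v n) x ^+ 2)%:C)))).
  by apply: nearW => n; rewrite prod_dfac -mulrA -cexpD subrr cexp0 mulr1.
apply: cvgC_mul; first exact: Qq.
apply: cvg_cexp; apply: (@cvgN _ R[i]^o).
by apply: cvgC_mul; [exact: cvgC_cst|exact: cvgC_real].
Qed.

End ProductLimit.

(** * Zeros of the approximating polynomials, near 0 and away from it *)

Section LaguerrePolyaLimit.
Context {R : realType}.

(** Continuity allows a move off the real line. Two points that differ by a real shift are required
    so that a quotient of moduli can later isolate the linear exponent of the limit. *)
Lemma entire_nonreal_nonzero (F : R[i] -> R[i]) (z0 : R[i]) :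
  entire F -> F z0 != 0 -> exists x y h : R,
    [/\ y != 0, 0 < h, F (x +i* y) != 0 & F ((x + h) +i* y) != 0].
Proof.
move=> /(_ z0)/derivable1_diffP/differentiable_continuous cF F0.
have [e e0 Fe] : exists2 e : R, 0 < e & forall w, normc (w - z0) < e -> F w != 0.
  have n0 : 0 < normc (F z0) by rewrite normc_gt0.
  move/(cvgC_normcP (F := nbhs (z0 : R[i]^o))) : cF => /(_ _ n0).
  rewrite -(@nbhs_nearE R[i]^o) => /(@nbhs_ballP R[i] R[i]^o)[e /= e0 he].
  have eE : e = (complex.Re e)%:C.
    by move: e0; rewrite ltcE => /andP[/eqP /= ie _]; apply: complex_eqP.
  exists (complex.Re e); first by move: e0; rewrite {1}eE ltcR.
  move=> w; rewrite normc_distC => wz; have := he w.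
  rewrite /ball /= normcE_complex {1}eE ltcR => /(_ wz) h.
  by apply: contraTneq h => ->; rewrite sub0r normc_N ltxx.
case: z0 {cF F0} Fe => a b Fe.
pose y := if b == 0 then e / 4 else b.
exists a, y, (e / 4).
have y0 : y != 0 by rewrite /y; case: ifPn => // _; rewrite gt_eqF // divr_gt0.
have yb : `|y - b| <= e / 4.
  rewrite /y; case: eqP => [->|_]; rewrite ?subr0 ?subrr ?normr0.
    by rewrite ger0_norm // divr_ge0 // ltW.
  by rewrite divr_ge0 // ltW.
split=> //; first by rewrite divr_gt0.
  apply: Fe; apply: (le_lt_trans (normc_le_ReIm _)) => /=.
  by rewrite subrr normr0 add0r; apply: (le_lt_trans yb); lra.
apply: Fe; apply: (le_lt_trans (normc_le_ReIm _)) => /=.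
rewrite (addrC a) addrK (ger0_norm (x := e / 4)); last by rewrite divr_ge0 // ltW.
by apply: (@le_lt_trans _ _ (e / 4 + e / 4)); [rewrite lerD2l|lra].
Qed.

Definition le_abs : rel R := fun x y => `|x| <= `|y|.

Lemma le_abs_trans : transitive le_abs.
Proof. by move=> x y z; exact: le_trans. Qed.

Lemma le_abs_refl : reflexive le_abs.
Proof. by move=> x; exact: lexx. Qed.

Lemma le_abs_total : total le_abs.
Proof. by move=> x y; exact: le_total. Qed.

Lemma sqr_le_norm (x y : R) : `|x| <= `|y| -> x ^+ 2 <= y ^+ 2.
Proof.
move=> h; rewrite -[leLHS]real_normK ?num_real // -[leRHS]real_normK ?num_real //.
by rewrite lerXn2r // nnegrE.
Qed.

(* Doubling the distance to the real line, where all the zeros are, multiplies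
   the modulus by a factor that controls the sum of the inverse squares. *)
Lemma sum_inv_sqr_le (s : seq R) (x y : R) : y != 0 ->
  normc (\prod_(a <- s) ((x +i* y) - a%:C)) ^+ 2
    * (1 + y ^+ 2 * \sum_(a <- s) (a ^+ 2 + (x ^+ 2 + y ^+ 2))^-1)
  <= normc (\prod_(a <- s) ((x +i* (2 * y)) - a%:C)) ^+ 2.
Proof.
move=> y0; have y2 : 0 < y ^+ 2 by rewrite exprn_even_gt0.
rewrite !normc_prod -!prodrXl.
have E a : normc ((x +i* (2 * y)) - a%:C) ^+ 2 = normc ((x +i* y) - a%:C) ^+ 2
    * (1 + 3 * y ^+ 2 / ((x - a) ^+ 2 + y ^+ 2)).
  rewrite !sqr_normcE /= !subr0; field.
  by rewrite gt_eqF // ltr_wpDl // sqr_ge0.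
under [leRHS]eq_bigr do rewrite E.
rewrite [leRHS]big_split; apply: ler_wpM2l.
  by apply: prodr_ge0 => a _; exact: sqr_ge0.
apply: le_trans (prod1D_ge _ _); last first.
  move=> a; apply: divr_ge0; first by apply: mulr_ge0 => //; exact: sqr_ge0.
  by apply: addr_ge0; exact: sqr_ge0.
rewrite lerD2l mulr_sumr; apply: ler_sum => a _.
rewrite [3 * y ^+ 2]mulrC -[leRHS]mulrA; apply: ler_wpM2l; first exact: ltW.
have P0 : 0 < a ^+ 2 + (x ^+ 2 + y ^+ 2) by rewrite ltr_wpDl ?sqr_ge0 // ltr_wpDl ?sqr_ge0.
have Q0 : 0 < (x - a) ^+ 2 + y ^+ 2 by rewrite ltr_wpDl ?sqr_ge0.
rewrite ler_pdivlMr // ler_pdivrMl //.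
(* [(x - a)^2 <= 2 x^2 + 2 a^2]: the factor 3 gained from the doubled height pays for centring the
   denominators at 0 instead of [x]. *)
have := sqr_ge0 (x + a); nra.
Qed.

Section SortedRoots.
Variables (F : R[i] -> R[i]) (A : nat -> R) (t : nat -> seq R) (U : set_system nat).
Hypotheses (UU : UltraFilter U) (ts : forall n, sorted le_abs (t n)).
Hypothesis tF : forall z : R[i],
  (fun n => (A n)%:C * \prod_(a <- t n) (z - a%:C)) @ U --> (F z : R[i]^o).
Variables (x y h : R).
Hypotheses (y0 : y != 0) (h0 : 0 < h) (F0 : F (x +i* y) != 0)
  (Fh : F ((x + h) +i* y) != 0).

Let UF : ProperFilter U := ultra_proper.
Let S := x ^+ 2 + y ^+ 2.

Let S0 : 0 < S.
Proof. by rewrite ltr_wpDl ?sqr_ge0 // exprn_even_gt0. Qed.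

Let g0 (a : R) : 0 < a ^+ 2 + S.
Proof. by rewrite ltr_wpDl // sqr_ge0. Qed.

(** The values at [x + iy] stay away from 0 and those at [x + 2iy] are bounded, so [sum_inv_sqr_le]
    bounds the sum. The shift by [S] keeps the terms finite for zeros near the origin. *)
Lemma sum_inv_sqr_bounded : exists B : R, \forall n \near U,
  \sum_(a <- t n) (a ^+ 2 + S)^-1 <= B.
Proof.
have y2 : 0 < y ^+ 2 by rewrite exprn_even_gt0.
have h1 := @cvgC_normc _ _ _ (@filter_filter _ _ UF) _ _ (@tF (x +i* y)).
have h2 := @cvgC_normc _ _ _ (@filter_filter _ _ UF) _ _ (@tF (x +i* (2 * y))).
set p := normc (F _) in h1; set p' := normc (F _) in h2.
have p0 : 0 < p by rewrite normc_gt0.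
have n1 : \forall n \near U,
    p / 2 <= normc ((A n)%:C * \prod_(a <- t n) ((x +i* y) - a%:C)).
  by apply: (cvgr_ge _ h1); lra.
have n2 : \forall n \near U,
    normc ((A n)%:C * \prod_(a <- t n) ((x +i* (2 * y)) - a%:C)) <= p' + 1.
  by apply: (cvgr_le _ h2); lra.
exists ((p' + 1) ^+ 2 / ((p / 2) ^+ 2 * y ^+ 2)); apply: filterS2 n1 n2 => n m1 m2.
rewrite ler_pdivlMr; last by rewrite mulr_gt0 // exprn_gt0 // divr_gt0.
have sq (u v : R) : 0 <= u -> u <= v -> u ^+ 2 <= v ^+ 2.
  by move=> u0 uv; rewrite lerXn2r // nnegrE //; exact: le_trans uv.
have s1 := sq _ _ (divr_ge0 (ltW p0) (ler0n _ 2)) m1.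
have s2 := sq _ _ (normc_ge0 _) m2.
move: s1 s2; rewrite !Normc.normcM [X in _ <= X -> _]exprMn [X in _ -> X <= _ -> _]exprMn.
have := sum_inv_sqr_le (t n) x y0.
set N := normc (\prod_(a <- t n) _); set N' := normc (\prod_(a <- t n) _).
set s := \sum_(a <- t n) _ => hs s1 s2.
have s_ge0 : 0 <= s by apply: sumr_ge0 => a _; rewrite invr_ge0 ltW.
set c := normc _ in s1 s2; have c0 : 0 <= c ^+ 2 by rewrite exprn_ge0 ?normc_ge0.
have := ler_wpM2l c0 hs; rewrite mulrA.
have : 0 <= y ^+ 2 * s by rewrite mulr_ge0 // ltW.
set q := c ^+ 2 * N ^+ 2 in s1 *; set q' := c ^+ 2 * N' ^+ 2 in s2 *.
have : 0 <= (p / 2) ^+ 2 by exact: sqr_ge0.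
set r := (p / 2) ^+ 2 in s1 *.
move=> r0 ys0 hq; rewrite mulrCA.
have : r * (y ^+ 2 * s) <= q * (y ^+ 2 * s) by apply: ler_wpM2r => //; exact: s1.
rewrite [s * _]mulrC; nra.
Qed.

Variable B : R.
Hypothesis tB : \forall n \near U, \sum_(a <- t n) (a ^+ 2 + S)^-1 <= B.

(** Zeros are sorted by modulus, so the least such [m] counts those that tend to 0 along [U] and is
    the exponent of [z] in the limit. An index beyond the end of [t n] imposes nothing, which covers
    polynomials of bounded degree. *)
Definition away_from0 m := exists2 M : R, 0 < M &
  \forall n \near U, (m < size (t n))%N -> 1 <= M * `|(t n)`_m|.

(** If the zero of index [m] has modulus below 1, the first [m.+1] zeros contribute at least
    [m.+1 / (1 + S)] to a sum bounded by [B]. *)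
Lemma away_from0_ex : exists m, away_from0 m.
Proof.
have B0 : 0 <= B.
  have [n] := filter_ex tB; apply: le_trans.
  by apply: sumr_ge0 => a _; rewrite invr_ge0 ltW.
pose m := Num.bound (B * (1 + S)).
exists m, 1 => //; apply: filterS tB => n tn mn; rewrite mul1r leNgt; apply/negP => a1.
have : m.+1%:R * ((t n)`_m ^+ 2 + S)^-1 <= B.
  apply: le_trans tn.
  apply: (@sorted_sum_ge R R le_abs (fun a : R => (a ^+ 2 + S)^-1)) => //.
  - exact: le_abs_trans.
  - exact: le_abs_refl.
  - by move=> a b ab; rewrite lef_pV2 ?posrE // lerD2r sqr_le_norm.
  by move=> a; rewrite invr_ge0 ltW.
rewrite ler_pdivrMr // => hm.
have a2 : (t n)`_m ^+ 2 <= 1.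
  by rewrite -[leRHS](expr1n _ 2); apply: sqr_le_norm; rewrite normr1 ltW.
have := archi_boundP (mulr_ge0 B0 (addr_ge0 ler01 (ltW S0))); rewrite -/m.
have : B * ((t n)`_m ^+ 2 + S) <= B * (1 + S) by apply: ler_wpM2l => //; rewrite lerD2r.
by rewrite -natr1 in hm; lra.
Qed.

Lemma not_away_from0 k : ~ away_from0 k -> forall e : R, 0 < e ->
  \forall n \near U, (k < size (t n))%N /\ `|(t n)`_k| < e.
Proof.
move=> nk e e0.
pose P := [set n | (k < size (t n))%N -> 1 <= e^-1 * `|(t n)`_k|].
have [UP|] := in_ultra_setVsetC P UU.
  by exfalso; apply: nk; exists e^-1 => //; rewrite invr_gt0.
apply: filterS => n /= /not_implyP[kn /negP]; rewrite -ltNge => hk; split=> //.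
by move: hk; rewrite ltr_pdivrMl // mulr1.
Qed.

Variable m : nat.
Hypotheses (mP : away_from0 m) (mmin : forall k, (k < m)%N -> ~ away_from0 k).

Lemma near_size : \forall n \near U, (m <= size (t n))%N.
Proof.
case: m mmin => [|k] hk; first exact: nearW.
by apply: filterS (not_away_from0 (hk k (ltnSn k)) ltr01) => n [].
Qed.

Lemma nth_cvg0 k : (k < m)%N -> (fun n => (t n)`_k) @ U --> (0 : R).
Proof.
move=> km; apply/cvgrPdist_lt => e e0.
apply: filterS (not_away_from0 (mmin km) e0) => n [_].
by rewrite sub0r normrN.
Qed.

Let v n := map (fun a : R => a^-1) (drop m (t n)).

Lemma near_drop : exists2 M : R, 0 < M &
  \forall n \near U, forall a, a \in drop m (t n) -> 1 <= M * `|a|.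
Proof.
have [M M0 hM] := mP; exists M => //; apply: filterS hM => n hn a.
move=> /(nthP 0)[j]; rewrite size_drop => jn <-; rewrite nth_drop.
have mj : (m + j < size (t n))%N by rewrite -ltn_subRL.
have mn : (m < size (t n))%N by exact: leq_ltn_trans (leq_addr _ _) mj.
apply: (le_trans (hn mn)); rewrite ler_pM2l //.
by apply: (sorted_leq_nth le_abs_trans le_abs_refl 0 (ts n)) => //; exact: leq_addr.
Qed.

(** When [1 <= M * |a|], [a^2 + S <= (1 + S M^2) a^2], so the shifted sums control the sums of
    inverse squares. Inversion turns increasing moduli into decreasing ones. *)
Lemma near_v : exists B' : R, \forall n \near U,
  sorted (@ge_abs R) (v n) /\ \sum_(b <- v n) b ^+ 2 <= B'.
Proof.
have [M M0 hM] := near_drop; exists ((1 + S * M ^+ 2) * B).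
apply: filterS2 hM tB => n hn tn; split.
  rewrite sorted_map.
  apply: (sub_in_sorted (P := mem (drop m (t n))) (e := le_abs)) => //.
  - move=> a b /hn a1 /hn b1 ab; rewrite /= /ge_abs !normfV lef_pV2 // posrE;
      rewrite normr_gt0; apply/eqP => z0.
      by move: b1; rewrite z0 normr0 mulr0 ler10.
    by move: a1; rewrite z0 normr0 mulr0 ler10.
  by apply: drop_sorted.
have M2 : 0 <= 1 + S * M ^+ 2.
  by apply: addr_ge0 => //; apply: mulr_ge0; [exact: ltW|exact: sqr_ge0].
apply: (@le_trans _ _ ((1 + S * M ^+ 2) * \sum_(a <- drop m (t n)) (a ^+ 2 + S)^-1)).
  rewrite big_map mulr_sumr big_seq [leRHS]big_seq; apply: ler_sum => a /hn a1.
  have a2 : 1 <= M ^+ 2 * a ^+ 2.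
    rewrite -exprMn -[leLHS](expr1n _ 2); apply: sqr_le_norm.
    by rewrite normr1 normrM (gtr0_norm M0).
  have a20 : 0 < a ^+ 2.
    rewrite exprn_even_gt0 //=; apply/eqP => z0.
    by move: a1; rewrite z0 normr0 mulr0 ler10.
  rewrite exprVn ler_pdivlMr // ler_pdivrMl //.
  have := ltW S0; nra.
apply: ler_wpM2l => //; apply: le_trans tn.
rewrite -{2}(cat_take_drop m (t n)) big_cat /= lerDr.
by apply: sumr_ge0 => a _; rewrite invr_ge0 ltW.
Qed.

Definition lead_coefficient n := A n * \prod_(a <- drop m (t n)) (- a).

(** Each zero away from 0 is rewritten by [z - a = (- a) * efac (z / a) * cexp (- (z / a))]; the
    leading factors and the linear exponents are collected, and the [m] smallest zeros are left as
    they are. *)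
Lemma near_factorization z : \forall n \near U,
  (A n)%:C * \prod_(a <- t n) (z - a%:C) =
    (lead_coefficient n)%:C * cexp (- (z * (\sum_(b <- v n) b)%:C))
     * \prod_(0 <= k < m) (z - ((t n)`_k)%:C) * \prod_(b <- v n) efac (z * b%:C).
Proof.
have [M M0 hM] := near_drop; apply: filterS2 hM near_size => n hn mn.
rewrite -{1}(cat_take_drop m (t n)) big_cat /=.
have -> : \prod_(a <- take m (t n)) (z - a%:C) = \prod_(0 <= k < m) (z - ((t n)`_k)%:C).
  by rewrite -(map_nth_iota0 0 mn) big_map /index_iota subn0.
have -> : \prod_(a <- drop m (t n)) (z - a%:C) =
   (\prod_(a <- drop m (t n)) (- a))%:C * cexp (- (z * (\sum_(b <- v n) b)%:C)) *
   \prod_(b <- v n) efac (z * b%:C).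
  rewrite !big_map rmorph_prod rmorph_sum mulr_sumr -sumrN cexp_sum -!big_split /=.
  rewrite big_seq [RHS]big_seq; apply: eq_bigr => a /hn a1.
  have a0 : a%:C != 0 :> R[i].
    rewrite -normc_gt0 normc_real normr_gt0; apply/eqP => z0.
    by move: a1; rewrite z0 normr0 mulr0 ler10.
  rewrite /efac mulrACA -mulrA [cexp _ * _]mulrC -cexpD subrr cexp0 mulr1.
  by rewrite fmorphV rmorphN; field.
rewrite /lead_coefficient rmorphM; ring.
Qed.

End SortedRoots.

End LaguerrePolyaLimit.

(** * Pointwise limits of polynomials with real zeros *)

Section LaguerrePolyaLimitTheorem.
Context {R : realType}.

Lemma near_eq_cvgR {T : Type} {F : set_system T} {FF : Filter F} (f g : T -> R) (l : R) :
  (\forall t \near F, f t = g t) -> f @ F --> l -> g @ F --> l.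
Proof.
move=> fg /cvgrPdist_lt h; apply/cvgrPdist_lt => e e0.
by apply: filterS2 fg (h e e0) => t ->.
Qed.

Lemma efac0 : efac 0 = 1 :> R[i].
Proof. by rewrite /efac subr0 cexp0 mulr1. Qed.

(** [lp_factor] has its zero at [- x], whence [x k = - (w k)^-1]. Decreasing moduli put the nonzero
    [w k] on an initial segment, which is what [below] encodes; the remaining factors are
    [efac 0 = 1]. *)
Lemma laguerre_polya_of_limit (phi : R[i] -> R[i]) (a b c A : R) (m : nat) (w : nat -> R) :
  entire phi -> real_on_reals phi -> 0 <= a ->
  (forall k, `|w k.+1| <= `|w k|) ->
  (forall K, \sum_(0 <= k < K) w k ^+ 2 <= A) ->
  (forall z, (fun K => c%:C * z ^+ m * cexp (b%:C * z) *
      (cexp (- (a%:C * z ^+ 2)) * \prod_(0 <= k < K) efac (z * (w k)%:C))) @ \oo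
    --> (phi z : R[i]^o)) ->
  laguerre_polya phi.
Proof.
move=> ent rea a0 wdecr wA cv; split=> //.
have wz k j : (k <= j)%N -> w k = 0 -> w j = 0.
  move=> kj wk0; rewrite -(subnK kj); elim: (j - k)%N => // l IH.
  by apply/eqP; rewrite -normr_le0; apply: (le_trans (wdecr _)); rewrite IH normr0.
have [om omE] : exists om : option nat, forall k, below om k = (w k != 0).
  have [h|h] := pselect (exists k, w k == 0).
    case: (ex_minnP h) => k0 /eqP wk0 kmin; exists (Some k0) => k /=.
    rewrite ltnNge; congr negb; apply/idP/eqP => [kk|wk]; first exact: wz wk0.
    by apply: kmin; rewrite wk.
  by exists None => k /=; apply/esym/negP => wk; apply: h; exists k.
exists om, a, b, c, m, (fun k => - (w k)^-1); split; first exact: a0.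
- by move=> k; rewrite omE oppr_eq0 invr_eq0.
- apply: (@le_lt_trans _ _ A%:E); last exact: ltry.
  apply: lime_le; first by apply: is_cvg_nneseries_cond => n _ _; rewrite lee_fin invr_ge0 sqr_ge0.
  apply: nearW => n; rewrite sumEFin lee_fin; apply: le_trans (wA n).
  rewrite big_mkcond /=; apply: ler_sum => k _; case: ifP => _; last exact: sqr_ge0.
  by rewrite sqrrN exprVn invrK.
move=> z; apply: near_eq_cvgC (cv z); apply: nearW => n.
have alg (u e1 e2 p q : R[i]) : p = q -> u * e2 * (e1 * p) = u * (e1 * e2) * q.
  by move=> ->; ring.
rewrite cexpD; apply: alg.
rewrite [RHS]big_mkcond /=; apply: eq_bigr => k _; rewrite omE.
case: eqVneq => /= [->|wk]; first by rewrite mulr0 efac0.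
rewrite /lp_factor /efac.
have -> : z / (- (w k)^-1)%:C = - (z * (w k)%:C).
  by rewrite -fmorphV invrN invrK rmorphN mulrN.
by rewrite opprK.
Qed.

(** All data are extracted along an ultrafilter [U] finer than [\oo]. Nothing is lost, since neither
    [F z] nor the limit product depends on [n]. *)
Theorem laguerre_polya_limit (F : R[i] -> R[i]) (A : nat -> R) (s : nat -> seq R) :
  entire F ->
  (forall z : R[i],
    (fun n => (A n)%:C * \prod_(a <- s n) (z - a%:C)) @ \oo --> (F z : R[i]^o)) ->
  laguerre_polya F.
Proof.
move=> entF cvF.
have realF : real_on_reals F.
  move=> x; have := cvF x%:C => /cvgC_ReImP[_ hi].
  have h0 : (fun n => complex.Im ((A n)%:C * \prod_(a <- s n) (x%:C - a%:C))) @ \oo --> (0 : R).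
    apply: (@near_eq_cvgR _ _ _ (fun=> 0)); last by apply: cvg_cst.
    apply: nearW => n.
    rewrite (_ : _ * _ = (A n * \prod_(a <- s n) (x - a))%:C) //.
    rewrite rmorphM rmorph_prod; congr (_ * _); apply: eq_bigr => a _.
    by rewrite rmorphB.
  exact: (@cvg_unique R (@norm_hausdorff _ _) _ _ _ _ hi h0).
have [F0|/existsNP[z0 /eqP Fz0]] := pselect (forall z, F z = 0).
  apply: (@laguerre_polya_of_limit F 0 0 0 0 0 (fun=> 0) entF realF (lexx _) (fun=> lexx _)).
    by move=> K; rewrite big1 // => k _; rewrite expr0n.
  move=> z; rewrite F0.
  apply: (@near_eq_cvgC _ _ _ _ (fun=> 0)); last by apply: cvgC_cst.
  by apply: nearW => K; rewrite !mul0r.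
have [x [y [h [y0 h0 F0 Fh]]]] := entire_nonreal_nonzero entF Fz0.
pose t n := sort le_abs (s n).
have ts n : sorted le_abs (t n) by apply: sort_sorted; exact: le_abs_total.
have [U [UU ooU]] := ultraFilterLemma (@eventually_filter).
have UF : ProperFilter U by exact: ultra_proper.
have cM f1 f2 a1 a2 := @cvgC_mul R nat U UF f1 f2 a1 a2.
have cV f a := @cvgC_inv R nat U UF f a.
have cN f a := @cvgC_normc R nat U (@filter_filter _ _ UF) f a.
have cR f a := @cvgC_real R nat U UF f a.
have tF (z : R[i]) : (fun n => (A n)%:C * \prod_(a <- t n) (z - a%:C)) @ U --> (F z : R[i]^o).
  apply/cvgC_normcP => e e0; have := cvF z => /cvgC_normcP/(_ e e0) H.
  apply: ooU; apply: filterS H => n.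
  by rewrite (perm_big (t n)) //= perm_sym perm_sort.
have [B tB] := sum_inv_sqr_bounded UU tF y0 F0.
have aw : exists m, `[< away_from0 t U m >].
  have [m hm] := away_from0_ex UU ts y0 tB.
  by exists m; apply/asboolP.
case: (ex_minnP aw) => m /asboolP mP mmin'.
have mmin k : (k < m)%N -> ~ away_from0 t U k.
  by move=> km /asboolP/mmin'; rewrite leqNgt km.
pose v n := map (fun a : R => a^-1) (drop m (t n)).
have [B' vB] := near_v UU ts y0 tB mP.
have [w vw] := ultra_coef_cvg vB.
have [AA vA] := ultra_sum_cvg vB.
set aa := (AA - lim (series (fun k => w k ^+ 2) @ \oo)) / 2.
have lim_fac (z : R[i]) := @ultra_efac_limit _ _ _ UU _ _ vB _ _ vw vA z.
pose C n := lead_coefficient A t m n.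
pose beta n := \sum_(b <- v n) b.
have fact (z : R[i]) := near_factorization A UU ts mP mmin z.
have cvz (z : R[i]) : (fun n => \prod_(0 <= k < m) (z - ((t n)`_k)%:C)) @ U --> (z ^+ m : R[i]^o).
  have -> : z ^+ m = \prod_(0 <= k < m) z by rewrite big_const_nat subn0 iter_mulr_1.
  rewrite big_nat; under eq_fun do rewrite big_nat.
  apply: cvgC_prod => k /andP[_ km]; rewrite -[X in _ --> X]subr0.
  apply: (@cvgB _ R[i]^o); first by apply: cvgC_cst.
  exact: (cvgC_real (nth_cvg0 UU mmin km)).
(* At a nonreal point where [F] is nonzero, [z ^+ m] and the limit of the elementary factors are
   nonzero too. Division isolates the remaining factor, with two unknown sequences [C] and
   [beta]. *)
have cvD (z : R[i]) : complex.Im z != 0 -> F z != 0 -> exists2 g : R[i], g != 0 &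
    (fun n => (C n)%:C * cexp (- (z * (beta n)%:C))) @ U --> (g : R[i]^o).
  move=> Iz Fz; have [L [vL _ L0]] := lim_fac z.
  have zm : z ^+ m != 0.
    by rewrite expf_neq0 //; apply: contraNneq Iz => ->.
  have zL : z ^+ m * L != 0 by rewrite mulf_neq0 // L0.
  exists (F z * (z ^+ m * L)^-1); first by rewrite mulf_neq0 // invr_neq0.
  have hP := cM _ _ _ _ (cvz z) vL.
  have hq := cM _ _ _ _ (tF z) (cV _ _ zL hP).
  have nz : \forall n \near U,
      \prod_(0 <= k < m) (z - ((t n)`_k)%:C) * \prod_(b <- v n) efac (z * b%:C) != 0.
    have n0 : 0 < normc (z ^+ m * L) by rewrite normc_gt0.
    by apply: filterS (cvgr_gt _ (cN _ _ hP) _ n0) => n; rewrite normc_gt0.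
  apply: near_eq_cvgC hq; apply: filterS2 (fact z) nz => n -> nz.
  by rewrite -/(v n) -[X in X / _]mulrA mulfK.
have [g1 g10 hg1] := cvD (x +i* y) y0 F0.
have [g2 g20 hg2] := cvD ((x + h) +i* y) y0 Fh.
have normE u n : normc ((C n)%:C * cexp (- ((u +i* y) * (beta n)%:C))) =
    `|C n| * expR (- (u * beta n)).
  rewrite Normc.normcM normc_real normc_cexp; congr (_ * expR _) => /=.
  by rewrite mulr0 subr0.
have [bb hbb] : exists bb : R, beta @ U --> bb.
  have N1 := cN _ _ hg1; have N2 := cN _ _ hg2.
  have p1 : 0 < normc g1 by rewrite normc_gt0.
  have p2 : 0 < normc g2 by rewrite normc_gt0.
  (* The modulus of that factor depends on the point through its real part only. The quotient of the
     moduli at two points at distance [h] on a horizontal line is free of [C n], and [ln] recovers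
     [beta n]. *)
  have hr : (fun n => expR (- (h * beta n))) @ U --> normc g2 / normc g1.
    have hq : (fun n => normc ((C n)%:C * cexp (- (((x + h) +i* y) * (beta n)%:C))) /
        normc ((C n)%:C * cexp (- ((x +i* y) * (beta n)%:C)))) @ U --> normc g2 / normc g1.
      by apply: cvgM; [exact: N2|apply: cvgV; [exact: lt0r_neq0|exact: N1]].
    apply: near_eq_cvgR hq.
    apply: filterS (cvgr_gt _ N1 _ p1) => n; rewrite /= !normE => n1.
    have C0 : `|C n| != 0 by apply: contraTneq n1 => ->; rewrite mul0r ltxx.
    rewrite invfM mulrACA divff // mul1r -expRN -expRD; congr expR; ring.
  exists (- (ln (normc g2 / normc g1) / h)).
  have q0 : 0 < normc g2 / normc g1 by rewrite divr_gt0.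
  have hl := @continuous_cvg _ _ _ _ _ _ (@ln R) _ (continuous_ln q0) hr.
  have hN : (fun n => - (ln (expR (- (h * beta n))) / h)) @ U -->
      - (ln (normc g2 / normc g1) / h).
    by apply: cvgN; apply: cvgM; [exact: hl|apply: cvg_cst].
  apply: near_eq_cvgR hN; apply: nearW => n /=.
  by rewrite expRK; field; rewrite gt_eqF.
have cvE (z : R[i]) : (fun n => cexp (- (z * (beta n)%:C))) @ U --> (cexp (- (z * bb%:C)) : R[i]^o).
  apply: cvg_cexp; apply: (@cvgN _ R[i]^o).
  by apply: cvgC_mul; [exact: cvgC_cst|exact: cvgC_real].
have [c hc] : exists c : R, C @ U --> c.
  have hq := cM _ _ _ _ hg1 (cV _ _ (cexp_neq0 _) (cvE (x +i* y))).
  set g := _ / _ in hq.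
  have hC : (fun n => (C n)%:C) @ U --> (g : R[i]^o).
    apply: near_eq_cvgC hq; apply: nearW => n.
    by rewrite mulfK // cexp_neq0.
  by have [hRe _] := (proj1 (@cvgC_ReImP _ _ _ _ _ _) hC); exists (complex.Re g).
have wA K : \sum_(0 <= k < K) w k ^+ 2 <= AA by exact: (sum_sqr_limit_le vw vA).
have aa0 : 0 <= aa.
  apply: divr_ge0 => //; rewrite subr_ge0.
  have inc : nondecreasing_seq (series (fun k => w k ^+ 2)).
    by apply: nondecreasing_series => k _ _; exact: sqr_ge0.
  apply: limr_le; last by apply: nearW => K; exact: wA.
  apply: nondecreasing_is_cvgn => //.
  by exists AA => _ [K _ <-]; exact: wA.
apply: (@laguerre_polya_of_limit F aa (- bb) c AA m w entF realF aa0
  (limit_abs_decr vB vw) wA).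
move=> z; have [L [vL wL _]] := lim_fac z.
(* Limits along [U] are unique, which identifies [F z]. Convergence along [\oo] to the same [L] is
   the second part of [ultra_efac_limit]. *)
have -> : F z = c%:C * z ^+ m * cexp ((- bb)%:C * z) * L.
  apply: (@cvgC_unique _ _ U UF _ _ _ (tF z)).
  have hq := cM _ _ _ _ (cM _ _ _ _ (cM _ _ _ _ (cR _ _ hc) (cvE z)) (cvz z)) vL.
  rewrite (_ : c%:C * z ^+ m * _ * L = c%:C * cexp (- (z * bb%:C)) * z ^+ m * L); last first.
    by rewrite rmorphN mulNr [bb%:C * z]mulrC; ring.
  by apply: near_eq_cvgC hq; apply: filterS (fact z) => n ->.
by apply: cvgC_mul; [exact: cvgC_cst|exact: wL].
Qed.

End LaguerrePolyaLimitTheorem.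

(** * Polynomials on the imaginary axis *)

Section ImaginaryAxis.
Context {R : realType}.
Implicit Types (p : {poly R}) (t : R).

Lemma ReCMr (z : R[i]) t : complex.Re (z * t%:C) = complex.Re z * t.
Proof. by rewrite ReCM mulr0 subr0. Qed.

Lemma ImCMr (z : R[i]) t : complex.Im (z * t%:C) = complex.Im z * t.
Proof. by rewrite ImCM mulr0 add0r. Qed.

Definition reI p : {poly R} := \poly_(k < size p) complex.Re ((p`_k)%:C * 'i ^+ k).
Definition imI p : {poly R} := \poly_(k < size p) complex.Im ((p`_k)%:C * 'i ^+ k).

Definition onI p t : R[i] := ceval p ('i * t%:C).

Lemma Re_sum (I : Type) (s : seq I) (P : pred I) (f : I -> R[i]) :
  complex.Re (\sum_(i <- s | P i) f i) = \sum_(i <- s | P i) complex.Re (f i).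
Proof. by apply: big_morph; [exact: ReCD|]. Qed.

Lemma Im_sum (I : Type) (s : seq I) (P : pred I) (f : I -> R[i]) :
  complex.Im (\sum_(i <- s | P i) f i) = \sum_(i <- s | P i) complex.Im (f i).
Proof. by apply: big_morph; [exact: ImCD|]. Qed.

Lemma onIE p t : onI p t = \sum_(k < size p) ((p`_k)%:C * 'i ^+ k) * (t ^+ k)%:C.
Proof.
rewrite /onI /ceval horner_coef size_map_poly; apply: eq_bigr => k _.
by rewrite coef_map /= exprMn rmorphXn mulrA.
Qed.

Lemma Re_onI p t : complex.Re (onI p t) = (reI p).[t].
Proof.
rewrite onIE Re_sum /reI horner_poly; apply: eq_bigr => k _.
by rewrite ReCMr.
Qed.

Lemma Im_onI p t : complex.Im (onI p t) = (imI p).[t].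
Proof.
rewrite onIE Im_sum /imI horner_poly; apply: eq_bigr => k _.
by rewrite ImCMr.
Qed.

Lemma coef_reI p k : (reI p)`_k = complex.Re ((p`_k)%:C * 'i ^+ k).
Proof.
by rewrite coef_poly; case: ltnP => // h; rewrite nth_default // mul0r.
Qed.

Lemma coef_imI p k : (imI p)`_k = complex.Im ((p`_k)%:C * 'i ^+ k).
Proof.
by rewrite coef_poly; case: ltnP => // h; rewrite nth_default // mul0r.
Qed.

(** Real part of [d/dt p(it) = i p'(it)]. *)
Lemma imI_deriv p : imI p^`() = - (reI p)^`().
Proof.
apply/polyP => k; rewrite coef_imI coefN !coef_deriv coef_reI.
rewrite exprSr mulrA ReiNIm mulNrn opprK -[RHS]mulr_natr -ImCMr; congr complex.Im.
by rewrite rmorphMn rmorph_nat mulr_natr mulrnAl.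
Qed.

Lemma onIN p t : onI p (- t) = (onI p t)^*.
Proof.
rewrite /onI -ceval_conj; congr ceval.
by apply: complex_eqP; rewrite ?ReCJ ?ImCJ !(ReCM, ImCM) /=; ring.
Qed.

Lemma reI_odd p k : odd k -> (reI p)`_k = 0.
Proof.
move=> ok; have -> : k = (k./2).*2.+1 by rewrite -[LHS]odd_double_half ok.
rewrite coef_reI exprS -mul2n exprM sqr_i -[-1](rmorphN1 (real_complex R)) -rmorphXn.
by rewrite mulrA ReCMr ReiNIm oppr0 mul0r.
Qed.

Lemma horner_bound p (T : R) : exists2 M : R, 0 <= M &
  forall t, `|t| <= T -> `|p.[t]| <= M.
Proof.
exists (\sum_(k < size p) `|p`_k| * `|T| ^+ k).
  by apply: sumr_ge0 => k _; rewrite mulr_ge0 // exprn_ge0.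
move=> t tT; rewrite horner_coef; apply: (le_trans (ler_norm_sum _ _ _)).
apply: ler_sum => k _; rewrite normrM normrX; apply: ler_wpM2l => //.
by apply: lerXn2r; rewrite ?nnegrE // (le_trans tT) // ler_norm.
Qed.

Lemma poly_ge_monomial p k : (k < size p)%N -> 0 < lead_coef p ->
  exists2 e : R, 0 < e & exists t0 : R, forall t, t0 <= t -> e * t ^+ k <= p.[t].
Proof.
move=> kp lp; pose e := lead_coef p / 2; exists e; first exact: divr_gt0.
have le : 0 < lead_coef (p - e *: 'X^k).
  have [kp'|kp'] := ltnP k.+1 (size p).
    rewrite lead_coefDl // size_polyN size_scale ?size_polyXn //.
    by rewrite gt_eqF // divr_gt0.
  have sp : size p = k.+1 by apply/eqP; rewrite eqn_leq kp' kp.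
  have c : (p - e *: 'X^k)`_k = e.
    rewrite coefB coefZ coefXn eqxx mulr1 /e /lead_coef sp /=; lra.
  have e0 : e != 0 by rewrite gt_eqF // divr_gt0.
  have s : size (p - e *: 'X^k) = k.+1.
    apply/eqP; rewrite eqn_leq; apply/andP; split.
      apply: (leq_trans (size_polyD _ _)).
      by rewrite sp size_polyN size_scale // size_polyXn maxnn.
    by rewrite ltnNge; apply: contra_neqN e0 => h; rewrite -c nth_default.
  by rewrite /lead_coef s /= c divr_gt0.
have [t0 ht0] := poly_pinfty_gt_lc le.
exists t0 => t /ht0 h; have := le_trans (ltW le) h.
by rewrite hornerD hornerN hornerZ hornerXn subr_ge0.
Qed.

Lemma poly_eventually_signed p : exists t0 : R,
  (forall t, t0 <= t -> 0 <= p.[t]) \/ (forall t, t0 <= t -> p.[t] <= 0).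
Proof.
have [lp|lp|lp] := ltgtP 0 (lead_coef p).
- have [t0 h] := poly_pinfty_gt_lc lp; exists t0; left => t /h.
  by apply: le_trans; exact: ltW.
- have lN : 0 < lead_coef (- p) by rewrite lead_coefN oppr_gt0.
  have [t0 h] := poly_pinfty_gt_lc lN; exists t0; right => t /h.
  by rewrite lead_coefN hornerN lerN2 => /le_trans; apply; exact: ltW.
have -> : p = 0 by apply/eqP; rewrite -lead_coef_eq0 -lp.
by exists 0; left => t _; rewrite horner0.
Qed.

Variable G : {poly R}.
Hypothesis Ginf : complex.Re (ceval G ('i * t%:C)) @[t --> +oo_R] --> -oo_R.

Let Gle (c : R) : exists M : R, forall t, M < t -> (reI G).[t] < c.
Proof.
move: Ginf => /cvgrNyPlt/(_ c)[M [_ hM]]; exists M => t /hM.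
by rewrite -Re_onI.
Qed.

Lemma reI_lead_lt0 : lead_coef (reI G) < 0.
Proof.
rewrite ltNge; apply/negP => l0.
have [p0|l1] := eqVneq (reI G) 0.
  have [M hM] := Gle 0; have := hM (M + 1); rewrite ltrDl p0 horner0 ltxx.
  by move=> /(_ ltr01).
have l2 : 0 < lead_coef (reI G) by rewrite lt_neqAle l0 eq_sym lead_coef_eq0 l1.
have [t0 h] := poly_pinfty_gt_lc l2; have [M hM] := Gle 0.
have h1 : t0 <= Num.max t0 (M + 1) by rewrite le_max lexx.
have h2 : M < Num.max t0 (M + 1) by rewrite lt_max ltrDl ltr01 orbT.
by have := lt_trans l2 (le_lt_trans (h _ h1) (hM _ h2)); rewrite ltxx.
Qed.

(** A polynomial in [t] that tends to minus infinity is not constant, and evenness excludes degree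
    one. *)
Lemma size_reI_gt2 : (2 < size (reI G))%N.
Proof.
have l := reI_lead_lt0.
case E : (size (reI G)) => [|[|[|k]]] //.
- by move: l; rewrite /lead_coef E /= nth_default ?E // ltxx.
- move: l; rewrite /lead_coef E /= => l.
  have [M hM] := Gle (reI G)`_0.
  have := hM (M + 1); rewrite ltrDl ltr01 => /(_ isT).
  have -> : reI G = ((reI G)`_0)%:P by apply: size1_polyC; rewrite E.
  by rewrite hornerC coefC /= ltxx.
by move: l; rewrite /lead_coef E /= reI_odd // ltxx.
Qed.

(** [Im G'(it)] is minus the derivative of [Re G(it)], so it has positive leading coefficient and
    degree at least 1. This linear growth is the source of every decay estimate for the
    coefficients. *)
Lemma imI_deriv_ge : exists2 e : R, 0 < e & exists t0 : R, forall t, t0 <= t ->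
  e * t <= complex.Im (onI G^`() t).
Proof.
have s : size (imI G^`()) = (size (reI G)).-1 by rewrite imI_deriv size_polyN size_deriv.
have s2 : (1 < size (imI G^`()))%N by rewrite s; move: size_reI_gt2; case: (size _) => [|[|]].
have l : 0 < lead_coef (imI G^`()).
  rewrite imI_deriv lead_coefN oppr_gt0 /lead_coef size_deriv coef_deriv.
  move: size_reI_gt2 reI_lead_lt0; rewrite /lead_coef.
  by case: (size _) => [|[|k]] //= _ h; rewrite pmulrn_llt0.
have [e e0 [t0 ht]] := poly_ge_monomial s2 l.
by exists e => //; exists t0 => t /ht; rewrite expr1 Im_onI.
Qed.

Lemma size_deriv_gt1 : (1 < size G^`())%N.
Proof.
rewrite size_deriv; have h := size_reI_gt2.
have : (2 < size G)%N by apply: leq_trans h (size_poly _ _).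
by case: (size G) => [|[|[|]]].
Qed.

Lemma reI_gaussian_le : exists2 e : R, 0 < e & exists K : R, forall t,
  complex.Re (onI G t) <= K - e * t ^+ 2.
Proof.
have l : 0 < lead_coef (- reI G) by rewrite lead_coefN oppr_gt0 reI_lead_lt0.
have s : (2 < size (- reI G))%N by rewrite size_polyN size_reI_gt2.
have [e e0 [t0 ht]] := poly_ge_monomial s l.
have [M M0 hM] := horner_bound (reI G) t0.
exists e => //; exists (M + e * t0 ^+ 2) => t.
wlog t_ge0 : t / 0 <= t.
  move=> H; have [/H //|t_lt0] := leP 0 t.
  have := H (- t); rewrite oppr_ge0 onIN ReCJ sqrrN; apply; exact: ltW.
rewrite Re_onI; have [tt|tt] := leP t0 t.
  have := ht t tt; rewrite hornerN => h.
  have : 0 <= e * t0 ^+ 2 by rewrite mulr_ge0 ?sqr_ge0 // ltW.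
  lra.
have t00 : 0 <= t0 by exact: le_trans (ltW tt).
have h : (reI G).[t] <= M.
  apply: (le_trans (ler_norm _)); apply: hM.
  by rewrite ger0_norm // ltW.
have : e * t ^+ 2 <= e * t0 ^+ 2.
  by rewrite ler_pM2l // lerXn2r // ?nnegrE // ltW.
lra.
Qed.

End ImaginaryAxis.

(** * Trigonometric approximants *)

Lemma onI_correction {R : realType} (D : {poly R}) (k be c t : R) :
  onI (k *: (D * (1 - be *: 'X) ^+ 2 * (1 - c *: 'X^2))) t =
    k%:C * onI D t * (1 - 'i * (be * t)%:C) ^+ 2 * (1 + c * t ^+ 2)%:C.
Proof.
have cZ (x : R) (p : {poly R}) z : ceval (x *: p) z = x%:C * ceval p z.
  by rewrite -mul_polyC cevalM cevalC.
have c1B (p : {poly R}) z : ceval (1 - p) z = 1 - ceval p z.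
  by rewrite /ceval rmorphB rmorph1 hornerD hornerN hornerC.
have cX z : ceval ('X : {poly R}) z = z by rewrite /ceval map_polyX hornerX.
rewrite /onI cZ !cevalM !c1B !cZ cevalM cX.
have i2 : ('i * t%:C) * ('i * t%:C) = - (t ^+ 2)%:C :> R[i].
  by rewrite mulrACA -expr2 sqr_i mulN1r -rmorphM -expr2.
rewrite i2 rmorphD rmorph1 (rmorphM _ c) (rmorphM _ be) mulrN opprK.
ring.
Qed.

Section Approximant.
Context {R : realType}.
Variables (D : {poly R}) (T : R).

(** Half-angle formula: [beta T = - a / (b + H)] with [D(iT) = a + ib] of modulus [H], so that
    [(1 - i beta T)^2] rotates [D(iT)] onto the positive imaginary axis. *)
Definition apx_slope : R :=
  - complex.Re (onI D T) / (complex.Im (onI D T) + normc (onI D T)) / T.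

(** Modulus of [D(iT) (1 - i beta T)^2 (1 + T)], the corrected value at [iT] before scaling. *)
Definition apx_mod : R :=
  2 * normc (onI D T) ^+ 2 / (complex.Im (onI D T) + normc (onI D T)) * (1 + T).

(** The step [2 / apx_mod] would give [Q(iT) = 2i / eps] at once, but [T / eps] must be an integer.
    [T * apx_mod / 2] is therefore rounded up, and [apx_scale], which tends to 1, makes up for the
    rounding. *)
Definition apx_deg : nat := (Num.truncn (T * apx_mod / 2)).+1.

Definition apx_step : R := T / apx_deg%:R.

Definition apx_scale : R := 2 * apx_deg%:R / (T * apx_mod).

(* The real rooted factor after [D] tends to 1; it is chosen so that
   [Q (i T) = 2 i / eps], which makes the recurrence for [apx_coef] terminate
   exactly at the index [apx_deg]. *)
Definition apx_poly : {poly R} :=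
  apx_scale *: (D * (1 - apx_slope *: 'X) ^+ 2 * (1 - T^-1 *: 'X^2)).

Local Notation a := (complex.Re (onI D T)).
Local Notation b := (complex.Im (onI D T)).
Local Notation H := (normc (onI D T)).
Local Notation beta := apx_slope.
Local Notation Y := apx_mod.
Local Notation N := apx_deg.
Local Notation eps := apx_step.
Local Notation kap := apx_scale.
Local Notation Q := apx_poly.

Hypotheses (T0 : 0 < T) (b0 : 0 < b).

Lemma bH_gt0 : 0 < b + H.
Proof. by rewrite ltr_wpDr ?normc_ge0. Qed.

Lemma sqrH : H ^+ 2 = a ^+ 2 + b ^+ 2.
Proof. exact: sqr_normcE. Qed.

Lemma le_bH : b <= H.
Proof. exact: le_trans (ler_norm _) (normr_Im_le _). Qed.

Lemma apx_slope_le1 : `|beta * T| <= 1.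
Proof.
rewrite /apx_slope divfK ?gt_eqF // normrM normfV (gtr0_norm bH_gt0).
rewrite ler_pdivrMr ?bH_gt0 // mul1r normrN.
by apply: (le_trans (normr_Re_le _)); rewrite lerDr ltW.
Qed.

Lemma apx_mod_ge : b * (1 + T) <= Y.
Proof.
apply: ler_wpM2r; first by rewrite addr_ge0 // ltW.
rewrite ler_pdivlMr ?bH_gt0 //; have := le_bH; have := b0; nra.
Qed.

Lemma apx_mod_gt0 : 0 < Y.
Proof. by apply: lt_le_trans apx_mod_ge; rewrite mulr_gt0 // addr_gt0. Qed.

Lemma apx_step_gt0 : 0 < eps.
Proof. by rewrite divr_gt0 // ltr0n. Qed.

Lemma apx_stepN : eps * N%:R = T.
Proof. by rewrite divfK // pnatr_eq0. Qed.

Lemma apx_step_le : eps <= 2 / Y.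
Proof.
rewrite ler_pdivlMr ?apx_mod_gt0 // /apx_step mulrAC ler_pdivrMr ?ltr0n //.
have := truncnS_gt (T * Y / 2); rewrite -/N; lra.
Qed.

Lemma apx_scale_bounds : 1 <= kap /\ kap <= 1 + 2 / (T * Y).
Proof.
have TY : 0 < T * Y by rewrite mulr_gt0 ?apx_mod_gt0.
split.
  rewrite ler_pdivlMr // mul1r.
  have := truncnS_gt (T * Y / 2); rewrite -/N; lra.
have -> : 1 + 2 / (T * Y) = (T * Y + 2) / (T * Y) by rewrite [RHS]mulrDl divff ?gt_eqF.
rewrite ler_pM2r ?invr_gt0 // /apx_deg -natr1.
have := truncn_le (T * Y / 2); rewrite (ltW (divr_gt0 TY (ltr0n _ 2))) => h.
have {}h : (Num.truncn (T * Y / 2))%:R <= T * Y / 2 by rewrite h.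
lra.
Qed.

Lemma onI_apx (t : R) : onI Q t = kap%:C * onI D t *
  (1 - 'i * (beta * t)%:C) ^+ 2 * (1 + t ^+ 2 / T)%:C.
Proof.
rewrite [t ^+ 2 / T]mulrC; exact: onI_correction.
Qed.

Lemma onI_apx_end : onI Q (eps * N%:R) = 'i * (2 / eps)%:C.
Proof.
rewrite onI_apx apx_stepN.
have TE : 1 + T ^+ 2 / T = 1 + T by rewrite expr2 mulfK // gt_eqF.
have sE : beta * T = - a / (b + H) by rewrite /apx_slope divfK // gt_eqF.
have eE : 2 / eps = kap * Y.
  rewrite /apx_step /apx_scale; field.
  by rewrite !gt_eqF ?ltr0n ?apx_mod_gt0.
rewrite TE sE eE /apx_mod.
have bH := bH_gt0; have hE := sqrH.
set h := H in bH hE *; case: (onI D T) bH hE => u v /= bH hE.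
have s0 : v + h != 0 by rewrite gt_eqF.
have h2 : h ^+ 2 - u ^+ 2 - v ^+ 2 = 0 by rewrite hE; ring.
(* [E1] and [E2] are the real and imaginary parts of the rotated value; both reduce modulo
   [h^2 = u^2 + v^2]. *)
have E1 : u * (1 - (- u / (v + h)) ^+ 2) + 2 * v * (- u / (v + h)) = 0.
  rewrite (_ : _ + _ = u * (h ^+ 2 - u ^+ 2 - v ^+ 2) / (v + h) ^+ 2); last by field.
  by rewrite h2 mulr0 mul0r.
have E2 : v * (1 - (- u / (v + h)) ^+ 2) - 2 * u * (- u / (v + h)) = 2 * h ^+ 2 / (v + h).
  rewrite (_ : _ - _ = (2 * (u ^+ 2 + v ^+ 2) * (v + h)
    + v * (h ^+ 2 - u ^+ 2 - v ^+ 2)) / (v + h) ^+ 2); last by field.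
  by rewrite h2 mulr0 addr0 -hE; field.
have E : (u +i* v) * (1 - 'i * (- u / (v + h))%:C) ^+ 2 = 'i * (2 * h ^+ 2 / (v + h))%:C.
  rewrite -E2; apply: complex_eqP; last by rewrite /=; ring.
  transitivity (u * (1 - (- u / (v + h)) ^+ 2) + 2 * v * (- u / (v + h))).
    by rewrite /=; ring.
  by rewrite E1 /=; ring.
by rewrite -(mulrA kap%:C) E !rmorphM /=; ring.
Qed.

End Approximant.

Section ApproximantRoots.
Context {R : realType}.
Variables (D : {poly R}) (T : R).
Hypotheses (T0 : 0 < T) (b0 : 0 < complex.Im (onI D T)).
Hypotheses (DR : real_rooted D) (sD : (1 < size D)%N).

Local Notation beta := (apx_slope D T).
Local Notation N := (apx_deg D T).
Local Notation eps := (apx_step D T).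
Local Notation kap := (apx_scale D T).
Local Notation Q := (apx_poly D T).

Lemma apx_scale_neq0 : kap != 0.
Proof.
have [h _] := apx_scale_bounds T0 b0.
by rewrite gt_eqF // (lt_le_trans ltr01).
Qed.

Lemma real_rooted_1BZX (c : R) : real_rooted (1 - c *: 'X).
Proof.
move=> [x y]; rewrite /ceval rmorphB rmorph1 /= map_polyZ map_polyX !hornerE.
move=> h; have := congr1 (@complex.Re R) h; have := congr1 (@complex.Im R) h.
rewrite !(ReCD, ImCD, ReCN, ImCN) /= => h1 h2.
have [c0|c0] := eqVneq c 0; first by move: h2; rewrite c0; lra.
by apply: (mulfI c0); lra.
Qed.

Lemma real_rooted_1BZX2 (c : R) : 0 < c -> real_rooted (1 - c *: 'X^2).
Proof.
move=> c0 [x y]; rewrite /ceval rmorphB rmorph1 /= map_polyZ map_polyXn !hornerE.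
move=> h; have := congr1 (@complex.Re R) h; have := congr1 (@complex.Im R) h.
rewrite !(ReCD, ImCD, ReCN, ImCN) /= => h1 h2.
have xy : x * y = 0 by apply: (mulfI (lt0r_neq0 c0)); lra.
have [-> //|y0] := eqVneq y 0.
have x0 : x = 0 by move/eqP: xy; rewrite mulf_eq0 (negPf y0) orbF => /eqP.
move: h2; rewrite x0; have : 0 < c * y ^+ 2 by rewrite mulr_gt0 // exprn_even_gt0.
by rewrite expr2; lra.
Qed.

Lemma real_rooted_apx : real_rooted Q.
Proof.
move=> z; rewrite /apx_poly -mul_polyC cevalM cevalC => /eqP.
rewrite mulf_eq0 -normc_eq0 normc_real normr_eq0 (negPf apx_scale_neq0) /= => /eqP.
apply: real_rooted_mul; last by apply: real_rooted_1BZX2; rewrite invr_gt0.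
apply: real_rooted_mul => //; rewrite expr2; apply: real_rooted_mul; exact: real_rooted_1BZX.
Qed.

Lemma size_apx : (1 < size Q)%N.
Proof.
have nz (p : {poly R}) : p.[0] = 1 -> p != 0.
  by move=> h; apply: contraPneq h => ->; rewrite horner0 => /esym/eqP; rewrite oner_eq0.
have h1 : (1 - beta *: 'X) ^+ 2 != 0.
  by apply/expf_neq0/nz; rewrite !hornerE /=; ring.
have h2 : 1 - T^-1 *: 'X^2 != 0 :> {poly R}.
  by apply: nz; rewrite !hornerE /=; ring.
have D0 : D != 0 by rewrite -size_poly_gt0 (ltn_trans _ sD).
have gen (p q : {poly R}) : p != 0 -> q != 0 -> (1 < size (D * p * q)%R)%N.
  move=> p0 q0; rewrite !size_mul ?mulf_neq0 //.
  move: p0 q0 sD; rewrite -!size_poly_gt0.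
  move: (size p) (size q) (size D) => [|k] [|l] [|[|m]] // _ _ _.
  by rewrite !addnS /= !addSn.
by rewrite /apx_poly size_scale ?apx_scale_neq0 // gen.
Qed.

(** The zeros [a] of [Q] are real, so each [|it - a|^2 = t^2 + a^2] increases. With [|w Q(iT)| = 1]
    this keeps [|w q_k|] below 1 for [k < N], and no numerator or denominator of the recurrence
    vanishes there. *)
Lemma normc_onI_apx_lt (s t : R) : 0 <= s -> s < t ->
  normc (onI Q s) < normc (onI Q t).
Proof.
move=> s0 st; have [r sr rE] := real_rooted_ceval real_rooted_apx.
have lQ : lead_coef Q != 0 by rewrite lead_coef_eq0 -size_poly_gt0 (ltn_trans _ size_apx).
rewrite /onI !rE !Normc.normcM ltr_pM2l; last first.
  by rewrite normc_real normr_gt0.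
rewrite !normc_prod; apply: ltr_prod; last first.
  move=> a _; apply/andP; split; first exact: normc_ge0.
  rewrite -(ltr_pXn2r (n := 2)) ?nnegrE ?normc_ge0 //.
  rewrite !sqr_normcE !(ReCD, ImCD, ReCM, ImCM, ReCN, ImCN) /=.
  have : s ^+ 2 < t ^+ 2 by rewrite ltrXn2r // ?nnegrE // (le_trans s0) // ltW.
  lra.
by rewrite has_predT sr; move: size_apx; case: (size Q) => [|[|]].
Qed.

Definition apx_val (k : nat) : R[i] := onI Q (eps * k%:R).
Definition apx_w : R[i] := 'i * (eps / 2)%:C.
Definition apx_num (k : nat) : R[i] := 1 + apx_w * apx_val k.
Definition apx_den (k : nat) : R[i] := 1 - apx_w * apx_val k.

(** The equation multiplied by [e^(i eps z) + 1], coefficient by coefficient, reads [c_(k+1) (1 - w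
    q_(k+1)) = c_k (1 + w q_k)]. The numerator belongs to index [k] and the denominator to [k+1]. *)
Fixpoint apx_coef (k : nat) : R[i] :=
  if k is k'.+1 then apx_coef k' * (apx_num k' / apx_den k) else 1.

Lemma normc_apx_w : normc apx_w = eps / 2.
Proof.
rewrite /apx_w Normc.normcM normc_i mul1r normc_real ger0_norm //.
by rewrite divr_ge0 // ltW // apx_step_gt0.
Qed.

Lemma apx_w_conj : apx_w^* = - apx_w.
Proof. by apply: complex_eqP; rewrite ?ReCJ ?ImCJ /=; ring. Qed.

Lemma conj_recurrence (c1 c0 v1 v0 : R[i]) :
  c1 * (1 - apx_w * v1) = c0 * (1 + apx_w * v0) ->
  c1^* * (1 + apx_w * v1^*) = c0^* * (1 - apx_w * v0^*).
Proof.
case: c1 c0 v1 v0 => [a b] [c d] [e f] [g h] [h1 h2].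
apply: complex_eqP => /=; [move: h1|move: h2]; lra.
Qed.

Lemma apx_wM_conj (x : R[i]) : (apx_w * x)^* = - (apx_w * x^*).
Proof. by rewrite -mulNr -apx_w_conj; apply: (rmorphM (@conjc R) apx_w x). Qed.

Lemma apx_val_end : apx_w * apx_val N = -1.
Proof.
rewrite /apx_w /apx_val onI_apx_end // mulrACA -expr2 sqr_i -rmorphM.
rewrite (_ : eps / 2 * (2 / eps) = 1); last by field; rewrite gt_eqF // apx_step_gt0.
by rewrite rmorph1 mulr1.
Qed.

Lemma apx_val_lt1 k : (k < N)%N -> normc (apx_w * apx_val k) < 1.
Proof.
move=> kN; have e0 := apx_step_gt0 D T0.
have -> : 1 = normc (apx_w * apx_val N) by rewrite apx_val_end normc_N Normc.normc1.
rewrite 2!(Normc.normcM apx_w) normc_apx_w ltr_pM2l; last by rewrite divr_gt0.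
by apply: normc_onI_apx_lt; [rewrite mulr_ge0 // ltW|rewrite ltr_pM2l // ltr_nat].
Qed.

Lemma apx_num_neq0 k : (k < N)%N -> apx_num k != 0.
Proof.
move=> /apx_val_lt1 h; apply/eqP => n0; move: h.
have -> : apx_w * apx_val k = -1 by move/eqP: n0; rewrite /apx_num addrC addr_eq0 => /eqP.
by rewrite normc_N Normc.normc1 ltxx.
Qed.

Lemma apx_den_neq0 k : (k <= N)%N -> apx_den k != 0.
Proof.
rewrite leq_eqVlt => /orP[/eqP ->|/apx_val_lt1 h].
  by rewrite /apx_den apx_val_end opprK -mulr2n pnatr_eq0.
apply/eqP => /eqP; rewrite /apx_den subr_eq0 => /eqP n0; move: h.
by rewrite -n0 Normc.normc1 ltxx.
Qed.

Lemma apx_coef_neq0 k : (k <= N)%N -> apx_coef k != 0.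
Proof.
elim: k => [|k IH] kN /=; first exact: oner_neq0.
by rewrite !mulf_neq0 ?invr_neq0 ?apx_num_neq0 ?apx_den_neq0 ?IH // ltnW.
Qed.

Lemma apx_coef_rec k : (k < N)%N ->
  apx_coef k.+1 * apx_den k.+1 = apx_coef k * apx_num k.
Proof. by move=> kN /=; rewrite -mulrA divfK // apx_den_neq0. Qed.

(** Index [j] stands for the frequency [j - N], and [c_(-k)] is the conjugate of [c_k]: the
    trigonometric polynomial is real on the real line and its extreme coefficients have equal
    moduli. *)
Definition apx_ext (j : nat) : R[i] :=
  if (N <= j)%N then apx_coef (j - N) else (apx_coef (N - j))^*.

Lemma apx_extN k : (k <= N)%N -> apx_ext (N - k) = (apx_coef k)^*.
Proof.
move=> kN; rewrite /apx_ext; case: ifP => [h|_]; last by rewrite subKn.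
have k0 : k = 0%N.
  by move: h; rewrite leq_subRL // => h; apply/eqP; rewrite -leqn0 -(leq_add2r N).
by rewrite k0 subn0 subnn; apply: complex_eqP; rewrite /= ?oppr0.
Qed.

Lemma apx_extD k : apx_ext (N + k) = apx_coef k.
Proof. by rewrite /apx_ext leq_addr addKn. Qed.

Lemma apx_freqD k : ceval Q (freq eps N (N + k)) = apx_val k.
Proof. by rewrite /apx_val /onI /freq natrD addrAC subrr add0r. Qed.

Lemma apx_freqN k : (k <= N)%N -> ceval Q (freq eps N (N - k)) = (apx_val k)^*.
Proof.
move=> kN; rewrite /apx_val -onIN /onI /freq natrB // addrAC subrr add0r.
by rewrite mulrN.
Qed.

Lemma apx_ext_rec j : (j < N.*2)%N ->
  apx_ext j * (1 + apx_w * ceval Q (freq eps N j)) =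
  apx_ext j.+1 * (1 - apx_w * ceval Q (freq eps N j.+1)).
Proof.
move=> jN; have [Nj|Nj] := leqP N j.
  have jE : j = (N + (j - N))%N by rewrite subnKC.
  have jk : (j - N < N)%N by rewrite ltn_subLR // addnn.
  rewrite jE -addnS !apx_extD !apx_freqD.
  by rewrite -/(apx_num _) -/(apx_den _) apx_coef_rec.
pose k := (N - j.+1)%N.
have kN : (k < N)%N by rewrite /k subnS prednK ?subn_gt0 // leq_subr.
have jE : j.+1 = (N - k)%N by rewrite /k subKn.
have jE' : j = (N - k.+1)%N by rewrite subnS -jE.
rewrite jE {1 2}jE' !apx_extN ?apx_freqN ?(ltnW kN) //.
have h := conj_recurrence (apx_coef_rec kN).
exact: h.
Qed.

Definition apx_laurent : {poly R[i]} := \poly_(j < N.*2.+1) apx_ext j.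

Lemma coef_apx_laurent j : (j <= N.*2)%N -> apx_laurent`_j = apx_ext j.
Proof. by move=> h; rewrite coef_poly ltnS h. Qed.

Lemma apx_ext0 : apx_ext 0 = (apx_coef N)^*.
Proof. by rewrite -(subnn N) apx_extN. Qed.

Lemma apx_ext2N : apx_ext N.*2 = apx_coef N.
Proof. by rewrite -addnn apx_extD. Qed.

Lemma size_apx_laurent : size apx_laurent = N.*2.+1.
Proof. by rewrite size_poly_eq //= apx_ext2N apx_coef_neq0. Qed.

(** Inner degrees are the recurrence. Degrees 0 and [2N+1] have no neighbour on one side; they agree
    because [w q_N = -1], and its conjugate relation holds at the other end. *)
Lemma apx_laurent_eq : ('X - 1%:P) * apx_laurent = - ('i * (eps / 2)%:C) *:
  (('X + 1%:P) * coef_mul (fun j => ceval Q (freq eps N j)) apx_laurent).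
Proof.
rewrite -/apx_w; apply/polyP => j.
rewrite mulrBl mulrDl coefB coefZ coefD !mul1r !coefXM !coef_coef_mul.
case: j => [|j] /=.
  rewrite coef_apx_laurent // !add0r mulNr; congr (- _).
  rewrite -{2}(subnn N) apx_freqN //.
  have h : apx_w * (apx_val N)^* = 1.
    have := congr1 conjc apx_val_end; rewrite apx_wM_conj rmorphN rmorph1.
    exact: oppr_inj.
  by rewrite mulrA h mul1r.
have [jN|Nj] := ltnP j N.*2; last first.
  rewrite [apx_laurent`_j.+1]nth_default ?size_apx_laurent // mulr0 subr0 addr0.
  move: Nj; rewrite leq_eqVlt => /orP[/eqP <-|Nj]; last first.
    by rewrite nth_default ?size_apx_laurent // !mulr0.
  by rewrite -{2}addnn apx_freqD mulNr mulrA apx_val_end mulN1r opprK.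
rewrite !coef_apx_laurent //; last exact: ltnW.
have := apx_ext_rec jN; set A := apx_ext j; set B := apx_ext j.+1 => h.
apply/eqP; rewrite -subr_eq0; apply/eqP.
move/eqP: h; rewrite -subr_eq0 => /eqP <-; ring.
Qed.

Lemma apx_laurent_roots z : root apx_laurent z -> normc z = 1.
Proof.
have N0 : (0 < N)%N by [].
apply: (circle_roots (apx_step_gt0 D T0) N0 real_rooted_apx size_apx
  size_apx_laurent _ _ apx_laurent_eq).
  by rewrite !coef_apx_laurent // apx_ext0 apx_ext2N normc_conj.
rewrite coef_apx_laurent // apx_ext0 -normc_eq0 normc_conj normc_eq0.
exact: apx_coef_neq0.
Qed.

End ApproximantRoots.

(** * Cayley transform to polynomials with real zeros *)

Section Cayley.
Context {R : realType}.

Definition cayley_sum (N : nat) (dl : R) (p : {poly R[i]}) (z : R[i]) : R[i] :=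
  \sum_(j < N.*2.+1) p`_j *
    ((1 + 'i * dl%:C * z) ^+ j * (1 - 'i * dl%:C * z) ^+ (N.*2 - j)).

(* The Cayley transform [z |-> (1 + i dl z) / (1 - i dl z)] maps the real line to
   the unit circle, so the zeros of the transformed polynomial are real. *)
Lemma cayley_sum_factor (N : nat) (dl : R) (p : {poly R[i]}) :
  0 < dl -> size p = N.*2.+1 -> (forall z, root p z -> normc z = 1) ->
  (forall j, (j <= N.*2)%N -> p`_(N.*2 - j) = (p`_j)^*) ->
  exists A : R, exists s : seq R, forall z,
    cayley_sum N dl p z = A%:C * \prod_(a <- s) (z - a%:C).
Proof.
move=> d0 sp pr pc.
pose w : R[i] := 'i * dl%:C.
pose P : {poly R[i]} := \sum_(j < N.*2.+1)
  p`_j *: ((1 + w *: 'X) ^+ j * (1 - w *: 'X) ^+ (N.*2 - j)).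
have PE z : P.[z] = cayley_sum N dl p z.
  rewrite /P horner_sum; apply: eq_bigr => j _.
  by rewrite hornerZ hornerM !horner_exp !hornerD hornerN !hornerZ hornerX !hornerC.
have P0 z : complex.Im z != 0 -> P.[z] != 0.
  move=> z0; rewrite PE /cayley_sum -/w.
  set u := 1 + w * z; set v := 1 - w * z.
  have uv : normc u != normc v.
    apply/eqP => /(congr1 (fun x => x ^+ 2)); rewrite !sqr_normcE /u /v /w => h.
    have : dl * complex.Im z != 0 by rewrite mulf_neq0 // gt_eqF.
    apply/negP; rewrite negbK; apply/eqP.
    by move: h; case: (z) => x y /=; lra.
  (* At the pole of the Cayley transform only the top term of the sum survives, and it is
     nonzero. *)
  have [v0|v0] := eqVneq v 0.
    rewrite big_ord_recr /= subnn expr0 mulr1 big1 ?add0r; last first.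
      move=> j _; rewrite v0 expr0n subn_eq0 leqNgt ltn_ord /= !mulr0 //.
    rewrite mulf_neq0 //.
      have -> : p`_(N.*2) = lead_coef p by rewrite /lead_coef sp.
      by rewrite lead_coef_eq0 -size_poly_eq0 sp.
    apply: expf_neq0; apply: contraNneq uv => ->.
    by rewrite v0.
  have -> : \sum_(j < N.*2.+1) p`_j * (u ^+ j * v ^+ (N.*2 - j)) =
      v ^+ N.*2 * p.[u / v].
    rewrite horner_coef sp mulr_sumr; apply: eq_bigr => j _.
    rewrite [RHS]mulrCA; congr (_ * _).
    have jN : (j <= N.*2)%N by rewrite -ltnS.
    have -> : v ^+ N.*2 = v ^+ (N.*2 - j) * v ^+ j by rewrite -exprD subnK.
    have vj : v ^+ j != 0 by exact: expf_neq0.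
    by rewrite expr_div_n -mulrA [_ * (_ / _)]mulrC divfK // mulrC.
  rewrite mulf_neq0 ?expf_neq0 //; apply/negP => /eqP h.
  have := pr (u / v); rewrite /root h eqxx => /(_ isT).
  rewrite Normc.normcM Normc.normcV => h2.
  move/eqP: uv; apply; have nv : normc v != 0 by rewrite normc_eq0.
  by rewrite -[normc u](divfK nv) h2 mul1r.
have Pn0 : P != 0.
  have : P.['i] != 0 by apply: P0; exact: oner_neq0.
  by apply: contraNneq => ->; rewrite horner0.
have [r rE] := closed_field_poly_normal P.
have rr z : z \in r -> z = (complex.Re z)%:C.
  move=> zr; apply: complex_eqP => //=; apply: contraTeq zr => /P0.
  by rewrite {1}rE hornerZ mulf_eq0 negb_or => /andP[_]; rewrite -root_prod_XsubC.
pose s := map (@complex.Re R) r.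
have fE z : P.[z] = lead_coef P * \prod_(a <- s) (z - a%:C).
  rewrite {1}rE hornerZ horner_prod big_map; congr (_ * _).
  by rewrite big_seq [RHS]big_seq; apply: eq_bigr => a /rr aE; rewrite hornerXsubC {1}aE.
(* For real [x] the two linear factors are conjugate, so conjugation reverses the sum, which the
   symmetry of the coefficients undoes. *)
have realP (x : R) : complex.Im P.[x%:C] = 0.
  have h : (P.[x%:C])^* = P.[x%:C].
    rewrite PE /cayley_sum rmorph_sum /= (reindex_inj rev_ord_inj) /=.
    apply: eq_bigr => j _; rewrite subSS.
    have jN : (j <= N.*2)%N by rewrite -ltnS.
    have cX (a : R[i]) k : conjc (a ^+ k : R[i]) = conjc a ^+ k.
      elim: k => [|k IH]; first by apply: complex_eqP; rewrite /= ?oppr0.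
      by rewrite exprS conjcM IH -exprS.
    rewrite !conjcM !cX pc // conjcK subKn //; congr (_ * _).
    have -> : (1 + 'i * dl%:C * x%:C)^* = 1 - 'i * dl%:C * x%:C.
      by apply: complex_eqP => /=; ring.
    have -> : (1 - 'i * dl%:C * x%:C)^* = 1 + 'i * dl%:C * x%:C.
      by apply: complex_eqP => /=; ring.
    by rewrite mulrC.
  have := congr1 (@complex.Im R) h; rewrite ImCJ; lra.
have leadR : complex.Im (lead_coef P) = 0.
  (* A real point to the right of all the zeros: the product there is real and nonzero, so the
     leading coefficient is real because [P] is. *)
  pose x := 1 + \sum_(a <- s) `|a|.
  have xs a : a \in s -> x - a != 0.
    move=> ai; rewrite gt_eqF // subr_gt0 /x.
    apply: (@le_lt_trans _ _ (\sum_(b <- s) `|b|)); last by rewrite ltrDr.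
    rewrite (big_rem a ai) /=; apply: (le_trans (ler_norm a)).
    by rewrite lerDl sumr_ge0.
  have q0 : \prod_(a <- s) (x - a) != 0 by rewrite prodf_seq_neq0; apply/allP.
  have := realP x; rewrite fE.
  have -> : \prod_(a <- s) (x%:C - a%:C) = (\prod_(a <- s) (x - a))%:C.
    by rewrite rmorph_prod; apply: eq_bigr => a _; rewrite rmorphB.
  by rewrite ImCMr => /eqP; rewrite mulf_eq0 (negPf q0) orbF => /eqP.
exists (complex.Re (lead_coef P)), s => z; rewrite -PE fE; congr (_ * _).
exact: complex_eqP.
Qed.

Lemma apx_laurent_sym (D : {poly R}) (T : R) j : (j <= (apx_deg D T).*2)%N ->
  (apx_laurent D T)`_((apx_deg D T).*2 - j) = ((apx_laurent D T)`_j)^*.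
Proof.
set N := apx_deg D T => jN; rewrite !coef_apx_laurent // ?leq_subr //.
have [Nj|/ltnW Nj] := leqP N j.
  have kN : (j - N <= N)%N by rewrite leq_subLR addnn.
  have -> : (N.*2 - j = N - (j - N))%N by rewrite subnBA // addnn.
  by rewrite apx_extN // -{2}(subnKC Nj) apx_extD.
have -> : (N.*2 - j = N + (N - j))%N by rewrite -addnn addnBA.
rewrite apx_extD -{2}(subKn Nj) apx_extN ?leq_subr //.
by rewrite conjcK.
Qed.

End Cayley.

(** * Gaussian bounds for the coefficients *)

Section Bounds.
Context {R : realType}.
Variables (D : {poly R}) (e0 t0 M0 : R).
Hypotheses (DR : real_rooted D) (sD : (1 < size D)%N).
Hypotheses (e0_gt0 : 0 < e0) (t0_ge1 : 1 <= t0) (M0_ge0 : 0 <= M0).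
Hypothesis imD : forall t, t0 <= t -> e0 * t <= complex.Im (onI D t).
Hypothesis reD : (forall t, t0 <= t -> 0 <= complex.Re (onI D t)) \/
                 (forall t, t0 <= t -> complex.Re (onI D t) <= 0).
Hypothesis M0P : forall t, 0 <= t <= t0 -> normc (onI D t) <= M0.

(** Bound for [Q(it)] on [0 <= t <= t0]: [M0] for [D], 2 for the scale, 2 for the squared slope
    factor and [1 + t0] for the last factor. *)
Definition bnd_M : R := 4 * M0 * (1 + t0).

(** The first threshold puts [t0] below the middle of [[0, T]]; the second gives [eps <= 1] and
    [kap <= 2]; the third gives [eps * bnd_M <= 1 / 2]. *)
Definition large_T (T : R) := [/\ 2 * t0 + 1 <= T, 2 / e0 <= T & 4 * bnd_M / e0 <= T].

Lemma bnd_M_ge0 : 0 <= bnd_M.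
Proof. by rewrite /bnd_M !mulr_ge0 // addr_ge0 // (le_trans ler01). Qed.

Variable T : R.
Hypothesis TL : large_T T.

Local Notation beta := (apx_slope D T).
Local Notation N := (apx_deg D T).
Local Notation eps := (apx_step D T).
Local Notation kap := (apx_scale D T).
Local Notation Q := (apx_poly D T).

Lemma T_ge3 : 3 <= T.
Proof. by case: TL => h _ _; have := t0_ge1; lra. Qed.

Lemma T_gt0 : 0 < T.
Proof. exact: lt_le_trans T_ge3. Qed.

Lemma t0_leT : t0 <= T.
Proof. by case: TL => h _ _; have := t0_ge1; lra. Qed.

Lemma imD_gt0 : 0 < complex.Im (onI D T).
Proof.
apply: lt_le_trans (imD t0_leT); rewrite mulr_gt0 //; exact: T_gt0.
Qed.

Lemma apx_mod_large : e0 * T * (1 + T) <= apx_mod D T.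
Proof.
apply: le_trans (apx_mod_ge T_gt0 imD_gt0).
apply: ler_wpM2r; last exact: imD t0_leT.
by have := T_gt0; lra.
Qed.

Lemma apx_step_small : eps * (e0 * T * (1 + T)) <= 2.
Proof.
have h := apx_step_le T_gt0 imD_gt0.
have Y0 := apx_mod_gt0 T_gt0 imD_gt0.
apply: (@le_trans _ _ (eps * apx_mod D T)).
  apply: ler_wpM2l; last exact: apx_mod_large.
  by rewrite ltW // apx_step_gt0 // T_gt0.
by rewrite -ler_pdivlMr.
Qed.

Lemma apx_step_eT : eps * (e0 * T) <= 2 / 3.
Proof.
have h := apx_step_small.
have h3 := T_ge3; have e := apx_step_gt0 D T_gt0.
have p : 0 <= eps * (e0 * T) by rewrite !mulr_ge0 // ltW // T_gt0.
have : eps * (e0 * T) * 4 <= eps * (e0 * T) * (1 + T) by apply: ler_wpM2l => //; lra.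
by rewrite -mulrA; lra.
Qed.

Lemma apx_step_le1 : eps <= 1.
Proof.
have h := apx_step_eT; have e := apx_step_gt0 D T_gt0.
have [_ hT _] := TL; have h2 : 2 <= e0 * T by rewrite mulrC -ler_pdivrMr.
have : eps * 2 <= eps * (e0 * T) by apply: ler_wpM2l => //; exact: ltW.
lra.
Qed.

Lemma apx_step_M : eps * bnd_M <= 1 / 2.
Proof.
have h := apx_step_eT; have e := apx_step_gt0 D T_gt0.
have [_ _ hT] := TL; have h2 : 4 * bnd_M <= e0 * T by rewrite [leRHS]mulrC -ler_pdivrMr.
have : eps * (4 * bnd_M) <= eps * (e0 * T) by apply: ler_wpM2l => //; exact: ltW.
lra.
Qed.

Lemma apx_scale_le : 1 <= kap <= 2.
Proof.
have [h1 h2] := apx_scale_bounds T_gt0 imD_gt0; rewrite h1 /=.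
apply: (le_trans h2); have TT := T_gt0.
have Y0 := apx_mod_gt0 T_gt0 imD_gt0.
suff : 2 / (T * apx_mod D T) <= 1 by lra.
have TY : 0 < T * apx_mod D T by exact: mulr_gt0.
rewrite (ler_pdivrMr _ _ TY) mul1r.
have [_ hT _] := TL; have h3 : 2 <= e0 * T by rewrite mulrC -ler_pdivrMr.
have h4 := apx_mod_large.
have h5 : 2 * 1 <= e0 * T * (1 + T).
  by apply: ler_pM => //; have := T_ge3; lra.
have : 1 * apx_mod D T <= T * apx_mod D T.
  by apply: ler_wpM2r; [exact: ltW|have := T_ge3; lra].
lra.
Qed.

Lemma beta_le (t : R) : 0 <= t -> t <= T -> `|beta * t| <= t / T.
Proof.
move=> t_ge0 tT; have TT := T_gt0.
have h := apx_slope_le1 T_gt0 imD_gt0.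
rewrite ler_pdivlMr // -{2}(gtr0_norm TT) -normrM mulrAC normrM (ger0_norm t_ge0).
by rewrite ler_piMl.
Qed.

Lemma normc_val_small (t : R) : 0 <= t -> t <= t0 -> normc (onI Q t) <= bnd_M.
Proof.
move=> t_ge0 tt; have TT := T_gt0; have tT := le_trans tt t0_leT.
rewrite onI_apx.
have /andP[k1 k2] := apx_scale_le.
have nE (u v p q : R[i]) : normc (u * v * p * q) =
    normc u * normc v * normc p * normc q by rewrite !Normc.normcM.
rewrite nE normcX !normc_real.
have n1 : normc (1 - 'i * (beta * t)%:C) ^+ 2 <= 2.
  rewrite sqr_normcE !(ReCD, ImCD, ReCN, ImCN, ReCM, ImCM) /=.
  have h := beta_le t_ge0 tT.
  have h1 : t / T <= 1 by rewrite ler_pdivrMr // mul1r.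
  have : (beta * t) ^+ 2 <= 1.
    by rewrite -(expr1n _ 2); apply: sqr_le_norm; rewrite normr1 (le_trans h).
  lra.
have n2 : `|1 + t ^+ 2 / T| <= 1 + t0.
  rewrite ger0_norm; last by rewrite addr_ge0 // divr_ge0 ?sqr_ge0 // ltW.
  rewrite lerD2l ler_pdivrMr // expr2; apply: ler_pM => //.
have n3 : `|kap| <= 2 by rewrite ger0_norm // (le_trans ler01).
have n4 : normc (onI D t) <= M0 by apply: M0P; rewrite t_ge0.
rewrite /bnd_M (_ : 4 * M0 * (1 + t0) = 2 * M0 * 2 * (1 + t0)); last by ring.
have n0 := normc_ge0.
apply: ler_pM => //; first by rewrite mulr_ge0 ?sqr_ge0 // mulr_ge0.
apply: ler_pM => //; first by rewrite mulr_ge0.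
  exact: sqr_ge0.
exact: ler_pM.
Qed.

Lemma Im_onI_apx (t : R) : complex.Im (onI Q t) = kap * (1 + t ^+ 2 / T) *
  (complex.Im (onI D t) * (1 - (beta * t) ^+ 2)
    - 2 * (complex.Re (onI D t) * (beta * t))).
Proof.
rewrite onI_apx.
by case: (onI D t) => a b /=; ring.
Qed.

(** The slope has the sign opposite to [Re D(iT)], and [Re D(it)] keeps its sign from [t0] on. Hence
    the cross term in [Im_onI_apx] can only increase the imaginary part. *)
Lemma re_slope (t : R) : t0 <= t -> complex.Re (onI D t) * (beta * t) <= 0.
Proof.
move=> tt; have t_ge0 : 0 <= t by apply: le_trans tt; have := t0_ge1; lra.
have b := bH_gt0 imD_gt0.
have p : 0 <= complex.Re (onI D t) * complex.Re (onI D T).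
  case: reD => h; first by rewrite mulr_ge0 // h // t0_leT.
  by rewrite mulr_le0 // h // t0_leT.
rewrite (_ : _ * _ = - (complex.Re (onI D t) * complex.Re (onI D T) *
  (t * ((complex.Im (onI D T) + normc (onI D T))^-1 * T^-1)))); last first.
  by rewrite /apx_slope; ring.
rewrite oppr_le0; apply: mulr_ge0 => //; apply: mulr_ge0 => //.
by apply: mulr_ge0; rewrite invr_ge0 ltW // T_gt0.
Qed.

Lemma Im_val_ge0 (t : R) : t0 <= t -> t <= T -> 0 <= complex.Im (onI Q t).
Proof.
move=> tt tT; have TT := T_gt0.
have t_ge0 : 0 <= t by apply: le_trans tt; have := t0_ge1; lra.
have /andP[k1 _] := apx_scale_le.
rewrite Im_onI_apx mulr_ge0 //.
  apply: mulr_ge0; first exact: le_trans k1.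
  by apply: addr_ge0 => //; apply: divr_ge0; [exact: sqr_ge0|exact: ltW].
have h := re_slope tt.
have x1 : (beta * t) ^+ 2 <= 1.
  rewrite -(expr1n _ 2); apply: sqr_le_norm; rewrite normr1.
  by apply: (le_trans (beta_le t_ge0 tT)); rewrite ler_pdivrMr // mul1r.
have : 0 <= complex.Im (onI D t) * (1 - (beta * t) ^+ 2).
  rewrite mulr_ge0 ?subr_ge0 //; apply: le_trans (imD tt).
  by rewrite mulr_ge0 // ltW.
lra.
Qed.

(** In the first half [|beta t| <= 1 / 2], so [(beta t)^2] costs at most a quarter of [Im D(it)];
    the other factors are at least 1. *)
Lemma Im_val_ge (t : R) : t0 <= t -> 2 * t <= T -> 3 / 4 * e0 * t <= complex.Im (onI Q t).
Proof.
move=> tt tT; have TT := T_gt0.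
have t_ge0 : 0 <= t by apply: le_trans tt; have := t0_ge1; lra.
have /andP[k1 _] := apx_scale_le.
have h := re_slope tt; have hi := imD tt.
have x1 : (beta * t) ^+ 2 <= 1 / 4.
  have -> : 1 / 4 = (1 / 2) ^+ 2 :> R by lra.
  apply: sqr_le_norm; rewrite [leRHS]ger0_norm //.
  have tT' : t <= T by lra.
  by apply: (le_trans (beta_le t_ge0 tT')); rewrite ler_pdivrMr //; lra.
have E := Im_onI_apx t; set X := (complex.Im (onI D t) * _ - 2 * _) in E.
have X1 : 3 / 4 * e0 * t <= X.
  have : 0 <= (complex.Im (onI D t) - e0 * t) * (3 / 4).
    by apply: mulr_ge0; [rewrite subr_ge0|rewrite divr_ge0].
  have : 0 <= complex.Im (onI D t) * (1 / 4 - (beta * t) ^+ 2).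
    rewrite mulr_ge0 ?subr_ge0 //; apply: le_trans hi.
    by rewrite mulr_ge0 // ltW.
  rewrite /X; lra.
have X0 : 0 <= X.
  apply: le_trans X1; apply: mulr_ge0 => //.
  by apply: mulr_ge0; [rewrite divr_ge0|exact: ltW].
rewrite E.
apply: (le_trans X1); rewrite ler_peMl //.
have u : 0 <= t ^+ 2 / T by rewrite divr_ge0 ?sqr_ge0 // ltW.
rewrite -[1]mulr1; apply: ler_pM => //; lra.
Qed.

Lemma recurrence_ratio_pos (S y : R) : 1 <= S -> S <= 2 -> 0 <= y -> y <= 2 ->
  S - y <= (S + y) * expR (- (y / 2)).
Proof.
move=> S1 S2 y0 y2; have h : 1 - y / 2 <= expR (- (y / 2)) by exact: expR_ge1Dx.
have : (S + y) * (1 - y / 2) <= (S + y) * expR (- (y / 2)).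
  by apply: ler_wpM2l => //; lra.
have : 0 <= y * (2 - S / 2 - y / 2) by rewrite mulr_ge0 //; lra.
lra.
Qed.

Lemma recurrence_ratio_neg (S y : R) : 1 <= S -> 0 <= y -> y <= 1 / 2 ->
  S + y <= (S - y) * expR (4 * y).
Proof.
move=> S1 y0 y2; have h : 1 + 4 * y <= expR (4 * y) by exact: expR_ge1Dx.
have : (S - y) * (1 + 4 * y) <= (S - y) * expR (4 * y).
  by apply: ler_wpM2l => //; lra.
have : 0 <= y * (S - 1 / 2 - y) by rewrite mulr_ge0 //; lra.
nra.
Qed.

Local Notation q := (apx_val D T).
Local Notation w := (apx_w D T).
Local Notation c := (apx_coef D T).

Definition apx_S k : R := 1 + normc (w * q k) ^+ 2.
Definition apx_y k : R := eps * complex.Im (q k).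

Lemma normc_num k : normc (apx_num D T k) ^+ 2 = apx_S k - apx_y k.
Proof.
rewrite /apx_S /apx_y /apx_num !sqr_normcE /apx_w; case: (q k) => u v /=.
by field.
Qed.

Lemma normc_den k : normc (apx_den D T k) ^+ 2 = apx_S k + apx_y k.
Proof.
rewrite /apx_S /apx_y /apx_den !sqr_normcE /apx_w; case: (q k) => u v /=.
by field.
Qed.

Lemma apx_S_ge1 k : 1 <= apx_S k.
Proof. by rewrite lerDl exprn_ge0 // normc_ge0. Qed.

Lemma apx_S_le2 k : (k < N)%N -> apx_S k <= 2.
Proof.
move=> kN; have h := apx_val_lt1 T_gt0 imD_gt0 DR sD kN.
have : normc (w * q k) ^+ 2 <= 1 by rewrite exprn_ile1 ?normc_ge0 // ltW.
by rewrite /apx_S; lra.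
Qed.

Lemma apx_y_le k : `|apx_y k| <= 2 * normc (w * q k).
Proof.
have e := apx_step_gt0 D T_gt0.
rewrite /apx_y normrM (gtr0_norm e) Normc.normcM normc_apx_w //; last exact: T_gt0.
rewrite mulrA (_ : 2 * (eps / 2) = eps); last by field.
by rewrite ler_pM2l // normr_Im_le.
Qed.

Lemma eps_k_le k : (k <= N)%N -> eps * k%:R <= T.
Proof.
move=> kN; rewrite -[leRHS](apx_stepN D T); apply: ler_wpM2l.
  by rewrite ltW // apx_step_gt0 // T_gt0.
by rewrite ler_nat.
Qed.

Let eps0 : 0 < eps. Proof. exact: apx_step_gt0 T_gt0. Qed.

Let epsk0 k : 0 <= eps * k%:R. Proof. by rewrite mulr_ge0 // ltW. Qed.

Lemma apx_y_small k : eps * k%:R <= t0 -> `|apx_y k| <= eps * bnd_M.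
Proof.
move=> kt; rewrite /apx_y normrM (gtr0_norm eps0); apply: ler_wpM2l; first exact: ltW.
apply: (le_trans (normr_Im_le _)); exact: normc_val_small.
Qed.

(** Half of the slope [3 / 4 * e0] of [Im_val_ge], as [recurrence_ratio_pos] gives only
    [expR (- (y / 2))]. In [bnd_A], the term [4 * bnd_M] covers the possible growth up to [t0],
    where [Im Q] has no sign, and [bnd_d * t0] offsets the decay claimed there. *)
Definition bnd_d : R := 3 / 8 * e0.
Definition bnd_A : R := 4 * bnd_M + bnd_d * t0.

Lemma bnd_d_gt0 : 0 < bnd_d. Proof. by rewrite mulr_gt0. Qed.

Lemma bnd_A_ge0 : 0 <= bnd_A.
Proof.
apply: addr_ge0; apply: mulr_ge0 => //; first exact: bnd_M_ge0.
  exact: ltW bnd_d_gt0.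
exact: le_trans t0_ge1.
Qed.

Lemma num_le_den_half k : (k < N)%N -> (2 * k <= N)%N ->
  apx_S k - apx_y k <= (apx_S k + apx_y k) * expR (- (eps * (bnd_d * (eps * k%:R) - bnd_A))).
Proof.
move=> kN kh; have S1 := apx_S_ge1 k; have S2 := apx_S_le2 kN.
have yS := apx_y_le k; have v1 := ltW (apx_val_lt1 T_gt0 imD_gt0 DR sD kN).
have A0 := bnd_A_ge0; have d0 := bnd_d_gt0.
have [kt|kt] := leP (eps * k%:R) t0; last first.
  have h2 : 2 * (eps * k%:R) <= T.
    rewrite mulrCA -natrM -[leRHS](apx_stepN D T); apply: ler_wpM2l; first exact: ltW.
    by rewrite ler_nat.
  have im := Im_val_ge (ltW kt) h2; rewrite -/(apx_val D T k) in im.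
  have y0 : 0 <= apx_y k.
    rewrite /apx_y mulr_ge0 ?(ltW eps0) //; apply: le_trans im.
    by rewrite mulr_ge0 // mulr_ge0 ?divr_ge0 // ltW.
  have y2 : apx_y k <= 2 by apply: (le_trans (ler_norm _)); lra.
  apply: (le_trans (recurrence_ratio_pos S1 S2 y0 y2)).
  apply: ler_wpM2l; first lra.
  rewrite ler_expR lerN2 /apx_y -mulrA; apply: ler_wpM2l; first exact: ltW.
  by rewrite /bnd_d; lra.
have ys := apx_y_small kt; have eM := apx_step_M.
have ex : expR (4 * (eps * bnd_M)) <= expR (- (eps * (bnd_d * (eps * k%:R) - bnd_A))).
  rewrite ler_expR (_ : - _ = eps * (bnd_A - bnd_d * (eps * k%:R))); last by ring.
  rewrite mulrCA; apply: ler_wpM2l; first exact: ltW.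
  rewrite /bnd_A; have : bnd_d * (eps * k%:R) <= bnd_d * t0 by rewrite ler_pM2l.
  lra.
have M0' : 0 <= eps * bnd_M by rewrite mulr_ge0 ?bnd_M_ge0 // ltW.
have ylow : - (eps * bnd_M) <= apx_y k by move: ys; rewrite ler_norml => /andP[].
have SY : 0 <= apx_S k + apx_y k by lra.
apply: le_trans (ler_wpM2l SY ex).
have [y0|y0] := leP 0 (apx_y k).
  apply: (@le_trans _ _ ((apx_S k + apx_y k) * 1)); first lra.
  apply: ler_wpM2l => //; rewrite -[leLHS](expR0 R) ler_expR mulr_ge0 //.
have h := @recurrence_ratio_neg (apx_S k) (- apx_y k) S1.
rewrite opprK in h; apply: (le_trans (h _ _)); [lra|lra|].
by apply: ler_wpM2l => //; rewrite ler_expR; lra.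
Qed.

Lemma num_le_den k : (k < N)%N -> t0 <= eps * k%:R ->
  apx_S k - apx_y k <= apx_S k + apx_y k.
Proof.
move=> kN kt.
have : 0 <= apx_y k.
  apply: mulr_ge0; first exact: ltW.
  by apply: Im_val_ge0 => //; apply: eps_k_le; exact: ltnW.
lra.
Qed.

(** The factor [|apx_den k|^2] realigns the recurrence: the ratio of consecutive [apx_b] compares
    numerator and denominator at the same index. *)
Definition apx_b k : R := normc (c k) ^+ 2 * (apx_S k + apx_y k).

Lemma apx_b_rec k : (k < N)%N -> apx_b k.+1 = normc (c k) ^+ 2 * (apx_S k - apx_y k).
Proof.
move=> kN; have h := apx_coef_rec T_gt0 imD_gt0 DR sD kN.
have : normc (c k.+1 * apx_den D T k.+1) ^+ 2 = normc (c k * apx_num D T k) ^+ 2 by rewrite h.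
by rewrite (Normc.normcM (c k.+1)) (Normc.normcM (c k) (apx_num D T k)) !exprMn normc_den normc_num.
Qed.

Lemma apx_b0 : apx_b 0 <= 4.
Proof.
rewrite /apx_b Normc.normc1 expr1n mul1r.
have S2 := @apx_S_le2 0 isT; have := apx_y_le 0.
have := apx_val_lt1 T_gt0 imD_gt0 DR sD (isT : 0 < N)%N.
have := ler_norm (apx_y 0); lra.
Qed.

(** With [s = eps k], the exponents [eps * (bnd_d * (eps j) - bnd_A)] add up to about
    [bnd_d s^2 / 2 - bnd_A s]. The additional [bnd_d * s] absorbs the discretization error, since
    [eps <= 1]. *)
Lemma apx_b_half k : (2 * k <= N.+1)%N -> (k <= N)%N ->
  apx_b k <= 4 * expR (- (bnd_d / 2 * (eps * k%:R) ^+ 2) + (bnd_A + bnd_d) * (eps * k%:R)).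
Proof.
elim: k => [|k IH] kh kN.
  rewrite mulr0 expr0n !mulr0 oppr0 addr0 expR0 mulr1; exact: apx_b0.
have kh' : (2 * k <= N)%N by rewrite -ltnS (leq_trans _ kh) // mulnS.
have {}IH := IH (leqW kh') (ltnW kN).
have h : apx_b k.+1 <= apx_b k * expR (- (eps * (bnd_d * (eps * k%:R) - bnd_A))).
  rewrite (apx_b_rec kN) /apx_b -[leRHS]mulrA; apply: ler_wpM2l; first exact: sqr_ge0.
  exact: num_le_den_half.
apply: (le_trans h); apply: (le_trans (ler_wpM2r (expR_ge0 _) IH)).
rewrite -[leLHS]mulrA -expRD ler_pM2l // ler_expR -[k.+1%:R]natr1.
have e1 := apx_step_le1; have d0 := bnd_d_gt0.
set K := k%:R; have K0 : 0 <= K by exact: ler0n.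
have : 0 <= eps * bnd_d * (1 - eps / 2).
  by apply: mulr_ge0; [exact: ltW (mulr_gt0 eps0 d0)|lra].
lra.
Qed.

(** Near [T] the factor [1 - (beta t)^2] may be very small, so beyond the middle only monotonicity
    is claimed. *)
Lemma apx_b_large k j : (N <= 2 * j + 1)%N -> (j + k <= N)%N -> apx_b (j + k) <= apx_b j.
Proof.
move=> jh; elim: k => [|k IH] jk; first by rewrite addn0.
have jkN : (j + k < N)%N by rewrite -addnS.
apply: le_trans (IH (ltnW jkN)); rewrite addnS apx_b_rec //.
apply: ler_wpM2l; first exact: sqr_ge0.
apply: num_le_den => //.
have [hT _ _] := TL; have e1 := apx_step_le1.
have h1 : T <= eps * (2 * j + 1)%N%:R.
  by rewrite -[leLHS](apx_stepN D T); apply: ler_wpM2l; [exact: ltW|rewrite ler_nat].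
have h2 : eps * j%:R <= eps * (j + k)%N%:R.
  by apply: ler_wpM2l; [exact: ltW|rewrite ler_nat leq_addr].
move: h1; rewrite natrD natrM; lra.
Qed.

(** Beyond the middle the bound at [m = N./2] is reused. From [k <= 2m + 1] follows
    [s^2 >= u^2 / 8 - 1 / 4] for the two abscissae, which divides the Gaussian rate by 8 and costs
    [expR (bnd_d / 8)]. Dividing by [|apx_den k|^2 >= 1 / 2] turns 4 into 8. *)
Lemma apx_coef_bound k : (k <= N)%N -> normc (c k) ^+ 2 <=
  8 * expR (bnd_d / 8) * expR (- (bnd_d / 16 * (eps * k%:R) ^+ 2)
    + (bnd_A + bnd_d) * (eps * k%:R)).
Proof.
move=> kN.
have d0 := bnd_d_gt0; have A0 := bnd_A_ge0; have e1 := apx_step_le1.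
have hb : apx_b k <= 4 * expR (bnd_d / 8) * expR (- (bnd_d / 16 * (eps * k%:R) ^+ 2)
    + (bnd_A + bnd_d) * (eps * k%:R)).
  have [m [mk km mN bm]] : exists m, [/\ (m <= k)%N, (k <= 2 * m + 1)%N, (2 * m <= N.+1)%N &
      apx_b k <= apx_b m].
    have [kh|kh] := leqP (2 * k) N.+1.
      by exists k; split=> //; rewrite mul2n -addnn -addnA leq_addr.
    have NE : (2 * N./2 + odd N = N)%N by rewrite mul2n addnC odd_double_half.
    have mk : (N./2 <= k)%N.
      rewrite -(leq_pmul2l (m := 2)) //; apply: (@leq_trans N); last exact: ltnW (ltnW kh).
      by rewrite -{2}NE leq_addr.
    exists N./2; split=> //.
    - by apply: (leq_trans kN); rewrite -{1}NE leq_add2l leq_b1.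
    - by apply: leqW; rewrite -{2}NE leq_addr.
    rewrite -{1}(subnKC mk); apply: apx_b_large.
      by rewrite -{1}NE leq_add2l leq_b1.
    by rewrite subnKC.
  have mN' : (m <= N)%N by exact: leq_trans mk kN.
  apply: (le_trans bm); apply: (le_trans (apx_b_half mN mN')).
  rewrite -[leRHS]mulrA -expRD ler_pM2l // ler_expR.
  have s1 : eps * m%:R <= eps * k%:R.
    by apply: ler_wpM2l; [exact: ltW|rewrite ler_nat].
  have s2 : eps * k%:R <= 2 * (eps * m%:R) + 1.
    have : eps * k%:R <= eps * (2 * m + 1)%N%:R.
      by apply: ler_wpM2l; [exact: ltW|rewrite ler_nat].
    rewrite natrD natrM; lra.
  have p1 := epsk0 m; have p2 := epsk0 k.
  move: s1 s2 p1 p2; set s := eps * m%:R; set u := eps * k%:R => s1 s2 p1 p2.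
  have h1 : (bnd_A + bnd_d) * s <= (bnd_A + bnd_d) * u.
    by apply: ler_wpM2l => //; lra.
  have h2 : u ^+ 2 / 8 - 1 / 4 <= s ^+ 2.
    have : 0 <= (2 * s - u + 1) * (2 * s + u + 1) by rewrite mulr_ge0 //; lra.
    have := sqr_ge0 (2 * s - 1); nra.
  have : 0 <= bnd_d * (s ^+ 2 - (u ^+ 2 / 8 - 1 / 4)).
    by rewrite mulr_ge0 ?subr_ge0 // ltW.
  lra.
have hS : 1 / 2 <= apx_S k + apx_y k.
  have S1 := apx_S_ge1 k.
  have [kt|kt] := leP (eps * k%:R) t0.
    have := apx_y_small kt; rewrite ler_norml => /andP[h _]; have := apx_step_M; lra.
  have : 0 <= apx_y k.
    apply: mulr_ge0; first exact: ltW.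
    by apply: Im_val_ge0; [exact: ltW|exact: eps_k_le].
  lra.
have : normc (c k) ^+ 2 * (1 / 2) <= apx_b k.
  by apply: ler_wpM2l => //; exact: sqr_ge0.
lra.
Qed.

End Bounds.

(** * Pointwise convergence of the approximants *)

Section PolynomialTaylor.
Context {R : realType}.

Lemma poly_bounded (p : {poly R[i]}) (tau : R) : 0 <= tau ->
  exists2 M : R, 0 <= M & forall w, normc w <= tau -> normc p.[w] <= M.
Proof.
move=> t0; elim/poly_ind: p => [|p c [M M0 hM]].
  by exists 0 => // w _; rewrite horner0 Normc.normc0.
exists (M * tau + normc c); first by rewrite addr_ge0 ?normc_ge0 // mulr_ge0.
move=> w wt; rewrite hornerMXaddC; apply: (le_trans (normcD _ _)); rewrite lerD2r.
by rewrite Normc.normcM; apply: ler_pM; rewrite ?normc_ge0 // hM.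
Qed.

Lemma poly_taylor (p : {poly R[i]}) (tau : R) : 0 <= tau ->
  exists2 C : R, 0 <= C & forall w h, normc w <= tau -> normc h <= tau ->
    normc (p.[w + h] - p.[w] - h * p^`().[w]) <= C * normc h ^+ 2.
Proof.
move=> t0; elim/poly_ind: p => [|p c [C C0 hC]].
  exists 0 => // w h _ _.
  by rewrite deriv0 !horner0 mulr0 !subr0 Normc.normc0 mul0r.
have [M M0 hM] := poly_bounded p^`() t0.
exists (tau * C + (M + C * tau)).
  by rewrite addr_ge0 ?mulr_ge0 // addr_ge0 // mulr_ge0.
move=> w h wt ht; rewrite derivMXaddC hornerD hornerMX !hornerMXaddC.
have -> : p.[w + h] * (w + h) + c - (p.[w] * w + c) - h * (p.[w] + p^`().[w] * w) =
    w * (p.[w + h] - p.[w] - h * p^`().[w]) + h * (p.[w + h] - p.[w]) by ring.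
have h1 := hC w h wt ht.
have h2 : normc (p.[w + h] - p.[w]) <= normc h * (M + C * tau).
  rewrite -[p.[w + h] - p.[w]](subrK (h * p^`().[w])).
  apply: (le_trans (normcD _ _)); rewrite mulrDr addrC; apply: lerD.
    by rewrite Normc.normcM; apply: ler_wpM2l; rewrite ?normc_ge0 // hM.
  apply: (le_trans h1); rewrite expr2 mulrCA; apply: ler_wpM2l; first exact: normc_ge0.
  exact: ler_wpM2l.
apply: (le_trans (normcD _ _)); rewrite mulrDl; apply: lerD.
  rewrite Normc.normcM -mulrA; apply: ler_pM; rewrite ?normc_ge0 //.
rewrite Normc.normcM expr2 [leRHS]mulrC -mulrA; apply: ler_wpM2l => //.
exact: normc_ge0.
Qed.

Lemma onI_bounded (p : {poly R}) (tau : R) : 0 <= tau ->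
  exists2 M : R, 0 <= M & forall s, 0 <= s <= tau -> normc (onI p s) <= M.
Proof.
move=> t0; have [M M0 hM] := poly_bounded (map_poly (real_complex R) p) t0.
exists M => // s /andP[s0 st]; apply: hM.
by rewrite Normc.normcM normc_i mul1r normc_real ger0_norm.
Qed.

Lemma onI_taylor (p : {poly R}) (tau : R) : 0 <= tau ->
  exists2 C : R, 0 <= C & forall s e, 0 <= s <= tau -> 0 <= e <= tau ->
    normc (onI p (s + e) - onI p s - 'i * e%:C * onI p^`() s) <= C * e ^+ 2.
Proof.
move=> t0; have [C C0 hC] := poly_taylor (map_poly (real_complex R) p) t0.
exists C => // s e /andP[s0 st] /andP[e0 et].
have ni (x : R) : 0 <= x -> normc ('i * x%:C) = x.
  by move=> x0; rewrite Normc.normcM normc_i mul1r normc_real ger0_norm.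
have := hC ('i * s%:C) ('i * e%:C).
rewrite !ni // => /(_ st et).
by rewrite /onI /ceval rmorphD mulrDr deriv_map.
Qed.

End PolynomialTaylor.

Section CayleyPhase.
Context {R : realType}.

Definition cayley_phase (N k : nat) (W : R[i]) : R[i] :=
  (1 + W) ^+ (N + k) * (1 - W) ^+ (N - k).

(** For [W = i eps z / 2] the first factor is near 1, as [N |W|^2] is of order [eps T], and the
    second approximates [cexp (2 k W) = cexp (i eps k z)]. *)
Lemma cayley_phaseE (N k : nat) (W : R[i]) : (k <= N)%N ->
  cayley_phase N k W = (1 - W ^+ 2) ^+ (N - k) * (1 + W) ^+ (k.*2).
Proof.
move=> kN; have -> : 1 - W ^+ 2 = (1 + W) * (1 - W) by ring.
rewrite /cayley_phase (_ : N + k = (N - k) + k.*2)%N; last by rewrite -addnn addnA subnK.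
by rewrite exprD exprMn mulrAC.
Qed.

Lemma normc_1D_le (W : R[i]) : normc (1 + W) <= expR (normc W).
Proof.
apply: le_trans (expR_ge1Dx _); apply: (le_trans (normcD _ _)).
by rewrite Normc.normc1.
Qed.

Lemma expRB1_le (x : R) : expR x - 1 <= x * expR x.
Proof.
have h := expR_ge1Dx (- x).
have : (1 - x) * expR x <= expR (- x) * expR x by rewrite ler_wpM2r ?expR_ge0.
by rewrite -expRD addNr expR0; lra.
Qed.

Lemma normc_pow1B_sqr (N k : nat) (W : R[i]) :
  normc ((1 - W ^+ 2) ^+ (N - k) - 1) <= expR (N%:R * normc W ^+ 2) - 1.
Proof.
have -> : (1 - W ^+ 2) ^+ (N - k) = \prod_(i <- index_iota 0 (N - k)) (1 - W ^+ 2).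
  by rewrite prodr_const_nat subn0.
apply: (le_trans (@normc_prodB1 _ _ _ _ (fun=> normc W ^+ 2) _)).
  by move=> i _; rewrite addrAC subrr add0r normc_N normcX.
rewrite lerD2r ler_expR sumr_const_nat subn0 -[leLHS]mulr_natl.
by apply: ler_wpM2r; [rewrite sqr_ge0|rewrite ler_nat leq_subr].
Qed.

Lemma normc_cayley_phase_le (N k : nat) (W : R[i]) : (k <= N)%N ->
  normc (cayley_phase N k W) <= expR (N%:R * normc W ^+ 2) * expR (k.*2%:R * normc W).
Proof.
move=> kN; rewrite cayley_phaseE // Normc.normcM; apply: ler_pM; try exact: normc_ge0.
  rewrite -[X in normc X](subrK 1); apply: (le_trans (normcD _ _)).
  by rewrite Normc.normc1 -lerBrDr normc_pow1B_sqr.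
rewrite normcX expRM_natl; apply: lerXn2r; rewrite ?nnegrE ?normc_ge0 ?expR_ge0 //.
exact: normc_1D_le.
Qed.

Lemma cayley_phase_approx (N k : nat) (W : R[i]) : (k <= N)%N ->
  normc (cayley_phase N k W - cexp (k.*2%:R * W)) <=
    (N%:R * normc W ^+ 2 * expR (N%:R * normc W ^+ 2)
      + 21 * (k.*2%:R * normc W) * normc W * expR (normc W)) * expR (k.*2%:R * normc W).
Proof.
move=> kN; rewrite cayley_phaseE //; set P := _ ^+ (N - k); set n := k.*2.
have n0 := @normc_ge0 R.
have eE : cexp (n%:R * W) = \prod_(i <- index_iota 0 n) cexp W.
  rewrite prodr_const_nat subn0.
  elim: n => [|m IH]; first by rewrite mul0r cexp0.
  by rewrite -natr1 mulrDl mul1r cexpD IH exprSr.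
have qE : (1 + W) ^+ n = \prod_(i <- index_iota 0 n) (1 + W).
  by rewrite prodr_const_nat subn0.
have M1 : 1 <= expR (normc W) by rewrite -[leLHS](expR0 R) ler_expR.
have E : expR (n%:R * normc W) = expR (normc W) ^+ n by rewrite expRM_natl.
have d0 : 0 <= 21 * normc W ^+ 2 * expR (normc W).
  by rewrite !mulr_ge0 ?exprn_ge0 ?expR_ge0.
have h2 : normc ((1 + W) ^+ n - cexp (n%:R * W)) <=
    n%:R * expR (normc W) ^+ n * (21 * normc W ^+ 2 * expR (normc W)).
  rewrite qE eE; apply: (le_trans (@normc_prodB _ _ _ _ _ (expR (normc W)) _ M1 d0 _ _ _)).
  - by move=> i _; exact: normc_1D_le.
  - move=> i _; rewrite normc_cexp ler_expR; exact: le_trans (ler_norm _) (normr_Re_le _).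
  - move=> i _; rewrite normc_distC; have -> : cexp W - (1 + W) = cexp W - 1 - W by ring.
    exact: cexp_taylor2.
  - by rewrite size_iota subn0.
have -> : P * (1 + W) ^+ n - cexp (n%:R * W) =
    (P - 1) * (1 + W) ^+ n + ((1 + W) ^+ n - cexp (n%:R * W)) by ring.
apply: (le_trans (normcD _ _)); rewrite [leRHS]mulrDl; apply: lerD.
  rewrite Normc.normcM; apply: ler_pM => //.
    exact: le_trans (normc_pow1B_sqr _ _ _) (expRB1_le _).
  rewrite normcX E; apply: lerXn2r; rewrite ?nnegrE ?expR_ge0 //.
  exact: normc_1D_le.
by apply: (le_trans h2); rewrite E le_eqVlt; apply/orP; left; apply/eqP; ring.
Qed.

End CayleyPhase.

Section Pointwise.
Context {R : realType}.
Variables (G : {poly R}) (e0 t0 M0 : R).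
Local Notation D := G^`().
Hypotheses (DR : real_rooted D) (sD : (1 < size D)%N).
Hypotheses (e0_gt0 : 0 < e0) (t0_ge1 : 1 <= t0) (M0_ge0 : 0 <= M0).
Hypothesis imD : forall t, t0 <= t -> e0 * t <= complex.Im (onI D t).
Hypothesis reD : (forall t, t0 <= t -> 0 <= complex.Re (onI D t)) \/
                 (forall t, t0 <= t -> complex.Re (onI D t) <= 0).
Hypothesis M0P : forall t, 0 <= t <= t0 -> normc (onI D t) <= M0.

Local Notation large := (large_T e0 t0 M0).
Local Notation beta := (apx_slope D).
Local Notation N := (apx_deg D).
Local Notation eps := (apx_step D).
Local Notation kap := (apx_scale D).
Local Notation Q := (apx_poly D).
Local Notation q := (apx_val D).
Local Notation w := (apx_w D).
Local Notation c := (apx_coef D).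

Let TL_gt0 T : large T -> 0 < T.
Proof. by move=> TL; exact: (T_gt0 t0_ge1 TL). Qed.

Let TL_ge1 T : large T -> 1 <= T.
Proof. by move=> TL; have := T_ge3 t0_ge1 TL; lra. Qed.

Let im_gt0 T : large T -> 0 < complex.Im (onI D T).
Proof. by move=> TL; exact: (imD_gt0 e0_gt0 t0_ge1 imD TL). Qed.

Lemma step_bound T : large T -> eps T <= e0^-1 / T.
Proof.
move=> TL; have TT := TL_gt0 TL.
have h := apx_step_eT e0_gt0 t0_ge1 imD TL.
by rewrite ler_pdivlMr // -[leRHS]mul1r ler_pdivlMr //; lra.
Qed.

Lemma step_gt0 T : large T -> 0 < eps T.
Proof. by move=> /TL_gt0; exact: apx_step_gt0. Qed.

Lemma step_le1 T : large T -> eps T <= 1.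
Proof. by move=> TL; exact: (apx_step_le1 e0_gt0 t0_ge1 imD TL). Qed.

(** The reward of the factor [1 - X^2 / T]: not only [eps] but [eps T] tends to 0. *)
Lemma stepT_bound T : large T -> eps T * T <= 2 * e0^-1 / T.
Proof.
move=> TL; have TT := TL_gt0 TL; have e := step_gt0 TL.
have h0 := apx_step_small e0_gt0 t0_ge1 imD TL.
have h : eps T * (e0 * T * T) <= eps T * (e0 * T * (1 + T)).
  apply: ler_wpM2l; first exact: ltW.
  by apply: ler_wpM2l; [rewrite mulr_ge0 // ltW|lra].
by rewrite ler_pdivlMr // ler_pdivlMr //; lra.
Qed.

(** On a bounded range the scale, the slope factor and [1 + t^2 / T] each differ from 1 by a
    multiple of [1 / T]. *)
Lemma val_approx (tau : R) : 0 <= tau -> exists2 E : R, 0 <= E &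
  forall T t, large T -> tau <= T -> 0 <= t <= tau ->
    normc (onI (Q T) t - onI D t) <= E / T.
Proof.
move=> tau0; have [M M_ge0 hM] := onI_bounded D tau0.
have tau2 : 0 <= tau ^+ 2 by exact: sqr_ge0.
have i0 : 0 <= 2 / e0 by rewrite divr_ge0 // ltW.
pose Ct := 2 / e0 * (2 * (1 + tau ^+ 2)) + 3 * tau * (1 + tau ^+ 2) + tau ^+ 2.
have Ct0 : 0 <= Ct.
  have h : 0 <= 1 + tau ^+ 2 by exact: addr_ge0.
  by do 2?apply: addr_ge0 => //; apply: mulr_ge0 => //; apply: mulr_ge0.
exists (M * Ct); first exact: mulr_ge0.
move=> T t TL tT /andP[t_ge0 tt]; have TT := TL_gt0 TL.
have T1 := TL_ge1 TL; have I0 := im_gt0 TL.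
have [k1 k2] := apx_scale_bounds TT I0.
have Y0 := apx_mod_gt0 TT I0; have Yl := apx_mod_large e0_gt0 t0_ge1 imD TL.
have k3 : `|kap T - 1| <= 2 / e0 / T.
  rewrite ger0_norm ?subr_ge0 // lerBlDl; apply: (le_trans k2); rewrite lerD2l.
  have TY : 0 < T * apx_mod D T by exact: mulr_gt0.
  have eT : 0 < e0 * T by exact: mulr_gt0.
  rewrite -[leRHS]mulrA ler_pM2l // -(invfM e0 T) lef_pV2 ?posrE //.
  rewrite (mulrC e0) ler_pM2l //; apply: le_trans Yl; rewrite -[leRHS]mulrA.
  rewrite -{1}[e0]mulr1 ler_pM2l //; have := mulr_ge0 (ltW TT) (ltW TT); nra.
set b := beta T * t.
have bT : `|b| <= t / T by apply: (beta_le e0_gt0 t0_ge1 imD TL) => //; exact: le_trans tT.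
have b1 : `|b| <= 1.
  by apply: (le_trans bT); rewrite ler_pdivrMr // mul1r (le_trans tt).
have b2 : `|b| <= tau / T.
  by apply: (le_trans bT); rewrite ler_pM2r ?invr_gt0.
have bb : b ^+ 2 <= `|b|.
  by rewrite -real_normK ?num_real // expr2 ler_piMl.
pose X : R[i] := (1 - 'i * b%:C) ^+ 2.
have X2 : normc X <= 2.
  rewrite normcX sqr_normcE !(ReCD, ImCD, ReCN, ImCN, ReCM, ImCM) /=; lra.
have X1 : normc (X - 1) <= 3 * tau / T.
  have -> : X - 1 = - ('i * (2 * b)%:C) - (b ^+ 2)%:C.
    by apply: complex_eqP; rewrite /X /=; ring.
  apply: (le_trans (normcB _ _)); rewrite normc_N Normc.normcM normc_i mul1r !normc_real.
  rewrite normrM (ger0_norm (x := 2)) // (ger0_norm (sqr_ge0 b)) -[leRHS]mulrA; lra.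
pose V := 1 + t ^+ 2 / T.
have t2 : t ^+ 2 <= tau ^+ 2 by apply: lerXn2r; rewrite ?nnegrE.
have V1 : `|V - 1| <= tau ^+ 2 / T.
  rewrite /V addrC addKr ger0_norm ?ler_pM2r ?invr_gt0 //.
  by rewrite divr_ge0 ?sqr_ge0 // ltW.
have V2 : `|V| <= 1 + tau ^+ 2.
  rewrite -[V](subrK 1); apply: (le_trans (ler_normD _ _)); rewrite normr1 addrC lerD2l.
  by apply: (le_trans V1); rewrite ler_pdivrMr // ler_peMr.
rewrite onI_apx -/b -/X -/V.
have -> : (kap T)%:C * onI D t * X * V%:C - onI D t =
    onI D t * ((kap T - 1)%:C * (X * V%:C) + (X - 1) * V%:C + (V - 1)%:C).
  by rewrite !rmorphB rmorph1; ring.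
rewrite Normc.normcM -[leRHS]mulrA; apply: ler_pM; rewrite ?normc_ge0 //.
  by apply: hM; rewrite t_ge0.
have -> : Ct / T = 2 / e0 / T * (2 * (1 + tau ^+ 2)) + 3 * tau / T * (1 + tau ^+ 2)
    + tau ^+ 2 / T by rewrite /Ct; ring.
have n0 := @normc_ge0 R; clearbody X V.
apply: (le_trans (normcD _ _)); apply: lerD; last by rewrite normc_real.
apply: (le_trans (normcD _ _)); apply: lerD; rewrite !Normc.normcM !normc_real.
  have XV : normc X * `|V| <= 2 * (1 + tau ^+ 2) by exact: ler_pM.
  by apply: ler_pM => //; exact: mulr_ge0.
exact: ler_pM.
Qed.

(** The recurrence is a one-step scheme for [y' = i G'(it) y]. Its ratio and the exact ratio agree
    up to [eps / T] at each step; there are at most [tau / eps] steps, and [normc_prodB] adds up the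
    errors. *)
Lemma coef_approx (tau : R) : 0 <= tau -> exists C T2 : R, 0 <= C /\
  forall T k, large T -> T2 <= T -> eps T * k%:R <= tau ->
    normc (c T k - cexp (onI G (eps T * k%:R) - onI G 0)) <= C / T.
Proof.
move=> tau0.
have [M M_ge0 hM] := onI_bounded D tau0.
have [E E0 hE] := val_approx tau0.
have tau1 : 0 <= tau + 1 by rewrite addr_ge0.
have [C2 C20 hC2] := onI_taylor G tau1.
have [C3 C30 hC3] := onI_taylor D tau1.
have [M' M'0 hM'] := onI_bounded D^`() tau1.
pose L := M' + C3.
have L0 : 0 <= L by exact: addr_ge0.
pose B := M + C2.
have B0 : 0 <= B by exact: addr_ge0.
have ie : 0 < e0^-1 by rewrite invr_gt0.
(* [Ca] and [Cb] are the errors, in units of [eps / T], of the discrete and of the exact ratio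
   against [1 + i eps G'(i eps j)]. *)
pose Ca := 2 * E + L * e0^-1 + (M + E) * M * e0^-1.
pose Cb := (21 * B ^+ 2 + C2) * e0^-1.
pose C5 := Ca + Cb.
have B2 : 0 <= B ^+ 2 by exact: sqr_ge0.
have Ca0 : 0 <= Ca.
  have ME : 0 <= M + E by exact: addr_ge0.
  rewrite /Ca; do 2?apply: addr_ge0; try exact: mulr_ge0.
    by apply: mulr_ge0 => //; exact: ltW.
  by apply: mulr_ge0; [exact: mulr_ge0|exact: ltW].
have Cb0 : 0 <= Cb.
  by apply: mulr_ge0; [apply: addr_ge0 => //; exact: mulr_ge0|exact: ltW].
have C50 : 0 <= C5 by exact: addr_ge0.
(* The threshold yields [eps * (M + E + B) <= 1]: denominators are then at least 1/2, and the
   small-argument Taylor bound applies to each exact exponent. *)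
exists (tau * expR ((B + C5) * tau) * C5), (tau + (M + E + B) * e0^-1); split.
  by apply: mulr_ge0 => //; apply: mulr_ge0 => //; exact: expR_ge0.
move=> T k TL T2 ktau.
have TT := TL_gt0 TL; have T1 := TL_ge1 TL.
have MEB : 0 <= M + E + B by rewrite !addr_ge0.
have tauT : tau <= T by apply: le_trans T2; rewrite lerDl mulr_ge0 // ltW.
have ep := step_gt0 TL; have eb := step_bound TL; have e1 := step_le1 TL.
have eMEB : eps T * (M + E + B) <= 1.
  have h : eps T * (M + E + B) <= e0^-1 / T * (M + E + B) by apply: ler_wpM2r.
  apply: (le_trans h); rewrite mulrAC ler_pdivrMr // mul1r mulrC.
  by apply: le_trans T2; rewrite lerDr.
pose a j := apx_num D T j / apx_den D T j.+1.
pose b j := cexp (onI G (eps T * j.+1%:R) - onI G (eps T * j%:R)).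
have cE n : c T n = \prod_(j <- iota 0 n) a j.
  elim: n => [|n IH]; first by rewrite big_nil.
  by rewrite -addn1 iotaD big_cat big_seq1 -IH addn1.
have bE n : cexp (onI G (eps T * n%:R) - onI G 0) = \prod_(j <- iota 0 n) b j.
  elim: n => [|n IH]; first by rewrite (mulr0 (eps T)) subrr cexp0 /= big_nil.
  rewrite -addn1 iotaD big_cat big_seq1 add0n -IH addn1.
  apply: (@etrans _ _ (cexp _ * cexp _)); last by [].
  by rewrite -cexpD; congr cexp; rewrite [RHS]addrC [RHS]addrA subrK.
have jt j : j \in iota 0 k -> 0 <= eps T * j%:R <= tau /\ 0 <= eps T * j.+1%:R <= tau.
  rewrite mem_iota add0n => /andP[_ jk].
  have h1 : eps T * j.+1%:R <= tau.
    by apply: le_trans ktau; rewrite ler_pM2l // ler_nat.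
  have h2 : eps T * j%:R <= eps T * j.+1%:R by rewrite ler_pM2l // ler_nat.
  by split; rewrite mulr_ge0 ?(ltW ep) //=; exact: le_trans h1.
have nw : normc (w T) = eps T / 2 by exact: normc_apx_w.
have wE : w T * 2 = 'i * (eps T)%:C.
  by rewrite /apx_w; apply: complex_eqP => /=; field.
pose d j := onI D (eps T * j%:R).
have n0 := @normc_ge0 R.
have ET : E / T <= E by rewrite ler_pdivrMr // ler_peMr.
have qd j : 0 <= eps T * j%:R <= tau -> normc (q T j - d j) <= E / T.
  by move=> h; apply: hE.
have dM j : 0 <= eps T * j%:R <= tau -> normc (d j) <= M by exact: hM.
have qM j : 0 <= eps T * j%:R <= tau -> normc (q T j) <= M + E.
  move=> h; rewrite -[q T j](subrK (d j)) addrC; apply: (le_trans (normcD _ _)).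
  by apply: lerD; [exact: dM|exact: le_trans (qd _ h) ET].
have stepS j : eps T * j.+1%:R = eps T * j%:R + eps T by rewrite -natr1 mulrDr mulr1.
have es : 0 <= eps T <= tau + 1 by rewrite (ltW ep) /=; lra.
have widen x : 0 <= x <= tau -> 0 <= x <= tau + 1 by move=> /andP[-> h] /=; lra.
have dL j : j \in iota 0 k -> normc (d j.+1 - d j) <= L * eps T.
  move=> /jt[h1 _]; rewrite /d stepS.
  have := hC3 _ _ (widen _ h1) es; set u := 'i * _ * _ => h.
  rewrite -[X in normc X](subrK u); apply: (le_trans (normcD _ _)).
  have hu : normc u <= eps T * M'.
    rewrite /u !Normc.normcM normc_i mul1r normc_real (gtr0_norm ep).
    by apply: ler_wpM2l; [exact: ltW|exact: hM' (widen _ h1)].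
  have : C3 * eps T ^+ 2 <= C3 * eps T.
    by apply: ler_wpM2l => //; rewrite expr2 ler_piMl // ltW.
  rewrite /L; lra.
have aD j : j \in iota 0 k -> normc (a j - (1 + w T * 2 * d j)) <= eps T * (Ca / T).
  move=> jk; have [h1 h2] := jt j jk.
  have wq : normc (w T * q T j.+1) <= 1 / 2.
    rewrite Normc.normcM nw; have := qM _ h2.
    have : eps T * normc (q T j.+1) <= eps T * (M + E).
      by apply: ler_wpM2l; [exact: ltW|exact: qM].
    have : 0 <= eps T * B by rewrite mulr_ge0 // ltW.
    lra.
  have den : 1 / 2 <= normc (apx_den D T j.+1).
    apply: le_trans (ler_normcB 1 (w T * q T j.+1)); rewrite Normc.normc1.
    by move: wq; set u := normc _; lra.
  have den0 : apx_den D T j.+1 != 0 by rewrite -normc_gt0 (lt_le_trans _ den) // divr_gt0.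
  have -> : a j - (1 + w T * 2 * d j) =
      (w T * (q T j - d j + (q T j.+1 - d j.+1) + (d j.+1 - d j))
        + w T * 2 * (w T * q T j.+1 * d j)) / apx_den D T j.+1.
    apply: (mulIf den0); rewrite mulrBl /a !divfK // /apx_num /apx_den; ring.
  rewrite Normc.normcM Normc.normcV ler_pdivrMr ?normc_gt0 //.
  have t1 : normc (w T * (q T j - d j + (q T j.+1 - d j.+1) + (d j.+1 - d j))) <=
      eps T / 2 * (E / T + E / T + L * eps T).
    rewrite Normc.normcM nw; apply: ler_wpM2l; first by rewrite divr_ge0 // ltW.
    apply: (le_trans (normcD _ _)); apply: lerD; last exact: dL.
    by apply: (le_trans (normcD _ _)); apply: lerD; exact: qd.
  have t2 : normc (w T * 2 * (w T * q T j.+1 * d j)) <= eps T / 2 * ((M + E) * M * eps T).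
    rewrite wE (Normc.normcM ('i * (eps T)%:C)) (Normc.normcM 'i (eps T)%:C).
    rewrite (Normc.normcM (w T * q T j.+1)) (Normc.normcM (w T)).
    rewrite normc_i mul1r normc_real (gtr0_norm ep) nw.
    have -> : eps T / 2 * ((M + E) * M * eps T) = eps T * (eps T / 2 * (M + E) * M) by ring.
    apply: ler_wpM2l; first exact: ltW.
    apply: ler_pM => //; first by rewrite mulr_ge0 // divr_ge0 // ltW.
      by apply: ler_wpM2l; [rewrite divr_ge0 // ltW|exact: qM].
    exact: dM.
  have t3 : normc (w T * (q T j - d j + (q T j.+1 - d j.+1) + (d j.+1 - d j))
        + w T * 2 * (w T * q T j.+1 * d j)) <= eps T / 2 * (Ca / T).
    apply: (le_trans (normcD _ _)); apply: (le_trans (lerD t1 t2)).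
    rewrite -mulrDr; apply: ler_wpM2l; first by rewrite divr_ge0 // ltW.
    have l1 : L * eps T <= L * (e0^-1 / T) by exact: ler_wpM2l.
    have l2 : (M + E) * M * eps T <= (M + E) * M * (e0^-1 / T).
      by apply: ler_wpM2l => //; rewrite mulr_ge0 // addr_ge0.
    have -> : Ca / T = E / T + E / T + L * (e0^-1 / T) + (M + E) * M * (e0^-1 / T).
      by rewrite /Ca; ring.
    by apply: lerD l2; apply: lerD.
  apply: (le_trans t3).
  have CT : 0 <= eps T * (Ca / T) by rewrite mulr_ge0 ?divr_ge0 // ltW.
  have : eps T * (Ca / T) * (1 / 2) <= eps T * (Ca / T) * normc (apx_den D T j.+1).
    exact: ler_wpM2l.
  apply: le_trans; rewrite mulrAC; lra.
have bD j : j \in iota 0 k -> normc (b j - (1 + w T * 2 * d j)) <= eps T * (Cb / T) /\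
     normc (b j) <= expR (eps T * B).
  move=> jk; have [h1 h2] := jt j jk.
  rewrite /b; set x := onI G _ - onI G _.
  have hx : normc (x - w T * 2 * d j) <= C2 * eps T ^+ 2.
    by rewrite wE /x /d stepS; apply: hC2 => //; exact: widen.
  have xB : normc x <= eps T * B.
    rewrite -[x](subrK (w T * 2 * d j)); apply: (le_trans (normcD _ _)).
    have : normc (w T * 2 * d j) <= eps T * M.
      rewrite wE !Normc.normcM normc_i mul1r normc_real (gtr0_norm ep).
      by apply: ler_wpM2l; [exact: ltW|exact: dM].
    have : C2 * eps T ^+ 2 <= C2 * eps T.
      by apply: ler_wpM2l => //; rewrite expr2 ler_piMl // ltW.
    rewrite /B; lra.
  split; last first.
    rewrite normc_cexp ler_expR; apply: le_trans xB.
    exact: le_trans (ler_norm _) (normr_Re_le _).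
  have x1 : normc x <= 1.
    apply: (le_trans xB); apply: le_trans eMEB; apply: ler_wpM2l; first exact: ltW.
    by rewrite lerDr addr_ge0.
  have -> : cexp x - (1 + w T * 2 * d j) = (cexp x - 1 - x) + (x - w T * 2 * d j) by ring.
  apply: (le_trans (normcD _ _)).
  have h3 := cexp_taylor2_small x1.
  have x2 : normc x ^+ 2 <= eps T ^+ 2 * B ^+ 2.
    by rewrite -exprMn; apply: lerXn2r; rewrite ?nnegrE // mulr_ge0 // ltW.
  have h4 : eps T * ((21 * B ^+ 2 + C2) * eps T) <= eps T * (Cb / T).
    apply: ler_wpM2l; first exact: ltW.
    rewrite /Cb -[leRHS]mulrA; apply: ler_wpM2l => //.
    by rewrite addr_ge0 // mulr_ge0.
  lra.
have ab j : j \in iota 0 k -> normc (a j - b j) <= eps T * (C5 / T).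
  move=> jk.
  have -> : a j - b j = (a j - (1 + w T * 2 * d j)) - (b j - (1 + w T * 2 * d j)) by ring.
  apply: (le_trans (normcB _ _)).
  have h1 := aD j jk; have [h2 _] := bD j jk.
  by rewrite /C5 mulrDl mulrDr; exact: lerD.
have C5T : C5 / T <= C5 by rewrite ler_pdivrMr // ler_peMr.
have e5 : 0 <= eps T * C5 by rewrite mulr_ge0 // ltW.
have MB : expR (eps T * B) <= expR (eps T * (B + C5)).
  by rewrite ler_expR; apply: ler_wpM2l; [exact: ltW|rewrite lerDl].
have bM j : j \in iota 0 k -> normc (b j) <= expR (eps T * (B + C5)).
  by move=> /bD[_ h]; exact: le_trans MB.
have aM j : j \in iota 0 k -> normc (a j) <= expR (eps T * (B + C5)).
  move=> jk; rewrite -[a j](subrK (b j)); apply: (le_trans (normcD _ _)).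
  have [_ h2] := bD j jk; have h1 := ab j jk.
  have h3 : eps T * (C5 / T) <= eps T * C5 by apply: ler_wpM2l; [exact: ltW|].
  have h4 : 1 + eps T * C5 <= expR (eps T * C5) by exact: expR_ge1Dx.
  have u1 : 1 <= expR (eps T * B).
    by rewrite -[leLHS](expR0 R) ler_expR mulr_ge0 // ltW.
  have h5 : expR (eps T * B) * (1 + eps T * C5) <= expR (eps T * B) * expR (eps T * C5).
    by apply: ler_wpM2l => //; exact: expR_ge0.
  rewrite (mulrDr (eps T) B C5) expRD addrC; apply: le_trans h5.
  rewrite mulrDr mulr1; apply: lerD => //; apply: (le_trans (le_trans h1 h3)).
  by rewrite ler_peMl.
have M1 : 1 <= expR (eps T * (B + C5)).
  by rewrite -[leLHS](expR0 R) ler_expR; apply: mulr_ge0; [exact: ltW|exact: addr_ge0].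
have d5 : 0 <= eps T * (C5 / T) by rewrite mulr_ge0 ?divr_ge0 // ltW.
rewrite cE bE; apply: (le_trans (normc_prodB M1 d5 aM bM ab)).
rewrite size_iota -expRM_natl.
have -> : k%:R * expR (k%:R * (eps T * (B + C5))) * (eps T * (C5 / T)) =
  (eps T * k%:R) * expR ((B + C5) * (eps T * k%:R)) * (C5 / T).
  by rewrite (_ : k%:R * (eps T * (B + C5)) = (B + C5) * (eps T * k%:R)); ring.
rewrite -[leRHS]mulrA; apply: ler_wpM2r; first by rewrite divr_ge0 // ltW.
apply: ler_pM; [|exact: expR_ge0|exact: ktau|].
  by apply: mulr_ge0; first exact: ltW.
by rewrite ler_expR; apply: ler_wpM2l => //; exact: addr_ge0.
Qed.

Let eps0 T : large T -> 0 < eps T.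
Proof. by move=> TL; exact: (step_gt0 TL). Qed.

Let ie0 : 0 < e0^-1. Proof. by rewrite invr_gt0. Qed.

Lemma normc_wM T (z : R[i]) : large T -> normc (w T * z) = eps T / 2 * normc z.
Proof. by move=> TL; rewrite (Normc.normcM (w T)) normc_apx_w // TL_gt0. Qed.

Lemma deg_sqr_wM T (z : R[i]) : large T ->
  (N T)%:R * normc (w T * z) ^+ 2 <= e0^-1 * normc z ^+ 2 / T.
Proof.
move=> TL; rewrite normc_wM // exprMn mulrA.
have -> : (N T)%:R * (eps T / 2) ^+ 2 = eps T * (eps T * (N T)%:R) / 4 by field.
rewrite apx_stepN [leRHS]mulrAC; apply: ler_wpM2r; first by rewrite exprn_ge0 // normc_ge0.
have := stepT_bound TL.
have : 0 <= e0^-1 / T by rewrite divr_ge0 ?(ltW ie0) // ltW // TL_gt0.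
lra.
Qed.

Lemma double_wM T k (z : R[i]) : large T ->
  k.*2%:R * normc (w T * z) = eps T * k%:R * normc z.
Proof. by move=> TL; rewrite normc_wM // -muln2 natrM; field. Qed.

Lemma double_wE T k (z : R[i]) : k.*2%:R * (w T * z) = 'i * (eps T * k%:R)%:C * z.
Proof.
rewrite -muln2 natrM /apx_w; set e := eps T.
by apply: complex_eqP; case: z => x y; rewrite !(ReCD, ImCD, ReCM, ImCM) /=
  -(rmorph_nat (real_complex R) k) /=; field.
Qed.

Lemma sample_approx (tau : R) (z : R[i]) : 0 <= tau -> exists C T2 : R, 0 <= C /\
  forall T k, large T -> T2 <= T -> (k <= N T)%N -> eps T * k%:R <= tau ->
    normc (c T k * cayley_phase (N T) k (w T * z) -
      cexp (onI G (eps T * k%:R) - onI G 0 + 'i * (eps T * k%:R)%:C * z)) <= C / T.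
Proof.
move=> tau0.
have [C1 [T2 [C10 hC1]]] := coef_approx tau0.
have [M M_ge0 hM] := onI_bounded G tau0.
have n0 := @normc_ge0 R; have nz := n0 z.
pose a := e0^-1 * normc z ^+ 2.
have a0 : 0 <= a by rewrite mulr_ge0 ?sqr_ge0 // ltW.
have tz : 0 <= tau * normc z by rewrite mulr_ge0.
pose B1 := a * expR a.
pose B2 := 21 * (tau * normc z) * (e0^-1 * normc z) * expR (normc z).
pose C2 := (B1 + B2) * expR (tau * normc z).
have B10 : 0 <= B1 by rewrite mulr_ge0 ?expR_ge0.
have B20 : 0 <= B2.
  rewrite /B2; apply: mulr_ge0; last exact: expR_ge0.
  by apply: mulr_ge0; [exact: mulr_ge0|rewrite mulr_ge0 // ltW].
have C20 : 0 <= C2 by apply: mulr_ge0; [exact: addr_ge0|exact: expR_ge0].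
exists (C1 * (expR a * expR (tau * normc z)) + expR (M + M) * C2), T2; split.
  by apply: addr_ge0; apply: mulr_ge0; rewrite // mulr_ge0 ?expR_ge0.
move=> T k TL T2T kN kt.
have TT := TL_gt0 TL; have T1 := TL_ge1 TL; have ep := eps0 TL.
have h1 := hC1 T k TL T2T kt.
have hN := deg_sqr_wM z TL; rewrite -/a in hN.
have aT : a / T <= a by rewrite ler_pdivrMr // ler_peMr.
have hk : k.*2%:R * normc (w T * z) <= tau * normc z.
  by rewrite double_wM // ler_wpM2r.
have W1 : normc (w T * z) <= e0^-1 * normc z / T.
  rewrite normc_wM // [leRHS]mulrAC; apply: ler_wpM2r => //.
  have := step_bound TL; lra.
have W2 : normc (w T * z) <= normc z.
  rewrite normc_wM // -[leRHS]mul1r; apply: ler_wpM2r => //.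
  have := step_le1 TL; lra.
have NW0 : 0 <= (N T)%:R * normc (w T * z) ^+ 2 by rewrite mulr_ge0 ?sqr_ge0.
have kW0 : 0 <= k.*2%:R * normc (w T * z) by rewrite mulr_ge0.
have hphi : normc (cayley_phase (N T) k (w T * z)) <= expR a * expR (tau * normc z).
  apply: (le_trans (normc_cayley_phase_le _ kN)).
  by apply: ler_pM; rewrite ?expR_ge0 // ler_expR // (le_trans hN).
have h2 : normc (cayley_phase (N T) k (w T * z) - cexp ('i * (eps T * k%:R)%:C * z)) <= C2 / T.
  rewrite -double_wE; apply: (le_trans (cayley_phase_approx _ kN)).
  have -> : C2 / T = (a / T * expR a +
      21 * (tau * normc z) * (e0^-1 * normc z / T) * expR (normc z)) * expR (tau * normc z).
    by rewrite /C2 /B1 /B2; ring.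
  have e1 : expR (k.*2%:R * normc (w T * z)) <= expR (tau * normc z) by rewrite ler_expR.
  have p1 : (N T)%:R * normc (w T * z) ^+ 2 * expR ((N T)%:R * normc (w T * z) ^+ 2) <=
      a / T * expR a.
    by apply: ler_pM; rewrite ?expR_ge0 // ler_expR (le_trans hN).
  have p2 : 21 * (k.*2%:R * normc (w T * z)) * normc (w T * z) * expR (normc (w T * z)) <=
      21 * (tau * normc z) * (e0^-1 * normc z / T) * expR (normc z).
    have kW21 : 0 <= 21 * (k.*2%:R * normc (w T * z)) by exact: mulr_ge0.
    apply: ler_pM; [exact: mulr_ge0|exact: expR_ge0| |by rewrite ler_expR].
    by apply: ler_pM => //; rewrite ler_pM2l.
  apply: ler_pM; [|exact: expR_ge0|exact: lerD|exact: e1].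
  apply: addr_ge0; first by apply: mulr_ge0 => //; exact: expR_ge0.
  apply: mulr_ge0; last exact: expR_ge0.
  by apply: mulr_ge0 => //; exact: mulr_ge0.
have k0 : 0 <= eps T * k%:R by rewrite mulr_ge0 // ltW.
have h3 : normc (cexp (onI G (eps T * k%:R) - onI G 0)) <= expR (M + M).
  rewrite normc_cexp ler_expR; apply: (le_trans (ler_norm _)).
  apply: (le_trans (normr_Re_le _)); apply: (le_trans (normcB _ _)).
  by apply: lerD; apply: hM; [rewrite k0|rewrite lexx].
rewrite cexpD; set x := c T k in h1 *; set y := cayley_phase _ _ _ in hphi h2 *.
set u := cexp _ in h1 h3 *; set v := cexp _ in h2 *.
clearbody x y u v; have -> : x * y - u * v = (x - u) * y + u * (y - v) by ring.
apply: (le_trans (normcD _ _)); rewrite 2!Normc.normcM mulrDl; apply: lerD.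
  rewrite [leRHS]mulrAC; exact: ler_pM.
rewrite -[leRHS]mulrA; exact: ler_pM.
Qed.

(** The rate [bnd_d / 16] bounds a squared modulus, hence [bnd_d / 32] for the modulus; half of this
    is spent on completing the square against the linear terms. *)
Definition sample_d : R := bnd_d e0 / 64.

Lemma sample_d_gt0 : 0 < sample_d.
Proof. by rewrite divr_gt0 // bnd_d_gt0. Qed.

Lemma sample_dominated (z : R[i]) : exists2 K : R, 0 <= K &
  forall T k, large T -> (k <= N T)%N ->
    normc (c T k * cayley_phase (N T) k (w T * z)) <=
      K * expR (- (sample_d * (eps T * k%:R) ^+ 2)).
Proof.
have d0 := bnd_d_gt0 e0_gt0; set d := bnd_d e0 in d0.
pose B := (bnd_A e0 t0 M0 + d) / 2 + normc z.
pose K1 := Num.sqrt (8 * expR (d / 8)) * expR (e0^-1 * normc z ^+ 2).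
exists (K1 * expR (B ^+ 2 * 16 / d)).
  by rewrite !mulr_ge0 ?expR_ge0 // sqrtr_ge0.
move=> T k TL kN.
have TT := TL_gt0 TL; have T1 := TL_ge1 TL; have ep := eps0 TL.
have hc := apx_coef_bound DR sD e0_gt0 t0_ge1 M0_ge0 imD reD M0P TL kN.
rewrite -/d in hc; set s := eps T * k%:R in hc *.
have c1 : normc (c T k) <= Num.sqrt (8 * expR (d / 8)) *
    expR (- (d / 32 * s ^+ 2) + (bnd_A e0 t0 M0 + d) / 2 * s).
  rewrite -(ler_pXn2r (n := 2)) ?nnegrE ?normc_ge0 // ?mulr_ge0 ?expR_ge0 ?sqrtr_ge0 //.
  rewrite exprMn sqr_sqrtr ?mulr_ge0 ?expR_ge0 // -expRM_natl.
  apply: (le_trans hc); rewrite le_eqVlt; apply/orP; left; apply/eqP.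
  by congr (_ * expR _); field.
have p1 : normc (cayley_phase (N T) k (w T * z)) <=
    expR (e0^-1 * normc z ^+ 2) * expR (s * normc z).
  apply: (le_trans (normc_cayley_phase_le _ kN)); rewrite double_wM //.
  apply: ler_wpM2r; first exact: expR_ge0.
  rewrite ler_expR; apply: (le_trans (deg_sqr_wM z TL)).
  by rewrite ler_pdivrMr // ler_peMr // mulr_ge0 ?sqr_ge0 // ltW.
rewrite Normc.normcM.
apply: (le_trans (ler_pM (normc_ge0 _) (normc_ge0 _) c1 p1)).
rewrite mulrACA -/K1 -expRD -[leRHS]mulrA -expRD; apply: ler_wpM2l.
  by rewrite mulr_ge0 ?expR_ge0 // sqrtr_ge0.
rewrite ler_expR /sample_d -/d.
have -> : - (d / 32 * s ^+ 2) + (bnd_A e0 t0 M0 + d) / 2 * s + s * normc z =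
   B * s - d / 32 * s ^+ 2 by rewrite /B; ring.
have : 0 <= d / 64 * (s - 32 * B / d) ^+ 2.
  by rewrite mulr_ge0 ?sqr_ge0 // divr_ge0 // ltW.
have -> : d / 64 * (s - 32 * B / d) ^+ 2 = d / 64 * s ^+ 2 - B * s + B ^+ 2 * 16 / d.
  by field; rewrite gt_eqF.
lra.
Qed.

Definition laurent_term (T : R) (j : nat) (z : R[i]) : R[i] :=
  (apx_laurent D T)`_j * ((1 + w T * z) ^+ j * (1 - w T * z) ^+ ((N T).*2 - j)).

(** The integrand of [F] divided by [cexp (G(0))], in accordance with [apx_coef 0 = 1]. *)
Definition gauss_kernel (z : R[i]) (s : R) : R[i] :=
  cexp (onI G s - onI G 0 + 'i * s%:C * z).

Lemma laurent_termD T k z : (k <= N T)%N ->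
  laurent_term T (N T + k) z = c T k * cayley_phase (N T) k (w T * z).
Proof.
move=> kN; rewrite /laurent_term coef_apx_laurent; last by rewrite -addnn leq_add2l.
by rewrite apx_extD /cayley_phase -addnn subnDl.
Qed.

Lemma cayley_phase_conj T k (z : R[i]) :
  (cayley_phase (N T) k (w T * conjc z))^* =
  (1 - w T * z) ^+ (N T + k) * (1 + w T * z) ^+ (N T - k).
Proof.
have h : conjc (w T * conjc z) = - (w T * z).
  by rewrite apx_wM_conj; congr (- (_ * _)); case: z => x y; apply: complex_eqP => /=; ring.
have hW : w T * z = - conjc (w T * conjc z) by rewrite h opprK.
rewrite hW; move: (w T * conjc z) => V {h hW}; rewrite /cayley_phase.
rewrite (rmorphM (@conjc R)) (rmorphXn (@conjc R)) (rmorphXn (@conjc R)).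
by congr (_ ^+ _ * _ ^+ _); case: V => x y; apply: complex_eqP => /=; ring.
Qed.

(** Conjugation exchanges [z] with its conjugate and [k] with [- k], so that estimates are needed
    for nonnegative frequencies only. *)
Lemma laurent_termN T k z : (k <= N T)%N -> laurent_term T (N T - k) z =
  (c T k * cayley_phase (N T) k (w T * conjc z))^*.
Proof.
move=> kN; rewrite /laurent_term coef_apx_laurent; last first.
  by rewrite (leq_trans (leq_subr _ _)) // -addnn leq_addr.
rewrite apx_extN // conjcM cayley_phase_conj.
congr (_ * _); rewrite mulrC; congr (_ ^+ _ * _).
by rewrite -addnn -addnBA ?leq_subr // subKn.
Qed.

Lemma gauss_kernelN z s : gauss_kernel z (- s) = (gauss_kernel (conjc z) s)^*.
Proof.
rewrite /gauss_kernel -cexp_conj onIN; congr cexp.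
have h0 : (onI G 0)^* = onI G 0 by rewrite -onIN oppr0.
rewrite conjcD conjcB h0; congr (_ + _).
by case: z => x y; apply: complex_eqP => /=; ring.
Qed.

Lemma laurent_index T j : (j <= (N T).*2)%N ->
  (exists2 k, (k <= N T)%N & j = (N T + k)%N /\ eps T * j%:R - T = eps T * k%:R) \/
  (exists2 k, (k <= N T)%N & j = (N T - k)%N /\ eps T * j%:R - T = - (eps T * k%:R)).
Proof.
move=> jN; have h := apx_stepN D T; set n := N T in jN h *.
have [nj|/ltnW jn] := leqP n j.
  left; exists (j - n)%N; first by rewrite leq_subLR addnn.
  by split; [rewrite subnKC|rewrite natrB // -[X in _ - X]h mulrBr].
right; exists (n - j)%N; first exact: leq_subr.
by split; [rewrite subKn|rewrite natrB // -[X in _ - X]h mulrBr opprB].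
Qed.

Lemma laurent_term_approx (tau : R) (z : R[i]) : 0 <= tau -> exists C T2 : R, 0 <= C /\
  forall T j, large T -> T2 <= T -> (j <= (N T).*2)%N -> `|eps T * j%:R - T| <= tau ->
    normc (laurent_term T j z - gauss_kernel z (eps T * j%:R - T)) <= C / T.
Proof.
move=> tau0.
have [C1 [T1 [C10 h1]]] := sample_approx z tau0.
have [C2 [T2 [C20 h2]]] := sample_approx (conjc z) tau0.
exists (C1 + C2), (Num.max T1 T2); split; first exact: addr_ge0.
move=> T j TL; rewrite ge_max => /andP[T1T T2T] jN.
have TT : 0 < T := T_gt0 t0_ge1 TL.
have ep : 0 < eps T := step_gt0 TL.
have [[k kN [jE sE]]|[k kN [jE sE]]] := laurent_index jN; rewrite sE jE.
  rewrite ger0_norm; last by rewrite mulr_ge0 // ltW.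
  move=> kt; rewrite laurent_termD //; apply: (le_trans (h1 T k TL T1T kN kt)).
  by rewrite ler_pM2r ?invr_gt0 // lerDl.
rewrite normrN ger0_norm; last by rewrite mulr_ge0 // ltW.
move=> kt; rewrite laurent_termN // gauss_kernelN -conjcB normc_conj.
apply: (le_trans (h2 T k TL T2T kN kt)).
by rewrite ler_pM2r ?invr_gt0 // lerDr.
Qed.

Lemma laurent_term_dominated (z : R[i]) : exists2 K : R, 0 <= K &
  forall T j, large T -> (j <= (N T).*2)%N ->
    normc (laurent_term T j z) <= K * expR (- (sample_d * (eps T * j%:R - T) ^+ 2)).
Proof.
have [K1 K10 h1] := sample_dominated z.
have [K2 K20 h2] := sample_dominated (conjc z).
exists (K1 + K2); first exact: addr_ge0.
move=> T j TL jN; have [[k kN [jE sE]]|[k kN [jE sE]]] := laurent_index jN; rewrite sE jE.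
  rewrite laurent_termD //; apply: (le_trans (h1 T k TL kN)).
  by rewrite ler_wpM2r ?expR_ge0 // lerDl.
rewrite laurent_termN // normc_conj sqrrN; apply: (le_trans (h2 T k TL kN)).
by rewrite ler_wpM2r ?expR_ge0 // lerDr.
Qed.

End Pointwise.

(** * Riemann sums and integrals over the line *)

Section StepFunctions.
Context {R : realType}.
Local Notation mu := (@lebesgue_measure R).

Definition step_fun (x0 e : R) (m : nat) (v : nat -> R) (t : R) : R :=
  \sum_(j < m) v j * \1_(`[x0 + e * j%:R, x0 + e * j.+1%:R[%classic) t.

Lemma integrable_step_term (a b c : R) :
  mu.-integrable setT (EFin \o (fun t => c * \1_(`[a, b[%classic) t)).
Proof.
have -> : EFin \o (fun t => c * \1_(`[a, b[%classic) t) =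
    (fun t => c%:E * (EFin \o \1_(`[a, b[%classic : set R)) t)%E by [].
by apply: integrableZl => //; exact: integrable_indic_itv.
Qed.

Lemma integrable_step_fun x0 e m v : mu.-integrable setT (EFin \o step_fun x0 e m v).
Proof.
have -> : EFin \o step_fun x0 e m v = (fun t => \sum_(j < m)
    (v j * \1_(`[x0 + e * j%:R, x0 + e * j.+1%:R[%classic) t)%R%:E)%E.
  by apply/funext => t /=; rewrite sumEFin.
by apply: integrable_sum => // j _; exact: integrable_step_term.
Qed.

Lemma measurable_step_fun x0 e m v : measurable_fun setT (step_fun x0 e m v).
Proof.
have /measurable_int h := integrable_step_fun x0 e m v.
by apply/measurable_EFinP.
Qed.

Lemma Rintegral_step_fun x0 e m v : 0 < e ->
  (\int[mu]_t step_fun x0 e m v t) = e * \sum_(j < m) v j.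
Proof.
move=> e0; elim: m => [|m IH].
  rewrite big_ord0 mulr0 -[RHS](mul0r (fine (mu setT))) -(Rintegral_cst mu measurableT 0).
  by apply: eq_Rintegral => t _; rewrite /step_fun big_ord0.
rewrite big_ord_recr /= mulrDr -IH.
have -> : (\int[mu]_t step_fun x0 e m.+1 v t) = \int[mu]_t (step_fun x0 e m v t +
    v m * \1_(`[x0 + e * m%:R, x0 + e * m.+1%:R[%classic) t).
  by apply: eq_Rintegral => t _; rewrite /step_fun big_ord_recr.
rewrite RintegralD //; [|exact: integrable_step_fun|exact: integrable_step_term].
congr (_ + _); rewrite RintegralZl //; last exact: integrable_indic_itv.
rewrite mulrC; congr (_ * _).
rewrite /Rintegral integral_indic //= setIT lebesgue_measure_itv /= lte_fin ltrD2l ltr_pM2l //.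
by rewrite ltr_nat ltnSn -EFinB /= -natr1; ring.
Qed.

Lemma step_fun_eq x0 e m v t (j : nat) : 0 < e -> (j < m)%N ->
  x0 + e * j%:R <= t < x0 + e * j.+1%:R -> step_fun x0 e m v t = v j.
Proof.
move=> e0 jm /andP[jt tj]; rewrite /step_fun (bigD1 (Ordinal jm)) //= indicE mem_set; last first.
  by rewrite /= in_itv /= jt.
rewrite mulr1 big1 ?addr0 // => i ij; rewrite indicE memNset ?mulr0 //= in_itv /=.
apply/negP; apply: contra ij => /andP[it ti]; apply/eqP/val_inj => /=.
have h1 : (i < j.+1)%N.
  rewrite -(ltr_nat R) -(ltr_pM2l e0) -(ltrD2l x0); exact: le_lt_trans tj.
have h2 : (j < i.+1)%N.
  rewrite -(ltr_nat R) -(ltr_pM2l e0) -(ltrD2l x0); exact: le_lt_trans ti.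
by apply/eqP; rewrite eqn_leq -ltnS h1 -ltnS h2.
Qed.

Lemma step_fun_index (x0 e : R) (m : nat) (t : R) : 0 < e -> x0 <= t < x0 + e * m%:R ->
  exists2 j, (j < m)%N & x0 + e * j%:R <= t < x0 + e * j.+1%:R.
Proof.
move=> e0 /andP[xt tm]; have h0 : 0 <= (t - x0) / e by rewrite divr_ge0 ?subr_ge0 // ltW.
have := truncn_itv h0; set j := Num.truncn ((t - x0) / e) => /andP[h1 h2].
have {}h1 : x0 + e * j%:R <= t by move: h1; rewrite ler_pdivlMr // mulrC; lra.
have {}h2 : t < x0 + e * j.+1%:R by move: h2; rewrite ltr_pdivrMr // [X in _ < X]mulrC; lra.
exists j; last by rewrite h1.
rewrite -(ltr_nat R) -(ltr_pM2l e0) -(ltrD2l x0); exact: le_lt_trans tm.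
Qed.

Lemma step_fun_out x0 e m v t : 0 < e -> ~ (x0 <= t < x0 + e * m%:R) ->
  step_fun x0 e m v t = 0.
Proof.
move=> e0 h; rewrite /step_fun big1 // => i _; rewrite indicE memNset ?mulr0 //= in_itv /=.
move=> /andP[h1 h2]; apply: h; apply/andP; split.
  by apply: le_trans h1; rewrite lerDl mulr_ge0 // ltW.
by apply: (lt_le_trans h2); rewrite lerD2l ler_pM2l // ler_nat.
Qed.

(** A Riemann sum over growing intervals is the integral of a step function over the whole line, so
    dominated convergence handles the mesh and the ends together. *)
Lemma cvg_step_integral (e x0 : nat -> R) (m : nat -> nat) (v : nat -> nat -> R)
    (f g : R -> R) : (forall n, 0 < e n) -> measurable_fun setT f ->
  (forall t, (fun n => step_fun (x0 n) (e n) (m n) (v n) t) @ \oo --> f t) ->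
  (forall n t, `|step_fun (x0 n) (e n) (m n) (v n) t| <= g t) ->
  mu.-integrable setT (EFin \o g) ->
  (fun n => e n * \sum_(j < m n) v n j) @ \oo --> \int[mu]_t f t.
Proof.
move=> e0 mf cf dg ig.
have h1 n : measurable_fun setT (EFin \o step_fun (x0 n) (e n) (m n) (v n)).
  by apply/measurable_EFinP; exact: measurable_step_fun.
have h2 : measurable_fun setT (EFin \o f) by apply/measurable_EFinP.
have [] := @dominated_convergence _ _ R mu setT measurableT
  (fun n => EFin \o step_fun (x0 n) (e n) (m n) (v n)) (EFin \o f) (EFin \o g) h1 h2 _ ig _.
- apply/aeW => t _; apply: cvg_EFin; last exact: cf.
  by near=> n.
- by apply/aeW => t n _; rewrite /= lee_fin.
move=> intf _ hc.
have E n : (\int[mu]_t (EFin \o step_fun (x0 n) (e n) (m n) (v n)) t)%E =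
    (e n * \sum_(j < m n) v n j)%:E.
  rewrite -(Rintegral_step_fun (x0 n) (m n) (v n) (e0 n)) /Rintegral fineK //.
  exact: integrable_fin_num (integrable_step_fun _ _ _ _).
have E' : (\int[mu]_t (EFin \o f) t)%E = (\int[mu]_t f t)%:E.
  by rewrite /Rintegral fineK //; exact: integrable_fin_num.
rewrite E' in hc; apply: (fine_cvg (f := fun n => (e n * \sum_(j < m n) v n j)%:E)).
by apply: cvg_trans hc; apply: near_eq_cvg; near=> n; exact: E.
Unshelve. all: by end_near.
Qed.

Lemma integrable_gauss_scaled (d : R) : 0 < d ->
  mu.-integrable setT (EFin \o (fun t => expR (- (d * t ^+ 2)))).
Proof.
(* The normal density of variance [(2 * d)^-1] has exponent [- (d * t ^+ 2)]. *)
move=> d0; pose s := Num.sqrt (2 * d)^-1.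
have s0 : 0 < s by rewrite sqrtr_gt0 invr_gt0 mulr_gt0.
have s2 : s ^+ 2 = (2 * d)^-1 by rewrite sqr_sqrtr // invr_ge0 mulr_ge0 // ltW.
have p0 : 0 < normal_peak s by rewrite normal_peak_gt0 // gt_eqF.
have h := integrableZl measurableT (normal_peak s)^-1 (integrable_normal_pdf 0 s).
apply: (@eq_integrable _ _ _ _ _ measurableT _ _ _ h) => t _ /=.
rewrite normal_pdfE ?gt_eqF // -EFinM mulKf ?gt_eqF // /normal_fun subr0 s2.
congr ((expR _)%:E); rewrite -mulr_natl; field; by rewrite gt_eqF.
Qed.

End StepFunctions.

Section KernelContinuity.
Context {R : realType}.

Lemma horner_continuous (p : {poly R}) : continuous (fun t : R => p.[t]).
Proof.
elim/poly_ind: p => [|p c IH].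
  under eq_fun do rewrite horner0; move=> t; exact: cvg_cst.
under eq_fun do rewrite hornerMXaddC; move=> t.
apply: cvgD; last exact: cvg_cst.
by apply: cvgM; [exact: IH|exact: cvg_id].
Qed.

Variables (G : {poly R}) (z : R[i]).

Let kernel_arg (t : R) : R[i] := onI G t - onI G 0 + 'i * t%:C * z.

Let re_arg_continuous : continuous (fun t : R => complex.Re (kernel_arg t)).
Proof.
have E t : complex.Re (kernel_arg t) = (reI G).[t] - (reI G).[0] - complex.Im z * t.
  by rewrite /kernel_arg !(ReCD, ReCN) !Re_onI; case: z => x y /=; ring.
under eq_fun do rewrite E; move=> t; apply: cvgB.
  by apply: cvgB; [exact: horner_continuous|exact: cvg_cst].
by apply: cvgM; [exact: cvg_cst|exact: cvg_id].
Qed.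

Let im_arg_continuous : continuous (fun t : R => complex.Im (kernel_arg t)).
Proof.
have E t : complex.Im (kernel_arg t) = (imI G).[t] - (imI G).[0] + complex.Re z * t.
  by rewrite /kernel_arg !(ImCD, ImCN) !Im_onI; case: z => x y /=; ring.
under eq_fun do rewrite E; move=> t; apply: cvgD.
  by apply: cvgB; [exact: horner_continuous|exact: cvg_cst].
by apply: cvgM; [exact: cvg_cst|exact: cvg_id].
Qed.

Lemma Re_gauss_kernel_continuous : continuous (fun t => complex.Re (gauss_kernel G z t)).
Proof.
rewrite /gauss_kernel; under eq_fun do rewrite Re_cexp.
move=> t; apply: cvgM.
  exact: (@continuous_comp _ _ _ _ (@expR R) t (@re_arg_continuous t) (@continuous_expR R _)).
exact: (@continuous_comp _ _ _ _ (@cos R) t (@im_arg_continuous t) (@continuous_cos R _)).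
Qed.

Lemma Im_gauss_kernel_continuous : continuous (fun t => complex.Im (gauss_kernel G z t)).
Proof.
rewrite /gauss_kernel; under eq_fun do rewrite Im_cexp.
move=> t; apply: cvgM.
  exact: (@continuous_comp _ _ _ _ (@expR R) t (@re_arg_continuous t) (@continuous_expR R _)).
exact: (@continuous_comp _ _ _ _ (@sin R) t (@im_arg_continuous t) (@continuous_sin R _)).
Qed.

End KernelContinuity.

Section SamplingLimit.
Context {R : realType}.
Variables (G : {poly R}) (e0 t0 M0 : R).
Local Notation D := G^`().
Hypotheses (DR : real_rooted D) (sD : (1 < size D)%N).
Hypotheses (e0_gt0 : 0 < e0) (t0_ge1 : 1 <= t0) (M0_ge0 : 0 <= M0).
Hypothesis imD : forall t, t0 <= t -> e0 * t <= complex.Im (onI D t).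
Hypothesis reD : (forall t, t0 <= t -> 0 <= complex.Re (onI D t)) \/
                 (forall t, t0 <= t -> complex.Re (onI D t) <= 0).
Hypothesis M0P : forall t, 0 <= t <= t0 -> normc (onI D t) <= M0.

Local Notation large := (large_T e0 t0 M0).
Local Notation N := (apx_deg D).
Local Notation eps := (apx_step D).
Local Notation mu := (@lebesgue_measure R).

Variables (T : nat -> R) (z : R[i]).
Hypothesis TL : forall n, large (T n).
Hypothesis Ty : forall B : R, \forall n \near \oo, B <= T n.

Let ep n : 0 < eps (T n). Proof. exact: (step_gt0 G t0_ge1 (TL n)). Qed.

(** The [2N+1] nodes run from [- T] to [T]; each cell starts at its node, so the last one ends at
    [T + eps]. *)
Let Tend n : - T n + eps (T n) * (N (T n)).*2.+1%:R = T n + eps (T n).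
Proof.
have h := apx_stepN D (T n).
by rewrite -natr1 -muln2 natrM mulrDr mulr1 mulrA h; ring.
Qed.

Let dist_node n t j :
  - T n + eps (T n) * j%:R <= t < - T n + eps (T n) * j.+1%:R ->
  0 <= t - (eps (T n) * j%:R - T n) <= eps (T n).
Proof.
move=> /andP[h1]; rewrite -[j.+1%:R]natr1 mulrDr mulr1 => h2.
by apply/andP; split; lra.
Qed.

(** [rho] is the real or the imaginary part. At fixed [t] the node of its cell tends to [t]; the
    term there is close to the kernel at the node, and the kernel is continuous. *)
Lemma sampling_cvg_part (rho : R[i] -> R) :
  (forall u v, rho (u - v) = rho u - rho v) -> (forall u, `|rho u| <= normc u) ->
  continuous (fun t => rho (gauss_kernel G z t)) ->
  (fun n => eps (T n) * \sum_(j < (N (T n)).*2.+1) rho (laurent_term G (T n) j z))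
    @ \oo --> \int[mu]_t rho (gauss_kernel G z t).
Proof.
move=> rhoB rho1 rhoc.
have [K K0 hK] := laurent_term_dominated DR sD e0_gt0 t0_ge1 M0_ge0 imD reD M0P z.
have d0 := sample_d_gt0 e0_gt0; set d := sample_d e0 in d0 hK.
apply: (@cvg_step_integral R _ (fun n => - T n) _
  (fun n j => rho (laurent_term G (T n) j z)) (fun t => rho (gauss_kernel G z t))
  (fun t => K * expR d * expR (- (d / 2 * t ^+ 2)))) => //.
- exact: continuous_measurable_fun.
- move=> t; apply/cvgrPdist_le => e e_gt0.
  have tau0 : 0 <= `|t| + 1 by exact: addr_ge0.
  have [C [T2 [C0 hC]]] := laurent_term_approx M0 e0_gt0 t0_ge1 imD z tau0.
  have e2 : 0 < e / 2 by rewrite divr_gt0.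
  have /cvgrPdist_le /(_ _ e2) /nbhs_ballP [del /= del0 hd] := rhoc t.
  near=> n.
  have T2n : T2 <= T n by near: n; exact: Ty.
  have Tt : `|t| <= T n by near: n; exact: Ty.
  have TC : C / (e / 2) <= T n by near: n; exact: Ty.
  have Td : e0^-1 / del + 1 <= T n by near: n; exact: Ty.
  have TT : 0 < T n := T_gt0 t0_ge1 (TL n).
  have tn : - T n <= t < - T n + eps (T n) * (N (T n)).*2.+1%:R.
    rewrite Tend; move: Tt; rewrite ler_norml => /andP[-> h] /=.
    by apply: (le_lt_trans h); rewrite ltrDl.
  have [j jm jt] := step_fun_index (ep n) tn.
  rewrite (step_fun_eq _ (ep n) jm jt).
  have /andP[h1 h2] := dist_node jt.
  set s := eps (T n) * j%:R - T n in h1 h2.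
  have e1 := step_le1 e0_gt0 t0_ge1 imD (TL n).
  have st : `|s| <= `|t| + 1.
    rewrite -[s](subKr t) [t - (t - s)]addrC; rewrite addrC.
    by apply: (le_trans (ler_normB _ _)); rewrite lerD2l ger0_norm //; lra.
  have hV := hC (T n) j (TL n) T2n jm st; rewrite -/s in hV.
  have V2 : `|rho (gauss_kernel G z s) - rho (laurent_term G (T n) j z)| <= e / 2.
    rewrite distrC -rhoB; apply: (le_trans (rho1 _)); apply: (le_trans hV).
    by rewrite ler_pdivrMr // mulrC -ler_pdivrMr.
  have sd : `|t - s| < del.
    rewrite ger0_norm //; apply: (le_lt_trans h2).
    apply: (le_lt_trans (step_bound e0_gt0 t0_ge1 imD (TL n))).
    by rewrite ltr_pdivrMr // mulrC -ltr_pdivrMr //; lra.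
  have h3 := hd s sd.
  rewrite -[X in `|X|](subrKA (rho (gauss_kernel G z s))) (splitr e).
  by apply: (le_trans (ler_normD _ _)); exact: lerD.
- move=> n t; have [tn|/negP tn] := boolP (- T n <= t < - T n + eps (T n) * (N (T n)).*2.+1%:R).
    have [j jm jt] := step_fun_index (ep n) tn.
    rewrite (step_fun_eq _ (ep n) jm jt).
    have /andP[h1 h2] := dist_node jt.
    have h := hK (T n) j (TL n) jm; set s := eps (T n) * j%:R - T n in h1 h2 h.
    have e1 := step_le1 e0_gt0 t0_ge1 imD (TL n).
    apply: (le_trans (rho1 _)); apply: (le_trans h); rewrite -mulrA -expRD.
    apply: ler_wpM2l => //; rewrite ler_expR.
    (* The node [s] is within [eps <= 1] of [t]: half of the Gaussian rate is given up, and [expR d]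
       pays for the constant. *)
    have : t ^+ 2 <= 2 * s ^+ 2 + 2.
      have u1 : (t - s) ^+ 2 <= 1 by rewrite exprn_ile1 //; lra.
      have := sqr_ge0 (2 * s - t); lra.
    rewrite -(ler_pM2l d0); lra.
  rewrite step_fun_out // normr0 mulr_ge0 ?expR_ge0 // mulr_ge0 ?expR_ge0 //.
have -> : EFin \o (fun t => K * expR d * expR (- (d / 2 * t ^+ 2))) =
  (fun t => (K * expR d)%:E * (EFin \o (fun t => expR (- (d / 2 * t ^+ 2)))) t)%E by [].
by apply: integrableZl => //; apply: integrable_gauss_scaled; rewrite divr_gt0.
Unshelve. all: by end_near.
Qed.

Lemma sampling_cvg :
  (fun n => (eps (T n))%:C *
     cayley_sum (N (T n)) (eps (T n) / 2) (apx_laurent D (T n)) z) @ \oo -->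
  (cintegral (gauss_kernel G z) : R[i]^o).
Proof.
have ReB (u v : R[i]) : complex.Re (u - v) = complex.Re u - complex.Re v.
  by rewrite ReCD ReCN.
have ImB (u v : R[i]) : complex.Im (u - v) = complex.Im u - complex.Im v.
  by rewrite ImCD ImCN.
apply/cvgC_ReImP; split.
  have h := @sampling_cvg_part (@complex.Re R) ReB (@normr_Re_le R)
    (@Re_gauss_kernel_continuous R G z).
  apply: cvg_trans h; apply: near_eq_cvg; near=> n.
  by rewrite [X in complex.Re X]mulrC ReCMr mulrC /cayley_sum Re_sum.
have h := @sampling_cvg_part (@complex.Im R) ImB (@normr_Im_le R)
  (@Im_gauss_kernel_continuous R G z).
apply: cvg_trans h; apply: near_eq_cvg; near=> n.
by rewrite [X in complex.Im X]mulrC ImCMr mulrC /cayley_sum Im_sum.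
Unshelve. all: by end_near.
Qed.

End SamplingLimit.

(** * Complex-valued integrals *)

Section ComplexIntegrals.
Context {R : realType}.
Local Notation mu := (@lebesgue_measure R).
Implicit Types (f g : R -> R[i]).

Definition cintegrable f : Prop :=
  mu.-integrable setT (EFin \o (fun t => complex.Re (f t))) /\
  mu.-integrable setT (EFin \o (fun t => complex.Im (f t))).

Lemma integrable_RB (u v : R -> R) :
  mu.-integrable setT (EFin \o u) -> mu.-integrable setT (EFin \o v) ->
  mu.-integrable setT (EFin \o (fun t => u t - v t)).
Proof.
move=> hu hv; have -> : EFin \o (fun t => u t - v t) =
  ((EFin \o u) \- (EFin \o v))%E by apply/funext => t /=; rewrite EFinB.
exact: integrableB.
Qed.

Lemma integrable_RZ (a : R) (u : R -> R) : mu.-integrable setT (EFin \o u) ->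
  mu.-integrable setT (EFin \o (fun t => a * u t)).
Proof.
move=> hu; have -> : EFin \o (fun t => a * u t) = (fun t => a%:E * (EFin \o u) t)%E by [].
exact: integrableZl.
Qed.

Lemma integrable_of_continuous (u g : R -> R) : continuous u ->
  (forall t, `|u t| <= g t) -> mu.-integrable setT (EFin \o g) ->
  mu.-integrable setT (EFin \o u).
Proof.
move=> cu ug ig; apply: (le_integrable measurableT _ _ ig).
  by apply/measurable_EFinP; exact: continuous_measurable_fun.
by move=> t _ /=; rewrite lee_fin (le_trans (ug t)) // ler_norm.
Qed.

Lemma cintegrableB f g : cintegrable f -> cintegrable g ->
  cintegrable (fun t => f t - g t).
Proof.
move=> [f1 f2] [g1 g2]; split.
  by under eq_fun do rewrite ReCD ReCN; exact: integrable_RB.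
by under eq_fun do rewrite ImCD ImCN; exact: integrable_RB.
Qed.

Lemma cintegralB f g : cintegrable f -> cintegrable g ->
  cintegral (fun t => f t - g t) = cintegral f - cintegral g.
Proof.
move=> [f1 f2] [g1 g2]; apply: complex_eqP; rewrite ?(ReCD, ReCN, ImCD, ImCN) /=.
  by under eq_Rintegral do rewrite ReCD ReCN; rewrite RintegralB.
by under eq_Rintegral do rewrite ImCD ImCN; rewrite RintegralB.
Qed.

Lemma cintegrableZ (a : R[i]) f : cintegrable f -> cintegrable (fun t => a * f t).
Proof.
move=> [f1 f2]; split.
  under eq_fun do rewrite ReCM; apply: integrable_RB; exact: integrable_RZ.
under eq_fun do rewrite ImCM -[complex.Im a * _]opprK -mulNr.
by apply: integrable_RB; exact: integrable_RZ.
Qed.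

Lemma cintegralZ (a : R[i]) f : cintegrable f ->
  cintegral (fun t => a * f t) = a * cintegral f.
Proof.
move=> [f1 f2]; apply: complex_eqP; rewrite ?ReCM ?ImCM /=.
  under eq_Rintegral do rewrite ReCM.
  by rewrite RintegralB ?RintegralZl //; exact: integrable_RZ.
under eq_Rintegral do rewrite ImCM.
by rewrite RintegralD ?RintegralZl //; exact: integrable_RZ.
Qed.

(** The two parts are bounded separately, hence the factor 2. *)
Lemma normc_cintegral_le f (g : R -> R) : cintegrable f ->
  mu.-integrable setT (EFin \o g) -> (forall t, normc (f t) <= g t) ->
  normc (cintegral f) <= 2 * \int[mu]_t g t.
Proof.
move=> [f1 f2] ig fg; apply: (le_trans (normc_le_ReIm _)).
have abs (u : R -> R) : mu.-integrable setT (EFin \o u) ->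
    (forall t, `|u t| <= g t) -> `|\int[mu]_t u t| <= \int[mu]_t g t.
  move=> iu ug; apply: (le_trans (le_normr_Rintegral measurableT iu)).
  apply: le_Rintegral => //.
  have -> : EFin \o (fun t => `|u t|) = (abse \o (EFin \o u))%E by [].
  exact: integrable_abse.
rewrite mulr_natl mulr2n; apply: lerD; apply: abs => // t.
  exact: le_trans (normr_Re_le _) (fg t).
exact: le_trans (normr_Im_le _) (fg t).
Qed.

End ComplexIntegrals.

(** * Differentiation under the integral sign *)

Section KernelIntegral.
Context {R : realType}.
Variable G : {poly R}.
Hypothesis Ginf : complex.Re (ceval G ('i * t%:C)) @[t --> +oo_R] --> -oo_R.
Local Notation mu := (@lebesgue_measure R).
Local Notation ker := (gauss_kernel G).

(** The weights [1 + t ^+ 2] and [expR |t|] are those of the second-order remainder of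
    [cexp (i t h)] for [|h| <= 1]. Half of the Gaussian rate of [Re G(it)] absorbs them together
    with [expR (B * |t|)]. *)
Lemma gauss_kernel_decay (B : R) : 0 <= B -> exists K d : R, [/\ 0 <= K, 0 < d &
  forall (z : R[i]) t, `|complex.Im z| <= B ->
    (1 + t ^+ 2) * normc (ker z t) * expR `|t| <= K * expR (- (d * t ^+ 2))].
Proof.
move=> B0; have [e e_gt0 [K hK]] := reI_gaussian_le Ginf.
pose b := B + 1; pose c := complex.Re (onI G 0).
exists ((1 + 4 / e) * expR (K - c + b ^+ 2 / e)), (e / 2); split.
- by rewrite mulr_ge0 ?expR_ge0 // addr_ge0 // divr_ge0 // ltW.
- by rewrite divr_gt0.
move=> z t zB; have n0 := normr_ge0 t.
have t2 : `|t| ^+ 2 = t ^+ 2 by rewrite real_normK ?num_real.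
have nE : normc (ker z t) <= expR (K - e * t ^+ 2 - c + B * `|t|).
  rewrite /gauss_kernel normc_cexp ler_expR !(ReCD, ReCN) -/c; apply: lerD.
    by rewrite lerD2r.
  have -> : complex.Re ('i * t%:C * z) = - (t * complex.Im z).
    by case: z {zB} => x y /=; ring.
  by apply: (le_trans (ler_norm _)); rewrite normrN normrM mulrC; exact: ler_wpM2r.
have pE : 1 + t ^+ 2 <= (1 + 4 / e) * expR (e / 4 * t ^+ 2).
  have h := expR_ge1Dx (e / 4 * t ^+ 2).
  have e4 : 0 <= e / 4 * t ^+ 2 by rewrite mulr_ge0 ?sqr_ge0 // divr_ge0 // ltW.
  have i4 : 0 <= 4 / e by rewrite divr_ge0 // ltW.
  have : (1 + 4 / e) * (1 + e / 4 * t ^+ 2) <= (1 + 4 / e) * expR (e / 4 * t ^+ 2).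
    by rewrite ler_wpM2l // addr_ge0.
  apply: le_trans; have -> : (1 + 4 / e) * (1 + e / 4 * t ^+ 2) =
     1 + t ^+ 2 + 4 / e + e / 4 * t ^+ 2 by field; rewrite gt_eqF.
  lra.
apply: (@le_trans _ _ ((1 + 4 / e) * expR (e / 4 * t ^+ 2) *
    expR (K - e * t ^+ 2 - c + B * `|t|) * expR `|t|)).
  apply: ler_wpM2r; first exact: expR_ge0.
  by apply: ler_pM => //; [rewrite addr_ge0 ?sqr_ge0|exact: normc_ge0].
rewrite -!(mulrA (1 + 4 / e)) -!expRD; apply: ler_wpM2l.
  by rewrite addr_ge0 // divr_ge0 // ltW.
rewrite ler_expR -t2; set x := `|t|.
have : 0 <= e / 4 * (x - 2 * b / e) ^+ 2 by rewrite mulr_ge0 ?sqr_ge0 // divr_ge0 // ltW.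
have -> : e / 4 * (x - 2 * b / e) ^+ 2 = e / 4 * x ^+ 2 - b * x + b ^+ 2 / e.
  by field; rewrite gt_eqF.
by rewrite /b; lra.
Qed.

Lemma gauss_kernel_le_decay (B K d : R) (z : R[i]) (t : R) :
  (1 + t ^+ 2) * normc (ker z t) * expR `|t| <= K * expR (- (d * t ^+ 2)) ->
  normc (ker z t) <= K * expR (- (d * t ^+ 2)) /\
  normc ('i * t%:C * ker z t) <= K * expR (- (d * t ^+ 2)).
Proof.
move=> h; have n0 := normc_ge0 (ker z t); have s0 := sqr_ge0 t.
have e1 : 1 <= expR `|t| by rewrite -[leLHS](expR0 R) ler_expR.
have m : (1 + t ^+ 2) * normc (ker z t) <= K * expR (- (d * t ^+ 2)).
  by apply: le_trans h; rewrite ler_peMr // mulr_ge0 // addr_ge0.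
split; apply: le_trans m; first by rewrite ler_peMl // lerDl.
rewrite (Normc.normcM _ (ker z t)) (Normc.normcM 'i t%:C) normc_i mul1r normc_real.
apply: ler_wpM2r => //.
have : 0 <= (`|t| - 1) ^+ 2 by exact: sqr_ge0.
have : `|t| ^+ 2 = t ^+ 2 by rewrite real_normK ?num_real.
have := normr_ge0 t; lra.
Qed.

Lemma cintegrable_gauss_kernel z : cintegrable (ker z).
Proof.
have [K [d [K0 d0 h]]] := gauss_kernel_decay (normr_ge0 (complex.Im z)).
have ig := integrable_RZ K (integrable_gauss_scaled d0).
split; apply: integrable_of_continuous ig.
- exact: Re_gauss_kernel_continuous.
- move=> t; apply: (le_trans (normr_Re_le _)).
  by have [] := gauss_kernel_le_decay 0 (h z t (lexx _)).
- exact: Im_gauss_kernel_continuous.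
- move=> t; apply: (le_trans (normr_Im_le _)).
  by have [] := gauss_kernel_le_decay 0 (h z t (lexx _)).
Qed.

Lemma cintegrable_gauss_kernel_deriv z : cintegrable (fun t => 'i * t%:C * ker z t).
Proof.
have [K [d [K0 d0 h]]] := gauss_kernel_decay (normr_ge0 (complex.Im z)).
have ig := integrable_RZ K (integrable_gauss_scaled d0).
have cid : continuous (fun t : R => t) by move=> t; exact: cvg_id.
split; apply: integrable_of_continuous ig.
- have E t : complex.Re ('i * t%:C * ker z t) = - (t * complex.Im (ker z t)).
    by case: (ker z t) => x y /=; ring.
  under eq_fun do rewrite E; move=> t; apply: cvgN; apply: cvgM; first exact: cvg_id.
  exact: Im_gauss_kernel_continuous.
- move=> t; apply: (le_trans (normr_Re_le _)).
  by have [] := gauss_kernel_le_decay 0 (h z t (lexx _)).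
- have E t : complex.Im ('i * t%:C * ker z t) = t * complex.Re (ker z t).
    by case: (ker z t) => x y /=; ring.
  under eq_fun do rewrite E; move=> t; apply: cvgM; first exact: cvg_id.
  exact: Re_gauss_kernel_continuous.
- move=> t; apply: (le_trans (normr_Im_le _)).
  by have [] := gauss_kernel_le_decay 0 (h z t (lexx _)).
Qed.

Lemma gauss_kernelD z h t : ker (z + h) t = ker z t * cexp ('i * t%:C * h).
Proof. by rewrite /gauss_kernel -cexpD; congr cexp; ring. Qed.

(** [cexp_taylor2] bounds the pointwise remainder by [normc h ^+ 2] times a function of [t] that is
    integrable against the kernel. A quadratic remainder gives the complex derivative without any
    exchange of limits. *)
Lemma cintegral_kernel_taylor z : exists2 C : R, 0 <= C & forall h, normc h <= 1 ->
  normc (cintegral (ker (z + h)) - cintegral (ker z)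
    - h * cintegral (fun t => 'i * t%:C * ker z t)) <= C * normc h ^+ 2.
Proof.
have [K [d [K0 d0 hd]]] := gauss_kernel_decay (normr_ge0 (complex.Im z)).
have ig := integrable_gauss_scaled d0.
exists (2 * (21 * K * \int[mu]_t expR (- (d * t ^+ 2)))).
  by rewrite !mulr_ge0 // Rintegral_ge0 // => t _; exact: expR_ge0.
move=> h h1; have nh := normc_ge0 h.
have i1 := cintegrable_gauss_kernel (z + h); have i2 := cintegrable_gauss_kernel z.
have i3 := cintegrable_gauss_kernel_deriv z.
have i12 := cintegrableB i1 i2; have i3h := cintegrableZ h i3.
rewrite -cintegralB // -cintegralZ // -(cintegralB i12 i3h).
have igh := integrable_RZ (21 * K * normc h ^+ 2) ig.
apply: (le_trans (normc_cintegral_le (cintegrableB i12 i3h) igh _)); last first.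
  by rewrite RintegralZl // le_eqVlt; apply/orP; left; apply/eqP; ring.
move=> t; rewrite gauss_kernelD.
have -> : ker z t * cexp ('i * t%:C * h) - ker z t - h * ('i * t%:C * ker z t) =
  ker z t * (cexp ('i * t%:C * h) - 1 - 'i * t%:C * h) by ring.
rewrite Normc.normcM.
have nx : normc ('i * t%:C * h) = `|t| * normc h.
  by rewrite !Normc.normcM normc_i mul1r normc_real.
have h2 := cexp_taylor2 ('i * t%:C * h); rewrite nx in h2.
have e1 : expR (`|t| * normc h) <= expR `|t| by rewrite ler_expR ler_piMr.
have t2 : `|t| ^+ 2 = t ^+ 2 by rewrite real_normK ?num_real.
have h3 : normc (cexp ('i * t%:C * h) - 1 - 'i * t%:C * h) <=
    21 * normc h ^+ 2 * ((1 + t ^+ 2) * expR `|t|).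
  apply: (le_trans h2); rewrite exprMn t2.
  have -> : 21 * (t ^+ 2 * normc h ^+ 2) * expR (`|t| * normc h) =
    21 * normc h ^+ 2 * (t ^+ 2 * expR (`|t| * normc h)) by ring.
  apply: ler_wpM2l; first by apply: mulr_ge0 => //; exact: sqr_ge0.
  by apply: ler_pM => //; rewrite ?sqr_ge0 ?expR_ge0 // lerDr.
apply: (le_trans (ler_wpM2l (normc_ge0 _) h3)).
have := hd z t (lexx _); rewrite -(ler_pM2l (ltr0n R 21)) => h4.
have h5 : normc h ^+ 2 * (21 * ((1 + t ^+ 2) * normc (ker z t) * expR `|t|)) <=
    normc h ^+ 2 * (21 * (K * expR (- (d * t ^+ 2)))) by apply: ler_wpM2l => //; exact: sqr_ge0.
lra.
Qed.

Lemma entire_cintegral_kernel (a : R[i]) : entire (fun z => a * cintegral (ker z)).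
Proof.
move=> z; have [C C0 hC] := cintegral_kernel_taylor z.
set L := cintegral (fun t => 'i * t%:C * ker z t) in hC.
apply/cvg_ex; exists (a * L : R[i]^o); apply/cvgC_normcP => e e0.
have A0 : 0 < normc a * C + 1 by rewrite ltr_wpDl // mulr_ge0 ?normc_ge0.
have near_h (dl : R) : 0 < dl -> \forall h \near (0 : R[i]^o)^', normc h < dl.
  move=> dl0; have /cvgC_normcP /(_ dl dl0) : (id : R[i] -> R[i]) @ (0 : R[i]^o)^' --> (0 : R[i]^o).
    exact: cvg_within.
  by apply: filterS => h; rewrite subr0.
near=> h.
have h0 : h != 0 by near: h; exact: nbhs_dnbhs_neq.
have h1 : normc h < 1 by near: h; exact: near_h.
have h2 : normc h < e / (normc a * C + 1) by near: h; apply: near_h; rewrite divr_gt0.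
have nh : 0 < normc h by rewrite normc_gt0.
rewrite ltr_pdivlMr // in h2.
have -> : h^-1 *: (a * cintegral (ker (h *: (1 : R[i]^o) + z)) - a * cintegral (ker z)) - a * L =
    h^-1 * (a * (cintegral (ker (z + h)) - cintegral (ker z) - h * L)).
  have -> : h *: (1 : R[i]^o) + z = z + h by rewrite addrC; congr (_ + _); exact: mulr1.
  move: (cintegral (ker (z + h))) (cintegral (ker z)) => X Y.
  have E : h^-1 * (a * X - a * Y) - a * L = h^-1 * (a * (X - Y - h * L)) by field.
  exact: E.
rewrite Normc.normcM Normc.normcV Normc.normcM mulrC ltr_pdivrMr //.
have := hC h (ltW h1) => h3.
apply: (le_lt_trans (ler_wpM2l (normc_ge0 a) h3)).
have : normc h * (normc h * (normc a * C + 1)) < normc h * e by rewrite ltr_pM2l.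
have : 0 <= normc h * normc h by rewrite mulr_ge0 // ltW.
lra.
Unshelve. all: by end_near.
Qed.

End KernelIntegral.

(** * Assembly: constants for [G], approximants, limit *)

Unset Implicit Arguments.

Theorem corollary5p5 (R : realType) (G : {poly R}) (F : R[i] -> R[i])
  (G_pinfty : complex.Re (ceval G ('i * t%:C)) @[t --> +oo_R] --> -oo_R)
  (G_ninfty : complex.Re (ceval G ('i * t%:C)) @[t --> -oo_R] --> -oo_R)
  (dG_LP : laguerre_polya (ceval G^`()))
  (F_int : forall z : R[i],
     F z = cintegral (fun t : R =>
       cexp (ceval G ('i * t%:C)) * cexp ('i * t%:C * z))) :
  laguerre_polya F.
Proof.
have sD := size_deriv_gt1 G_pinfty.
have D0 : G^`() != 0 by rewrite -size_poly_gt0 (ltn_trans _ sD).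
have DR : real_rooted G^`() := laguerre_polya_real_rooted D0 dG_LP.
have [e0 e0_gt0 [t1 h1]] := imI_deriv_ge G_pinfty.
(* [re_slope] requires [Re G'(it)] to keep its sign for large [t], as every real polynomial does. *)
have [t2 h2] := poly_eventually_signed (reI G^`()).
pose t0 := Num.max 1 (Num.max t1 t2).
have t0_ge1 : 1 <= t0 by rewrite le_max lexx.
have t0_t1 : t1 <= t0 by rewrite !le_max lexx orbT.
have t0_t2 : t2 <= t0 by rewrite !le_max lexx !orbT.
have imD t : t0 <= t -> e0 * t <= complex.Im (onI G^`() t).
  by move=> h; apply: h1; exact: le_trans t0_t1 h.
have reD : (forall t, t0 <= t -> 0 <= complex.Re (onI G^`() t)) \/
    (forall t, t0 <= t -> complex.Re (onI G^`() t) <= 0).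
  by case: h2 => h2; [left|right] => t ht; rewrite Re_onI; apply: h2; exact: le_trans t0_t2 ht.
have [M0 M0_ge0 M0P] := onI_bounded G^`() (le_trans ler01 t0_ge1).
pose B := Num.max (2 * t0 + 1) (Num.max (2 / e0) (4 * bnd_M t0 M0 / e0)).
(* Any real [T] is admissible, because the step is defined as [T / N]; adding [B] makes every member
   of the sequence satisfy [large_T]. *)
pose T (n : nat) : R := n%:R + B.
have BT n : B <= T n by rewrite lerDr.
have TL n : large_T e0 t0 M0 (T n).
  by split; apply: le_trans (BT n); rewrite !le_max lexx ?orbT.
have Ty (C : R) : \forall n \near \oo, C <= T n.
  exists (Num.truncn `|C - B|).+1 => // n /= hn.
  have := truncnS_gt `|C - B|; rewrite -(ler_nat R) in hn.
  by have := ler_norm (C - B); rewrite /T; lra.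
have h n : exists As : R * seq R, forall z, cayley_sum (apx_deg G^`() (T n))
    (apx_step G^`() (T n) / 2) (apx_laurent G^`() (T n)) z =
    As.1%:C * \prod_(a <- As.2) (z - a%:C).
  have TT := T_gt0 t0_ge1 (TL n); have im := imD_gt0 e0_gt0 t0_ge1 imD (TL n).
  have d0 : 0 < apx_step G^`() (T n) / 2.
    by apply: divr_gt0 => //; exact: apx_step_gt0.
  have [A [s As]] := cayley_sum_factor d0 (size_apx_laurent TT im DR sD)
    (apx_laurent_roots TT im DR sD) (@apx_laurent_sym R G^`() (T n)).
  by exists (A, s).
have [As hAs] := choice h.
pose a : R := expR (complex.Re (onI G 0)).
(* [G(0)] is real: by [onIN] at 0 it is its own conjugate. The constant removed from [gauss_kernel]
   is thus a real factor and can be merged into the leading coefficients. *)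
have aE : cexp (onI G 0) = a%:C.
  rewrite -cexp_real; congr cexp; apply: complex_eqP => //=.
  have := congr1 (@complex.Im R) (onIN G 0); rewrite oppr0 ImCJ; lra.
have FE : F = fun z => a%:C * cintegral (gauss_kernel G z).
  apply/funext => z; rewrite F_int -cintegralZ; last exact: cintegrable_gauss_kernel.
  congr cintegral; apply/funext => t.
  by rewrite -aE /gauss_kernel -!cexpD; congr cexp; rewrite [RHS]addrA [onI G 0 + _]addrC subrK.
apply: (@laguerre_polya_limit R F
  (fun n => a * (apx_step G^`() (T n) * (As n).1)) (fun n => (As n).2)).
  by rewrite FE; exact: entire_cintegral_kernel G_pinfty _.
move=> z; rewrite FE.
have hs := sampling_cvg DR sD e0_gt0 t0_ge1 M0_ge0 imD reD M0P TL Ty (z := z).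
have hm : (fun n => a%:C * ((apx_step G^`() (T n))%:C * cayley_sum (apx_deg G^`() (T n))
    (apx_step G^`() (T n) / 2) (apx_laurent G^`() (T n)) z)) @ \oo -->
    (a%:C * cintegral (gauss_kernel G z) : R[i]^o).
  by apply: cvgC_mul hs; exact: cvgC_cst.
apply: cvg_trans hm; apply: near_eq_cvg; near=> n.
rewrite hAs (rmorphM (real_complex R) a) (rmorphM (real_complex R) (apx_step _ _)).
by rewrite -!mulrA.
Unshelve. all: by end_near.
Qed.
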